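(* Let $\mathcal P$ be a locally trivial QPFB with differential structure $\Gamma(\mathcal P)$ and covering completion $\Gamma_c(\mathcal P)$. Left (respectively right) covariant derivatives are in bijective correspondence to families of linear maps $A_{l_i}:H\to\Gamma^1(B_i)$ (respectively $A_{r_i}:H\to\Gamma^1(B_i)$), $i\in I$, with the properties, where $A_i$ stands for $A_{l_i}$ (respectively $A_{r_i}$), $$A_i(1)=0,$$ $$\pi^i_{j_{\Gamma_m}}(A_i(h))=\sum\tau_{ij}(h_1)\,\pi^j_{i_{\Gamma_m}}(A_j(h_2))\,\tau_{ji}(h_3)+\sum\tau_{ij}(h_1)\,d\tau_{ji}(h_2)\quad\text{in }\Gamma_m(B_{ij}),$$ for all $h\in H$, $i,j\in I$.
   Context: All algebras are associative and unital over $\mathbb C$; ideals are two-sided; $H$ is a Hopf algebra over $\mathbb C$ with coproduct $\Delta$, counit $\varepsilon$ and invertible antipode $S$; $\Delta(h)=\sum h_1\otimes h_2$. A covering of an algebra $B$ is a finite family $(J_i)_{i\in I}$ of ideals with $\bigcap_i J_i=0$. Put $B_i=B/J_i$, $B_{ij}=B/(J_i+J_j)$, with canonical projections $\pi_i:B\to B_i$, $\pi^i_j:B_i\to B_{ij}$. The covering is complete if $b\mapsto (b+J_i)_{i\in I}$ maps $B$ onto $\{(b_i)_i\in\bigoplus_i B_i\mid \pi^i_j(b_i)=\pi^j_i(b_j)\ \forall i\ne j\}$. A locally trivial quantum principal fibre bundle (QPFB) is a tuple $(\mathcal P,\Delta_{\mathcal P},H,B,\iota,(\chi_i,J_i)_{i\in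 I})$ where $\mathcal P$ is a right $H$-comodule algebra with coaction $\Delta_{\mathcal P}$, $(J_i)_{i\in I}$ is a complete covering of $B$, $\chi_i:\mathcal P\to B_i\otimes H$ are surjective homomorphisms, $\iota:B\to\mathcal P$ is an injective homomorphism, $(\mathrm{id}\otimes\Delta)\circ\chi_i=(\chi_i\otimes\mathrm{id})\circ\Delta_{\mathcal P}$, $\chi_i\circ\iota(a)=\pi_i(a)\otimes1$, $(\ker\chi_i)_{i\in I}$ is a complete covering of $\mathcal P$, and $\iota(B)=\{f\mid\Delta_{\mathcal P}(f)=f\otimes1\}$. There are isomorphisms $\phi_{ij}:B_{ij}\otimes H\to B_{ij}\otimes H$ determined by $(\pi^i_j\otimes\mathrm{id})\circ\chi_i=\phi_{ij}\circ(\pi^j_i\otimes\mathrm{id})\circ\chi_j$; the transition functions are the homomorphisms $\tau_{ji}:H\to B_{ij}$, $\tau_{ji}(h)=(\mathrm{id}\otimes\varepsilon)\phi_{ij}(1\otimes h)$ (central valued), and $\phi_{ij}(a\otimes h)=\sum a\tau_{ji}(h_1)\otimes h_2$. A differential algebra over $B$ is an $\mathbb N$-graded algebra $\Gamma(B)=\bigoplus_n\Gamma^n(B)$ with $\Gamma^0(B)=B$ and a graded derivation $d$ of degree 1, $d^2=0$; it is a differential calculus if it is generated as an algebra by $B$ and $dB$. A differential ideal is a $d$-invariant graded ideal. $\Omega(B)$ is the universal differential calculus; each calculus is $\Omega(B)/J(B)$ for a unique differential ideal $J(B)$. An algebra homomorphism $\psi:A\to B$ always extends to a homomorphism of differential algebras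 $\psi_{\Omega\to\Gamma}:\Omega(A)\to\Gamma(B)$. $\Gamma(A)\hat\otimes\Gamma(B)$ is the vector space $\Gamma(A)\otimes\Gamma(B)$ with $(\gamma\hat\otimes\rho)(\omega\hat\otimes\tau)=(-1)^{mn}\gamma\omega\hat\otimes\rho\tau$ for $\omega\in\Gamma^n(A)$, $\rho\in\Gamma^m(B)$, and $d(\gamma\hat\otimes\rho)=d\gamma\hat\otimes\rho+(-1)^n\gamma\hat\otimes d\rho$ for $\gamma\in\Gamma^n(A)$. A calculus $\Gamma(H)$ is right covariant if $\Delta^\Gamma(h_0dh_1\cdots dh_n)=\Delta(h_0)\,(d\otimes\mathrm{id})\Delta(h_1)\cdots(d\otimes\mathrm{id})\Delta(h_n)$ is a well-defined right coaction $\Gamma(H)\to\Gamma(H)\otimes H$. A differential structure on $\mathcal P$ is the calculus $\Gamma(\mathcal P)=\Omega(\mathcal P)/\bigcap_i\ker\chi_{i_{\Omega\to\Gamma}}$ determined by calculi $\Gamma(B_i)$ over $B_i$ and a right covariant calculus $\Gamma(H)$, where $\chi_{i_{\Omega\to\Gamma}}:\Omega(\mathcal P)\to\Gamma(B_i)\hat\otimes\Gamma(H)$; $\chi_{i_\Gamma}:\Gamma(\mathcal P)\to\Gamma(B_i)\hat\otimes\Gamma(H)$ are the induced maps. Similarly $\Gamma(B)=\Omega(B)/\bigcap_i\ker\pi_{i_{\Omega\to\Gamma}}$ with induced $\pi_{i_\Gamma}:\Gamma(B)\to\Gamma(B_i)$. Put $\Gamma^i(B_{ij}\otimes H):=(\Gamma(B_i)\hat\otimes\Gamma(H))/\chi_{i_\Gamma}(\ker\chi_{j_\Gamma})$,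 a calculus over $B_{ij}\otimes H$, with quotient map $(\pi^i_j\otimes\mathrm{id})_\Gamma$; $\phi_{ij}$ extends to an isomorphism $\phi_{ij_\Gamma}:\Gamma^j(B_{ij}\otimes H)\to\Gamma^i(B_{ij}\otimes H)$. The covering completion of $\Gamma(\mathcal P)$ is $$\Gamma_c(\mathcal P)=\{(\gamma_i)_i\in\bigoplus_i\Gamma(B_i)\hat\otimes\Gamma(H)\mid(\pi^i_j\otimes\mathrm{id})_\Gamma(\gamma_i)=\phi_{ij_\Gamma}\circ(\pi^j_i\otimes\mathrm{id})_\Gamma(\gamma_j)\},$$ with $i$-th projections $\chi_{i_{\Gamma_c}}$ and right coaction $\Delta^{\Gamma_c}_{\mathcal P}((\gamma_i)_i)=((\mathrm{id}\otimes\Delta^\Gamma)(\gamma_i))_i$. The covering completion $\Gamma_c(B)$ of $\Gamma(B)$ consists of the $(\rho_i)_i\in\bigoplus_i\Gamma(B_i)$ such that $\rho_i,\rho_j$ have the same image in $\Gamma(B)/(\ker\pi_{i_\Gamma}+\ker\pi_{j_\Gamma})$; $\iota_{\Gamma_c}:\Gamma_c(B)\to\Gamma_c(\mathcal P)$, $(\rho_i)_i\mapsto(\rho_i\hat\otimes1)_i$. Let $J^i(B_{ij}\otimes H)\subset\Omega(B_{ij}\otimes H)$ be the differential ideal of $\Gamma^i(B_{ij}\otimes H)$. The ideals $J^i(B_{ij}\otimes H)\cap\Omega(B_{ij}\otimes1)$ and $J^j(B_{ij}\otimes H)\cap\Omega(B_{ij}\otimes1)$ of $\Omega(B_{ij})$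 coincide, and $\Gamma_m(B_{ij})$ is the quotient of $\Omega(B_{ij})$ by it. Let $\iota^i_{ij_{\Gamma_m}}:\Gamma_m(B_{ij})\to\Gamma^i(B_{ij}\otimes H)$ be the injection $a_0da_1\cdots da_n\mapsto(a_0\otimes1)d(a_1\otimes1)\cdots d(a_n\otimes1)$, and define $\pi^i_{j_{\Gamma_m}}:\Gamma(B_i)\to\Gamma_m(B_{ij})$ by $\iota^i_{ij_{\Gamma_m}}\circ\pi^i_{j_{\Gamma_m}}(\gamma)=(\pi^i_j\otimes\mathrm{id})_\Gamma(\gamma\hat\otimes1)$. Horizontal forms: $\mathrm{hor}\,\Gamma_c(\mathcal P)=\{\gamma\in\Gamma_c(\mathcal P)\mid\chi_{i_{\Gamma_c}}(\gamma)\in\Gamma(B_i)\hat\otimes H\ \forall i\in I\}$. A left (right) covariant derivative is a linear map $D=D_l$ ($D=D_r$) from $\mathrm{hor}\,\Gamma_c(\mathcal P)$ to itself with: $D(\mathrm{hor}\,\Gamma^n_c(\mathcal P))\subset\mathrm{hor}\,\Gamma^{n+1}_c(\mathcal P)$; $D(1)=0$; in the left case $D_l(\iota_{\Gamma_c}(\gamma)\alpha)=(d\iota_{\Gamma_c}(\gamma))\alpha+(-1)^n\iota_{\Gamma_c}(\gamma)D_l(\alpha)$ for $\gamma\in\Gamma^n_c(B)$, $\alpha\in\mathrm{hor}\,\Gamma_c(\mathcal P)$; in the right case $D_r(\alpha\iota_{\Gamma_c}(\gamma))=D_r(\alpha)\iota_{\Gamma_c}(\gamma)+(-1)^n\alpha\,d\iota_{\Gamma_c}(\gamma)$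 for $\gamma\in\Gamma_c(B)$, $\alpha\in\mathrm{hor}\,\Gamma^n_c(\mathcal P)$; $(D\otimes\mathrm{id})\circ\Delta^{\Gamma_c}_{\mathcal P}=\Delta^{\Gamma_c}_{\mathcal P}\circ D$; and $D(\ker\chi_{i_{\Gamma_c}}|_{\mathrm{hor}\,\Gamma_c(\mathcal P)})\subset\ker\chi_{i_{\Gamma_c}}|_{\mathrm{hor}\,\Gamma_c(\mathcal P)}$ for all $i\in I$. *)

(* Defs.v *)
From HB Require Import structures.
From mathcomp Require Import all_boot all_order all_algebra.
From mathcomp Require Import boolp classical_sets reals.
From mathcomp.real_closed Require Import complex.

Set Implicit Arguments.
Unset Strict Implicit.
Unset Printing Implicit Defensive.

Import GRing.Theory.
Local Open Scope ring_scope.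
Local Open Scope quotient_scope.

Definition bilin (k : fieldType) (U V W : lmodType k) (f : U -> V -> W) : Prop :=
  (forall v, linear (f^~ v)) /\ (forall u, linear (f u)).

(* MathComp's [algType] excludes the zero algebra, but a quotient by a sum of
   ideals may be zero. *)
HB.mixin Record isUAlgebra (k : fieldType) A of GRing.Lmodule k A := {
  uone : A;
  umul : A -> A -> A;
  umulA : associative umul;
  umul1l : left_id uone umul;
  umul1r : right_id uone umul;
  umulDl : left_distributive umul +%R;
  umulDr : right_distributive umul +%R;
  uscaleAl : forall (a : k) (x y : A), a *: umul x y = umul (a *: x) y;
  uscaleAr : forall (a : k) (x y : A), a *: umul x y = umul x (a *: y) }.

#[short(type="ualgType")]
HB.structure Definition UAlgebra (k : fieldType) :=
  {A of GRing.Lmodule k A & isUAlgebra k A}.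

HB.instance Definition _ (k : fieldType) (A : ualgType k) :=
  GRing.Zmodule_isPzRing.Build (UAlgebra.sort A) umulA umul1l umul1r umulDl umulDr.

Section UAlgebraTheory.
Variables (k : fieldType) (A : ualgType k).
Lemma uscalerAl (a : k) (x y : A) : a *: (x * y) = (a *: x) * y.
Proof. exact: uscaleAl. Qed.
Lemma uscalerAr (a : k) (x y : A) : a *: (x * y) = x * (a *: y).
Proof. exact: uscaleAr. Qed.
Lemma umul_bilin : bilin (fun x y : A => x * y).
Proof.
split=> [y|x] a u v; first by rewrite mulrDl -uscalerAl.
by rewrite mulrDr -uscalerAr.
Qed.
End UAlgebraTheory.

Record alg_hom (k : fieldType) (A B : ualgType k) (f : A -> B) : Prop := AlgHom {
  ah_lin : linear f;
  ah_one : f 1 = 1;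
  ah_mul : {morph f : x y / x * y} }.

Definition subalgebra (k : fieldType) (A : ualgType k) (S : A -> Prop) : Prop :=
  [/\ S 1, forall (a : k) x y, S x -> S y -> S (a *: x + y)
         & forall x y, S x -> S y -> S (x * y)].

Section LinFacts.
Variables (k : fieldType) (U V : lmodType k) (f : U -> V).
Hypothesis fL : linear f.
Lemma lin0 : f 0 = 0.
Proof. by have := fL (-1) 0 0; rewrite scaler0 addr0 scaleN1r addNr. Qed.
Lemma linD x y : f (x + y) = f x + f y.
Proof. by have := fL 1 x y; rewrite !scale1r. Qed.
Lemma linZ a x : f (a *: x) = a *: f x.
Proof. by have := fL a x 0; rewrite !addr0 lin0 addr0. Qed.
Lemma linN x : f (- x) = - f x.
Proof. by rewrite -scaleN1r linZ scaleN1r. Qed.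
Lemma linB x y : f (x - y) = f x - f y.
Proof. by rewrite linD linN. Qed.
Lemma lin_sum (T : Type) (r : seq T) (P : pred T) (F : T -> U) :
  f (\sum_(i <- r | P i) F i) = \sum_(i <- r | P i) f (F i).
Proof. by apply: (big_morph f); [exact: linD|exact: lin0]. Qed.
End LinFacts.

Lemma lin_id (k : fieldType) (U : lmodType k) : linear (@id U).
Proof. by []. Qed.

Lemma lin_comp (k : fieldType) (U V W : lmodType k) (f : V -> W) (g : U -> V) :
  linear f -> linear g -> linear (fun x => f (g x)).
Proof. by move=> fL gL a x y; rewrite gL fL. Qed.

Lemma alg_hom_comp (k : fieldType) (A B C : ualgType k) (f : B -> C) (g : A -> B) :
  alg_hom f -> alg_hom g -> alg_hom (fun x => f (g x)).
Proof.
move=> [fL f1 fM] [gL g1 gM]; split; first exact: (lin_comp fL gL).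
- by rewrite g1 f1.
- by move=> x y; rewrite gM fM.
Qed.

Record tideal (k : fieldType) (A : ualgType k) := TIdeal {
  tideal_mem :> A -> Prop;
  tideal0 : tideal_mem 0;
  tidealZD : forall (a : k) x y, tideal_mem x -> tideal_mem y -> tideal_mem (a *: x + y);
  tidealMl : forall x y, tideal_mem y -> tideal_mem (x * y);
  tidealMr : forall x y, tideal_mem x -> tideal_mem (x * y) }.

Section QuotientAlgebra.
Variables (k : fieldType) (A : ualgType k) (J : tideal A).

Lemma tidealD x y : J x -> J y -> J (x + y).
Proof. by move=> Jx Jy; rewrite -[x]scale1r; apply: tidealZD. Qed.
Lemma tidealZ (a : k) x : J x -> J (a *: x).
Proof. by move=> Jx; rewrite -[a *: x]addr0; apply: tidealZD => //; apply: tideal0. Qed.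
Lemma tidealN x : J x -> J (- x).
Proof. by move=> Jx; rewrite -scaleN1r; apply: tidealZ. Qed.
Lemma tidealB x y : J x -> J y -> J (x - y).
Proof. by move=> Jx Jy; apply: tidealD => //; apply: tidealN. Qed.

Definition tideal_rel (x y : A) : bool := `[< J (x - y) >].

Lemma tideal_rel_refl : reflexive tideal_rel.
Proof. by move=> x; apply/asboolP; rewrite subrr; apply: tideal0. Qed.
Lemma tideal_rel_sym : symmetric tideal_rel.
Proof.
by move=> x y; apply/asboolP/asboolP => h; rewrite -opprB; apply: tidealN.
Qed.
Lemma tideal_rel_trans : transitive tideal_rel.
Proof.
move=> y x z /asboolP h1 /asboolP h2; apply/asboolP.
by rewrite -(subrKA y); apply: tidealD.
Qed.

Canonical tideal_equiv :=
  EquivRel tideal_rel tideal_rel_refl tideal_rel_sym tideal_rel_trans.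

Definition aquot := {eq_quot tideal_equiv}.
HB.instance Definition _ := Choice.on aquot.

Definition aproj (x : A) : aquot := \pi_{eq_quot tideal_equiv} x.
Definition arepr (x : aquot) : A := repr x.

Lemma areprK x : aproj (arepr x) = x.
Proof. exact: reprK. Qed.
Lemma aprojP x y : aproj x = aproj y <-> J (x - y).
Proof.
split; first by move/eqmodP/asboolP.
by move=> h; apply/eqmodP/asboolP.
Qed.
Lemma aproj_repr x : J (arepr (aproj x) - x).
Proof. by apply/aprojP; rewrite areprK. Qed.
Lemma aquotW (P : aquot -> Prop) : (forall x, P (aproj x)) -> forall x, P x.
Proof. by move=> h x; rewrite -(areprK x). Qed.

Let qadd x y := aproj (arepr x + arepr y).
Let qopp x := aproj (- arepr x).
Let qmul x y := aproj (arepr x * arepr y).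
Let qscale (a : k) x := aproj (a *: arepr x).

Let qaddE x y : qadd (aproj x) (aproj y) = aproj (x + y).
Proof. by apply/aprojP; rewrite opprD addrACA; apply: tidealD; apply: aproj_repr. Qed.
Let qoppE x : qopp (aproj x) = aproj (- x).
Proof. by apply/aprojP; rewrite -opprD; apply: tidealN; apply: aproj_repr. Qed.
Let qscaleE a x : qscale a (aproj x) = aproj (a *: x).
Proof. by apply/aprojP; rewrite -scalerBr; apply: tidealZ; apply: aproj_repr. Qed.
Let qmulE x y : qmul (aproj x) (aproj y) = aproj (x * y).
Proof.
apply/aprojP; set x' := arepr _; set y' := arepr _.
have -> : x' * y' - x * y = (x' - x) * y' + x * (y' - y).
  by rewrite mulrBl mulrBr addrA subrK.
by apply: tidealD; [apply: tidealMr|apply: tidealMl]; apply: aproj_repr.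
Qed.

Let qaddA : associative qadd.
Proof. by elim/aquotW=> x; elim/aquotW=> y; elim/aquotW=> z; rewrite !qaddE addrA. Qed.
Let qaddC : commutative qadd.
Proof. by elim/aquotW=> x; elim/aquotW=> y; rewrite !qaddE addrC. Qed.
Let qadd0 : left_id (aproj 0) qadd.
Proof. by elim/aquotW=> x; rewrite qaddE add0r. Qed.
Let qaddN : left_inverse (aproj 0) qopp qadd.
Proof. by elim/aquotW=> x; rewrite qoppE qaddE addNr. Qed.

HB.instance Definition _ := GRing.isZmodule.Build aquot qaddA qaddC qadd0 qaddN.

Let qmulA : associative qmul.
Proof. by elim/aquotW=> x; elim/aquotW=> y; elim/aquotW=> z; rewrite !qmulE mulrA. Qed.
Let qmul1l : left_id (aproj 1) qmul.
Proof. by elim/aquotW=> x; rewrite qmulE mul1r. Qed.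
Let qmul1r : right_id (aproj 1) qmul.
Proof. by elim/aquotW=> x; rewrite qmulE mulr1. Qed.
Let qmulDl : left_distributive qmul qadd.
Proof.
by elim/aquotW=> x; elim/aquotW=> y; elim/aquotW=> z; rewrite !(qmulE, qaddE) mulrDl.
Qed.
Let qmulDr : right_distributive qmul qadd.
Proof.
by elim/aquotW=> x; elim/aquotW=> y; elim/aquotW=> z; rewrite !(qmulE, qaddE) mulrDr.
Qed.

Let qscaleA (a b : k) (x : aquot) : qscale a (qscale b x) = qscale (a * b) x.
Proof. by elim/aquotW: x => x; rewrite !qscaleE scalerA. Qed.
Let qscale1 : left_id 1 qscale.
Proof. by elim/aquotW=> x; rewrite qscaleE scale1r. Qed.
Let qscaleDr : right_distributive qscale qadd.
Proof.
by move=> a; elim/aquotW=> x; elim/aquotW=> y; rewrite !(qaddE, qscaleE) scalerDr.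
Qed.
Let qscaleDl (x : aquot) a b : qscale (a + b) x = qadd (qscale a x) (qscale b x).
Proof. by elim/aquotW: x => x; rewrite !(qaddE, qscaleE) scalerDl. Qed.

HB.instance Definition _ :=
  GRing.Zmodule_isLmodule.Build k aquot qscaleA qscale1 qscaleDr qscaleDl.

Let qAl (a : k) (x y : aquot) : qscale a (qmul x y) = qmul (qscale a x) y.
Proof.
elim/aquotW: x => x; elim/aquotW: y => y.
by rewrite qmulE !(qscaleE, qmulE) uscalerAl.
Qed.
Let qAr (a : k) (x y : aquot) : qscale a (qmul x y) = qmul x (qscale a y).
Proof.
elim/aquotW: x => x; elim/aquotW: y => y.
by rewrite qmulE !(qscaleE, qmulE) uscalerAr.
Qed.
HB.instance Definition _ :=
  isUAlgebra.Build k aquot qmulA qmul1l qmul1r qmulDl qmulDr qAl qAr.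
HB.instance Definition _ := GRing.PzRing.copy aquot (UAlgebra.sort aquot).

Lemma aprojD x y : aproj (x + y) = aproj x + aproj y.
Proof. by symmetry; apply: qaddE. Qed.
Lemma aprojZ (a : k) x : aproj (a *: x) = a *: aproj x.
Proof. by symmetry; apply: qscaleE. Qed.
Lemma aprojM x y : aproj (x * y) = aproj x * aproj y.
Proof. by symmetry; apply: qmulE. Qed.
Lemma aproj_hom : alg_hom aproj.
Proof. by split=> [a x y||x y]; rewrite ?aprojD ?aprojZ ?aprojM. Qed.
Lemma aproj_eq0 x : aproj x = 0 <-> J x.
Proof.
have -> : (0 : aquot) = aproj 0 by [].
by split=> [/aprojP|h]; [|apply/aprojP]; rewrite subr0.
Qed.
End QuotientAlgebra.

Section Ideals.
Variables (k : fieldType) (A : ualgType k).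

Definition ideal_add (J K : tideal A) : tideal A.
Proof.
exists (fun x => exists y z, [/\ J y, K z & x = y + z]).
- by exists 0, 0; split; [apply: tideal0|apply: tideal0|rewrite addr0].
- move=> a _ _ [y [z [Jy Kz ->]]] [y' [z' [Jy' Kz' ->]]].
  exists (a *: y + y'), (a *: z + z'); split; try exact: tidealZD.
  by rewrite scalerDr addrACA.
- move=> x _ [y [z [Jy Kz ->]]]; exists (x * y), (x * z).
  by split; try exact: tidealMl; rewrite mulrDr.
- move=> _ x [y [z [Jy Kz ->]]]; exists (y * x), (z * x).
  by split; try exact: tidealMr; rewrite mulrDl.
Defined.

Definition ker_ideal (B : ualgType k) (f : A -> B) (fH : alg_hom f) : tideal A.
Proof.
exists (fun x => f x = 0).
- exact: lin0 (ah_lin fH).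
- by move=> a x y fx fy; rewrite (ah_lin fH) fx fy scaler0 addr0.
- by move=> x y fy; rewrite (ah_mul fH) fy mulr0.
- by move=> x y fx; rewrite (ah_mul fH) fx mul0r.
Defined.

(* If [J] is contained in [K], the projection [b + J |-> b + K]; if [K] is contained
   in [J], a choice of lift from [A/J] to [A/K]. *)
Definition qproj (J K : tideal A) (x : aquot J) : aquot K := aproj K (arepr x).

Definition covering (I : finType) (J : I -> tideal A) : Prop :=
  forall b : A, (forall i, J i b) -> b = 0.

Definition complete_covering (I : finType) (J : I -> tideal A) : Prop :=
  covering J /\
  forall b : (forall i, aquot (J i)),
    (forall i j, i != j ->
       qproj (ideal_add (J i) (J j)) (b i) = qproj (ideal_add (J i) (J j)) (b j)) ->
    exists a : A, forall i, b i = aproj (J i) a.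
End Ideals.

Section Tensor.
Variables (k : fieldType) (U V : lmodType k).

Definition psum (W : zmodType) (f : U -> V -> W) (s : seq (U * V)) : W :=
  \sum_(p <- s) f p.1 p.2.

(* A formal sum [sum_i u_i (x) v_i] is a list of pairs; two of them are
   identified when no bilinear map separates them. *)
Definition tens_rel (s t : seq (U * V)) : bool :=
  `[< forall (W : lmodType k) (f : U -> V -> W), bilin f -> psum f s = psum f t >].

Lemma tens_rel_refl : reflexive tens_rel.
Proof. by move=> s; apply/asboolP. Qed.
Lemma tens_rel_sym : symmetric tens_rel.
Proof. by move=> s t; apply/asboolP/asboolP => h W f fB; rewrite h. Qed.
Lemma tens_rel_trans : transitive tens_rel.
Proof.
by move=> t s r /asboolP h1 /asboolP h2; apply/asboolP => W f fB; rewrite h1 // h2.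
Qed.

Canonical tens_equiv := EquivRel tens_rel tens_rel_refl tens_rel_sym tens_rel_trans.

Definition tensor := {eq_quot tens_equiv}.
HB.instance Definition _ := Choice.on tensor.

Let pr (s : seq (U * V)) : tensor := \pi_{eq_quot tens_equiv} s.

Definition tens (u : U) (v : V) : tensor := pr [:: (u, v)].

(* For [t = sum u_i (x) v_i] and bilinear [f], [tsum f t = sum f u_i v_i]: this is
   the linear map induced by [f], also used for Sweedler sums. *)
Definition tsum (W : zmodType) (f : U -> V -> W) (t : tensor) : W := psum f (repr t).

Let prP s t : pr s = pr t <->
  forall (W : lmodType k) (f : U -> V -> W), bilin f -> psum f s = psum f t.
Proof.
split; first by move/eqmodP/asboolP.
by move=> h; apply/eqmodP/asboolP.
Qed.
Let prK t : pr (repr t) = t. Proof. exact: reprK. Qed.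

Let tsum_pr (W : lmodType k) (f : U -> V -> W) s : bilin f -> tsum f (pr s) = psum f s.
Proof. by move=> fB; apply: (prP _ s).1 => //; rewrite prK. Qed.

Let tensor_eq (s t : tensor) :
  (forall (W : lmodType k) (f : U -> V -> W), bilin f -> tsum f s = tsum f t) -> s = t.
Proof. by move=> h; rewrite -(prK s) -(prK t); apply/prP => W f /h. Qed.

Let tadd (s t : tensor) := pr (repr s ++ repr t).
Let tscale (a : k) (s : tensor) := pr [seq (a *: p.1, p.2) | p <- repr s].
Let topp (s : tensor) := tscale (-1) s.
Let t0 := pr [::].

Let tsum0 (W : lmodType k) (f : U -> V -> W) : bilin f -> tsum f t0 = 0.
Proof. by move=> fB; rewrite tsum_pr // /psum big_nil. Qed.
Let tsumD' (W : lmodType k) (f : U -> V -> W) s t :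
  bilin f -> tsum f (tadd s t) = tsum f s + tsum f t.
Proof. by move=> fB; rewrite tsum_pr // /psum big_cat. Qed.
Let tsumZ' (W : lmodType k) (f : U -> V -> W) a s :
  bilin f -> tsum f (tscale a s) = a *: tsum f s.
Proof.
move=> fB; rewrite tsum_pr // /psum big_map scaler_sumr.
by apply: eq_bigr => p _; rewrite (linZ (fB.1 _)).
Qed.

Let taddA : associative tadd.
Proof. by move=> x y z; apply: tensor_eq => W f fB; rewrite !tsumD' // addrA. Qed.
Let taddC : commutative tadd.
Proof. by move=> x y; apply: tensor_eq => W f fB; rewrite !tsumD' // addrC. Qed.
Let tadd0 : left_id t0 tadd.
Proof. by move=> x; apply: tensor_eq => W f fB; rewrite tsumD' // tsum0 // add0r. Qed.
Let taddN : left_inverse t0 topp tadd.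
Proof.
move=> x; apply: tensor_eq => W f fB.
by rewrite tsumD' // tsum0 // tsumZ' // scaleN1r addNr.
Qed.

HB.instance Definition _ := GRing.isZmodule.Build tensor taddA taddC tadd0 taddN.

Let tscaleA (a b : k) (x : tensor) : tscale a (tscale b x) = tscale (a * b) x.
Proof. by apply: tensor_eq => W f fB; rewrite !tsumZ' // scalerA. Qed.
Let tscale1 : left_id 1 tscale.
Proof. by move=> x; apply: tensor_eq => W f fB; rewrite tsumZ' // scale1r. Qed.
Let tscaleDr : right_distributive tscale +%R.
Proof.
by move=> a x y; apply: tensor_eq => W f fB; rewrite !(tsumZ', tsumD') // scalerDr.
Qed.
Let tscaleDl (x : tensor) : {morph tscale^~ x : a b / a + b}.
Proof.
by move=> a b; apply: tensor_eq => W f fB; rewrite !(tsumZ', tsumD') // scalerDl.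
Qed.

HB.instance Definition _ :=
  GRing.Zmodule_isLmodule.Build k tensor tscaleA tscale1 tscaleDr tscaleDl.

Lemma tsum_lin (W : lmodType k) (f : U -> V -> W) : bilin f -> linear (tsum f).
Proof. by move=> fB a x y; rewrite [LHS]tsumD' // tsumZ'. Qed.

Lemma tsum_tens (W : lmodType k) (f : U -> V -> W) u v :
  bilin f -> tsum f (tens u v) = f u v.
Proof. by move=> fB; rewrite tsum_pr // /psum big_seq1. Qed.

Lemma tens_bilin : bilin tens.
Proof.
by split=> [v|u] a x y; apply: tensor_eq => W f fB;
  rewrite [RHS]tsumD' // tsumZ' // !tsum_tens //; [rewrite (fB.1 v)|rewrite (fB.2 u)].
Qed.

Lemma tensE (t : tensor) : t = tsum tens t.
Proof.
apply: tensor_eq => W f fB.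
have -> : tsum tens t = \sum_(p <- repr t) tens p.1 p.2 by [].
rewrite (lin_sum (tsum_lin fB)).
by apply: eq_bigr => p _; rewrite tsum_tens.
Qed.

Lemma tensor_ind (P : tensor -> Prop) : P 0 -> (forall x y, P x -> P y -> P (x + y)) ->
  (forall u v, P (tens u v)) -> forall t, P t.
Proof.
move=> P0 PD Pt t; rewrite (tensE t) /tsum /psum.
by elim/big_ind: _ => // p _; apply: Pt.
Qed.

Lemma tensor_lin_eq (W : lmodType k) (f g : tensor -> W) : linear f -> linear g ->
  (forall u v, f (tens u v) = g (tens u v)) -> f =1 g.
Proof.
move=> fL gL h; elim/tensor_ind => [|x y fx fy|//]; first by rewrite !lin0.
by rewrite !linD // fx fy.
Qed.
End Tensor.

Notation "u ⊗ v" := (tens u v) (at level 40, left associativity) : ring_scope.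

Section TensorOps.
Variable (k : fieldType).

Definition tmap (U V U' V' : lmodType k) (f : U -> U') (g : V -> V')
  (t : tensor U V) : tensor U' V' := tsum (fun u v => f u ⊗ g v) t.

Definition tassoc (U V W : lmodType k) (t : tensor (tensor U V) W) :
    tensor U (tensor V W) :=
  tsum (fun uv w => tsum (fun u v => u ⊗ (v ⊗ w)) uv) t.

Variables (U V : lmodType k).

Lemma tensDl (u u' : U) (v : V) : (u + u') ⊗ v = u ⊗ v + u' ⊗ v.
Proof. exact: (linD ((tens_bilin U V).1 v)). Qed.
Lemma tensDr (u : U) (v v' : V) : u ⊗ (v + v') = u ⊗ v + u ⊗ v'.
Proof. exact: (linD ((tens_bilin U V).2 u)). Qed.
Lemma tensZl a (u : U) (v : V) : (a *: u) ⊗ v = a *: (u ⊗ v).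
Proof. exact: (linZ ((tens_bilin U V).1 v)). Qed.
Lemma tensZr a (u : U) (v : V) : u ⊗ (a *: v) = a *: (u ⊗ v).
Proof. exact: (linZ ((tens_bilin U V).2 u)). Qed.
Lemma tens0l (v : V) : (0 : U) ⊗ v = 0.
Proof. exact: (lin0 ((tens_bilin U V).1 v)). Qed.
Lemma tens0r (u : U) : u ⊗ (0 : V) = 0.
Proof. exact: (lin0 ((tens_bilin U V).2 u)). Qed.

Lemma bilin_comp (U' V' W : lmodType k) (b : U' -> V' -> W) (f : U -> U') (g : V -> V') :
  bilin b -> linear f -> linear g -> bilin (fun u v => b (f u) (g v)).
Proof.
move=> bB fL gL; split=> [v|u] a x y; first by rewrite fL (bB.1 (g v)).
by rewrite gL (bB.2 (f u)).
Qed.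

Lemma tmap_lin (U' V' : lmodType k) (f : U -> U') (g : V -> V') :
  linear f -> linear g -> linear (tmap f g).
Proof. by move=> fL gL; apply/tsum_lin/bilin_comp => //; apply: tens_bilin. Qed.

Lemma tmap_tens (U' V' : lmodType k) (f : U -> U') (g : V -> V') u v :
  linear f -> linear g -> tmap f g (u ⊗ v) = f u ⊗ g v.
Proof.
by move=> fL gL; rewrite /tmap tsum_tens //; apply: bilin_comp => //; apply: tens_bilin.
Qed.
End TensorOps.

Section TensorBilinear.
Variables (k : fieldType) (U V U' V' W : lmodType k).
Variable f : U -> V -> U' -> V' -> W.
Hypothesis f1 : forall u v, bilin (f u v).
Hypothesis f2 : forall u' v', bilin (fun u v => f u v u' v').

Lemma tsum_bilinl t : bilin (fun u v => tsum (f u v) t).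
Proof.
split=> [v|u] a x y; rewrite /tsum /psum scaler_sumr -big_split /=;
  apply: eq_bigr => p _; [exact: ((f2 p.1 p.2).1 v)|exact: ((f2 p.1 p.2).2 u)].
Qed.

Lemma tsum2_bilin : bilin (fun s t => tsum (fun u v => tsum (f u v) t) s).
Proof.
split=> [t|s]; first exact: tsum_lin (tsum_bilinl t).
move=> a x y; rewrite /tsum -/(tsum _ _) /psum scaler_sumr -big_split /=.
by apply: eq_bigr => p _; apply: (tsum_lin (f1 p.1 p.2)).
Qed.

Lemma tsum2_tens u v u' v' :
  tsum (fun u v => tsum (f u v) (u' ⊗ v')) (u ⊗ v) = f u v u' v'.
Proof.
by rewrite (tsum_tens _ _ (tsum_bilinl _)) (tsum_tens _ _ (f1 u v)).
Qed.
End TensorBilinear.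

Section TensorAlgebra.
Variables (k : fieldType) (A B : ualgType k).

Let tmul (s t : tensor A B) : tensor A B :=
  tsum (fun (a : A) (b : B) => tsum (fun (c : A) (d : B) => (a * c) ⊗ (b * d)) t) s.

Let f1 (a : A) (b : B) : bilin (fun (c : A) (d : B) => (a * c) ⊗ (b * d)).
Proof.
by apply: bilin_comp (tens_bilin A B) _ _; apply: (umul_bilin _).2.
Qed.
Let f2 (c : A) (d : B) : bilin (fun (a : A) (b : B) => (a * c) ⊗ (b * d)).
Proof.
by apply: bilin_comp (tens_bilin A B) _ _; apply: (umul_bilin _).1.
Qed.
Let mB : bilin tmul. Proof. exact: tsum2_bilin. Qed.
Let mE a b c d : tmul (a ⊗ b) (c ⊗ d) = (a * c) ⊗ (b * d).
Proof. by rewrite /tmul tsum2_tens. Qed.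

Let mulDl : left_distributive tmul +%R.
Proof. by move=> x y z; apply: (linD (mB.1 z)). Qed.
Let mulDr : right_distributive tmul +%R.
Proof. by move=> x y z; apply: (linD (mB.2 x)). Qed.
Let mul0l x : tmul 0 x = 0. Proof. exact: (lin0 (mB.1 x)). Qed.
Let mul0r x : tmul x 0 = 0. Proof. exact: (lin0 (mB.2 x)). Qed.

Let mulA : associative tmul.
Proof.
elim/tensor_ind => [y z|x x' hx hx' y z|a b]; first by rewrite !mul0l.
  by rewrite !mulDl hx hx'.
elim/tensor_ind => [z|y y' hy hy' z|c d]; first by rewrite !(mul0l, mul0r).
  by rewrite !(mulDl, mulDr) hy hy'.
elim/tensor_ind => [|z z' hz hz'|e g]; first by rewrite !mul0r.
  by rewrite !mulDr hz hz'.
by rewrite !mE !mulrA.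
Qed.
Let mul1l : left_id ((1 : A) ⊗ (1 : B)) tmul.
Proof.
elim/tensor_ind => [|x y hx hy|a b]; first by rewrite mul0r.
  by rewrite mulDr hx hy.
by rewrite mE !mul1r.
Qed.
Let mul1r : right_id ((1 : A) ⊗ (1 : B)) tmul.
Proof.
elim/tensor_ind => [|x y hx hy|a b]; first by rewrite mul0l.
  by rewrite mulDl hx hy.
by rewrite mE !mulr1.
Qed.
Let mulZl (a : k) x y : a *: tmul x y = tmul (a *: x) y.
Proof. by rewrite (linZ (mB.1 y)). Qed.
Let mulZr (a : k) x y : a *: tmul x y = tmul x (a *: y).
Proof. by rewrite (linZ (mB.2 x)). Qed.

HB.instance Definition _ :=
  isUAlgebra.Build k (tensor A B) mulA mul1l mul1r mulDl mulDr mulZl mulZr.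
HB.instance Definition _ := GRing.PzRing.copy (tensor A B) (UAlgebra.sort (tensor A B)).

Lemma tens_mul (a c : A) (b d : B) : (a ⊗ b) * (c ⊗ d) = (a * c) ⊗ (b * d).
Proof. exact: mE. Qed.
Lemma tens_one : (1 : A) ⊗ (1 : B) = 1 :> tensor A B.
Proof. by []. Qed.
End TensorAlgebra.

(* [gr n] is the projection onto the component of degree [n]. *)
Record dga (k : fieldType) := Dga {
  dga_alg :> ualgType k;
  gr : nat -> dga_alg -> dga_alg;
  dif : dga_alg -> dga_alg;
  gr_lin : forall n, linear (gr n);
  gr_gr : forall m n x, gr m (gr n x) = if m == n then gr n x else 0;
  gr_fin : forall x, exists N, x = \sum_(n < N) gr n x;
  gr_one : gr 0 1 = 1;
  gr_mul : forall m n x y, gr m x = x -> gr n y = y -> gr (m + n) (x * y) = x * y;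
  dif_lin : linear dif;
  dif_gr : forall n x, gr n x = x -> gr n.+1 (dif x) = dif x;
  dif_dif : forall x, dif (dif x) = 0;
  dif_mul : forall n x y, gr n x = x ->
    dif (x * y) = dif x * y + (-1) ^+ n *: (x * dif y) }.

Definition homog (k : fieldType) (G : dga k) (n : nat) (x : G) : Prop := gr n x = x.

Record dga_hom (k : fieldType) (G L : dga k) (f : G -> L) : Prop := DgaHom {
  dh_alg :> alg_hom f;
  dh_gr : forall n x, f (gr n x) = gr n (f x);
  dh_dif : forall x, f (dif x) = dif (f x) }.

Lemma dga_hom_comp (k : fieldType) (G L M : dga k) (f : L -> M) (g : G -> L) :
  dga_hom f -> dga_hom g -> dga_hom (fun x => f (g x)).
Proof.
move=> [fA fG fD] [gA gG gD]; split; first exact: alg_hom_comp.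
- by move=> n x; rewrite gG fG.
- by move=> x; rewrite gD fD.
Qed.

Section DgaTheory.
Variables (k : fieldType) (G : dga k).
Implicit Types x y : G.

Lemma homog_gr n x : homog n (gr n x).
Proof. by rewrite /homog gr_gr eqxx. Qed.

Lemma homogE m n x : homog n x -> gr m x = if m == n then x else 0.
Proof. by move=> h; rewrite -{1}h gr_gr h. Qed.

Lemma homog0 n : homog n (0 : G).
Proof. exact: lin0 (gr_lin n). Qed.

Lemma gr_big x N : x = \sum_(n < N) gr n x -> forall m, (N <= m)%N -> gr m x = 0.
Proof.
move=> e m hm; rewrite e (lin_sum (gr_lin m)) big1 // => i _.
by rewrite gr_gr gtn_eqF // (leq_trans _ hm).
Qed.

Lemma gr_sumE x N : (forall m, (N <= m)%N -> gr m x = 0) -> x = \sum_(n < N) gr n x.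
Proof.
move=> h; have [M hM] := gr_fin x; have h' := gr_big hM.
have aux K K' : (K <= K')%N -> (forall m, (K <= m)%N -> gr m x = 0) ->
    \sum_(n < K) gr n x = \sum_(n < K') gr n x.
  move=> le0 h0; rewrite -!(big_mkord xpredT (fun n => gr n x)).
  rewrite (big_cat_nat (leq0n K) le0) /= [X in _ = _ + X]big_nat_cond [X in _ = _ + X]big1 ?addr0 //.
  by move=> i; rewrite andbT => /andP[/h0].
rewrite {1}hM; case/orP: (leq_total N M) => l; first by rewrite (aux _ _ l h).
by rewrite (aux _ _ l h').
Qed.

Definition gbound x : nat := projT1 (cid (gr_fin x)).
Lemma gboundP x m : (gbound x <= m)%N -> gr m x = 0.
Proof. by rewrite /gbound; case: cid => N /= h; apply: gr_big. Qed.

(* [sum_n F n x_n], where [x = sum_n x_n] with [x_n] of degree [n]. *)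
Definition gsum (W : zmodType) (F : nat -> G -> W) x : W :=
  \sum_(n < gbound x) F n (gr n x).

Section Gsum.
Variables (W : lmodType k) (F : nat -> G -> W).
Hypothesis FL : forall n, linear (F n).

Lemma gsumE x N : (forall m, (N <= m)%N -> gr m x = 0) ->
  gsum F x = \sum_(n < N) F n (gr n x).
Proof.
move=> h; have aux K K' : (K <= K')%N -> (forall m, (K <= m)%N -> gr m x = 0) ->
    \sum_(n < K) F n (gr n x) = \sum_(n < K') F n (gr n x).
  move=> le0 h0; rewrite -!(big_mkord xpredT (fun n => F n (gr n x))).
  rewrite (big_cat_nat (leq0n K) le0) /= [X in _ = _ + X]big_nat_cond [X in _ = _ + X]big1 ?addr0 //.
  by move=> i; rewrite andbT => /andP[/h0 ->]; rewrite (lin0 (FL i)).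
rewrite /gsum; case/orP: (leq_total N (gbound x)) => l; first by rewrite (aux _ _ l h).
by rewrite (aux _ _ l (@gboundP x)).
Qed.

Lemma gsum_lin : linear (gsum F).
Proof.
move=> a x y; pose N := maxn (gbound x) (gbound y).
have hx m : (N <= m)%N -> gr m x = 0.
  by move=> h; apply: gboundP; apply: leq_trans h; apply: leq_maxl.
have hy m : (N <= m)%N -> gr m y = 0.
  by move=> h; apply: gboundP; apply: leq_trans h; apply: leq_maxr.
have hxy m : (N <= m)%N -> gr m (a *: x + y) = 0.
  by move=> h; rewrite gr_lin hx // hy // scaler0 addr0.
rewrite (gsumE hx) (gsumE hy) (gsumE hxy) scaler_sumr -big_split /=.
by apply: eq_bigr => i _; rewrite gr_lin FL.
Qed.

Lemma gsum_homog n x : homog n x -> gsum F x = F n x.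
Proof.
move=> h; rewrite (@gsumE x n.+1); last first.
  by move=> m hm; rewrite (homogE m h) gtn_eqF.
rewrite big_ord_recr /= h big1 ?add0r // => i _.
by rewrite (homogE i h) ltn_eqF // (lin0 (FL i)).
Qed.
End Gsum.

Lemma homog_ind (P : G -> Prop) : P 0 -> (forall x y, P x -> P y -> P (x + y)) ->
  (forall n x, homog n x -> P x) -> forall x, P x.
Proof.
move=> P0 PD Ph x; have [N ->] := gr_fin x.
by elim/big_ind: _ => // i _; apply: (Ph i); apply: homog_gr.
Qed.

Lemma gr_mulE n x y : gr n (x * y) = \sum_(p < n.+1) gr p x * gr (n - p) y.
Proof.
move: x y; apply: homog_ind => [y|x x' hx hx' y|p x hx].
- rewrite mul0r homog0 big1 // => i _; by rewrite homog0 mul0r.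
- rewrite mulrDl (linD (gr_lin n)) hx hx' -big_split; apply: eq_bigr => i _.
  by rewrite (linD (gr_lin _)) mulrDl.
apply: homog_ind => [|y y' hy hy'|q y hy].
- rewrite mulr0 homog0 big1 // => i _; by rewrite homog0 mulr0.
- rewrite mulrDr (linD (gr_lin n)) hy hy' -big_split; apply: eq_bigr => i _.
  by rewrite (linD (gr_lin _)) mulrDr.
rewrite (homogE n (gr_mul hx hy)).
have [->|ne] := eqVneq n (p + q)%N.
  have lt : (p < (p + q).+1)%N by rewrite ltnS leq_addr.
  rewrite (bigD1 (Ordinal lt)) //= hx addKn hy big1 ?addr0 // => i ni.
  rewrite (homogE i hx) ifN ?mul0r //.
rewrite big1 // => i _; rewrite (homogE i hx) (homogE _ hy).
case: eqP => e; last by rewrite mul0r.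
case: eqP => e'; last by rewrite mulr0.
by case/eqP: ne; rewrite -e -e' subnKC // -ltnS.
Qed.

Definition sgn x : G := gsum (fun n y => (-1) ^+ n *: y) x.
Let sgnL' n : linear (fun y : G => (-1) ^+ n *: y).
Proof. by move=> a u v; rewrite scalerDr !scalerA [a * _]mulrC. Qed.
Lemma sgn_lin : linear sgn. Proof. exact: gsum_lin. Qed.
Lemma sgn_homog n x : homog n x -> sgn x = (-1) ^+ n *: x.
Proof. by move=> h; rewrite /sgn (gsum_homog sgnL' h). Qed.
Lemma sgn_mul x y : sgn (x * y) = sgn x * sgn y.
Proof.
move: x y; apply: homog_ind => [y|x x' hx hx' y|p x hx].
- by rewrite mul0r !(lin0 sgn_lin) mul0r.
- by rewrite mulrDl !(linD sgn_lin) hx hx' mulrDl.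
apply: homog_ind => [|y y' hy hy'|q y hy].
- by rewrite mulr0 !(lin0 sgn_lin) mulr0.
- by rewrite mulrDr !(linD sgn_lin) hy hy' mulrDr.
rewrite (sgn_homog hx) (sgn_homog hy) (sgn_homog (gr_mul hx hy)).
by rewrite -uscalerAl -uscalerAr scalerA -exprD.
Qed.
Lemma dif_mulE x y : dif (x * y) = dif x * y + sgn x * dif y.
Proof.
move: x y; apply: homog_ind => [y|x x' hx hx' y|p x hx y].
- by rewrite mul0r !(lin0 (@dif_lin _ G)) (lin0 sgn_lin) !mul0r addr0.
- by rewrite mulrDl !(linD (@dif_lin _ G)) (linD sgn_lin) hx hx' !mulrDl addrACA.
- by rewrite (dif_mul _ hx) (sgn_homog hx) uscalerAl.
Qed.
Lemma dif_homog n x : homog n x -> homog n.+1 (dif x).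
Proof. exact: dif_gr. Qed.
Lemma dif_one : dif (1 : G) = 0.
Proof.
have := @dif_mul _ G 0 1 1 (gr_one G).
rewrite expr0 scale1r !mul1r mulr1 => h.
by apply: (addrI (dif (1 : G))); rewrite addr0 -h.
Qed.
End DgaTheory.

Section GradedTensor.
Variables (k : fieldType) (G L : dga k).

(* The vector space [G (x) L] with the Koszul-signed product. *)
Definition gtens : Type := tensor G L.
HB.instance Definition _ := GRing.Lmodule.on gtens.

Let mf (g : G) (r : L) (w : G) (t : L) : gtens :=
  gsum (fun m (rm : L) =>
    gsum (fun n (wn : G) => (-1) ^+ (m * n) *: ((g * wn) ⊗ (rm * t))) w) r.

Let sclin (U V : lmodType k) (a : k) (f : U -> V) :
  linear f -> linear (fun x => a *: f x).
Proof. by move=> fL c u v; rewrite fL scalerDr !scalerA [a * c]mulrC. Qed.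

Let inL (g : G) (t : L) m n (rm : L) :
  linear (fun wn : G => (-1) ^+ (m * n) *: ((g * wn) ⊗ (rm * t))).
Proof.
apply: sclin => a u v; rewrite ((umul_bilin G).2 g).
exact: ((tens_bilin G L).1 (rm * t)).
Qed.

Let outL (g : G) (t : L) w m :
  linear (fun rm : L =>
    gsum (fun n (wn : G) => (-1) ^+ (m * n) *: ((g * wn) ⊗ (rm * t))) w).
Proof.
move=> a u v; rewrite /gsum scaler_sumr -big_split /=; apply: eq_bigr => i _.
rewrite ((umul_bilin L).1 t) ((tens_bilin G L).2 (g * gr i w)).
by rewrite scalerDr !scalerA [a * _]mulrC.
Qed.

Let mfB1 g r : bilin (mf g r).
Proof.
split=> [t|w] a x y; rewrite /mf /gsum scaler_sumr -big_split /=; apply: eq_bigr => i _.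
  by apply: (gsum_lin (fun n => @inL g t i n (gr i r))).
rewrite /gsum scaler_sumr -big_split /=; apply: eq_bigr => j _.
rewrite ((umul_bilin L).2 (gr i r)) ((tens_bilin G L).2 _).
by rewrite scalerDr !scalerA [a * _]mulrC.
Qed.
Let mfB2 w t : bilin (fun g r => mf g r w t).
Proof.
split=> [r|g]; last exact: (gsum_lin (outL g t w)).
move=> a x y; rewrite /mf /gsum scaler_sumr -big_split /=; apply: eq_bigr => i _.
rewrite /gsum scaler_sumr -big_split /=; apply: eq_bigr => j _.
rewrite ((umul_bilin G).1 (gr j w)) ((tens_bilin G L).1 _).
by rewrite scalerDr !scalerA [a * _]mulrC.
Qed.
Let mfE g r w t m n : homog m r -> homog n w ->
  mf g r w t = (-1) ^+ (m * n) *: ((g * w) ⊗ (r * t)).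
Proof.
by move=> hr hw; rewrite /mf (gsum_homog (outL g t w) hr) (gsum_homog _ hw).
Qed.

Let gmul (x y : gtens) : gtens := tsum (fun g r => tsum (mf g r) y) x.
Let mB : bilin gmul. Proof. exact: tsum2_bilin. Qed.
Let mE g r w t m n : homog m r -> homog n w ->
  gmul (g ⊗ r) (w ⊗ t) = (-1) ^+ (m * n) *: ((g * w) ⊗ (r * t)).
Proof. by move=> hr hw; rewrite /gmul tsum2_tens // (mfE _ _ hr hw). Qed.

Let hind (P : gtens -> Prop) : P 0 -> (forall x y, P x -> P y -> P (x + y)) ->
  (forall m n u v, homog m u -> homog n v -> P (u ⊗ v)) -> forall x, P x.
Proof.
move=> P0 PD Ph; apply: tensor_ind => // u v; move: u v.
apply: homog_ind => [v|u u' hu hu' v|m u hu]; first by rewrite tens0l.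
  by rewrite tensDl; apply: PD.
apply: homog_ind => [|v v' hv hv'|n v hv]; first by rewrite tens0r.
  by rewrite tensDr; apply: PD.
exact: Ph hu hv.
Qed.

Let mulDl : left_distributive gmul +%R.
Proof. by move=> x y z; apply: (linD (mB.1 z)). Qed.
Let mulDr : right_distributive gmul +%R.
Proof. by move=> x y z; apply: (linD (mB.2 x)). Qed.
Let gm0l x : gmul 0 x = 0. Proof. exact: (lin0 (mB.1 x)). Qed.
Let gm0r x : gmul x 0 = 0. Proof. exact: (lin0 (mB.2 x)). Qed.
Let mulZl (a : k) x y : a *: gmul x y = gmul (a *: x) y.
Proof. by rewrite (linZ (mB.1 y)). Qed.
Let mulZr (a : k) x y : a *: gmul x y = gmul x (a *: y).
Proof. by rewrite (linZ (mB.2 x)). Qed.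

Let mulA : associative gmul.
Proof.
apply: hind => [y z|x x' hx hx' y z|m n a b ha hb]; first by rewrite !gm0l.
  by rewrite !mulDl hx hx'.
apply: hind => [z|y y' hy hy' z|p q c d hc hd]; first by rewrite !(gm0l, gm0r).
  by rewrite !(mulDl, mulDr) hy hy'.
apply: hind => [|z z' hz hz'|r s e g he hg]; first by rewrite !gm0r.
  by rewrite !mulDr hz hz'.
rewrite (mE _ _ hd he) (mE _ _ hb hc) -mulZl -mulZr.
rewrite (mE _ _ hb (gr_mul hc he)) (mE _ _ (gr_mul hb hd) he) !scalerA !mulrA.
rewrite -!exprD mulnDl mulnDr. by rewrite addnC addnA.
Qed.
Let mul1l : left_id ((1 : G) ⊗ (1 : L) : gtens) gmul.
Proof.
apply: hind => [|x y hx hy|m n a b ha hb]; first by rewrite gm0r.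
  by rewrite mulDr hx hy.
by rewrite (mE _ _ (gr_one L) ha) !mul1r mul0n scale1r.
Qed.
Let mul1r : right_id ((1 : G) ⊗ (1 : L) : gtens) gmul.
Proof.
apply: hind => [|x y hx hy|m n a b ha hb]; first by rewrite gm0l.
  by rewrite mulDl hx hy.
by rewrite (mE _ _ hb (gr_one G)) !mulr1 muln0 scale1r.
Qed.

HB.instance Definition _ :=
  isUAlgebra.Build k gtens mulA mul1l mul1r mulDl mulDr mulZl mulZr.
HB.instance Definition _ := GRing.PzRing.copy gtens (UAlgebra.sort gtens).

Let mE' g r w t m n : homog m r -> homog n w ->
  (g ⊗ r : gtens) * (w ⊗ t : gtens) = (-1) ^+ (m * n) *: ((g * w) ⊗ (r * t)).
Proof. exact: mE. Qed.

Let ggr n (x : gtens) : gtens :=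
  tsum (fun u v => \sum_(p < n.+1) gr p u ⊗ gr (n - p) v) x.
Let grB n : bilin (fun (u : G) (v : L) => \sum_(p < n.+1) gr p u ⊗ gr (n - p) v).
Proof.
split=> [v|u] a x y; rewrite scaler_sumr -big_split /=; apply: eq_bigr => i _.
  by rewrite gr_lin; apply: ((tens_bilin G L).1 _).
by rewrite gr_lin; apply: ((tens_bilin G L).2 _).
Qed.
Let grL n : linear (ggr n). Proof. exact: tsum_lin. Qed.
Let grE n p q (u : G) (v : L) : homog p u -> homog q v ->
  ggr n (u ⊗ v) = if n == (p + q)%N then u ⊗ v else 0.
Proof.
move=> hu hv; rewrite /ggr tsum_tens //.
have [->|ne] := eqVneq n (p + q)%N.
  have lt : (p < (p + q).+1)%N by rewrite ltnS leq_addr.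
  rewrite (bigD1 (Ordinal lt)) //= hu addKn hv big1 ?addr0 // => i ni.
  rewrite (homogE i hu) ifN ?tens0l //.
rewrite big1 // => i _; rewrite (homogE i hu) (homogE _ hv).
case: eqP => e; last by rewrite tens0l.
case: eqP => e'; last by rewrite tens0r.
by case/eqP: ne; rewrite -e -e' subnKC // -ltnS.
Qed.

Let df (g : G) (r : L) : gtens :=
  dif g ⊗ r + gsum (fun n (gn : G) => (-1) ^+ n *: (gn ⊗ dif r)) g.
Let dfin r n : linear (fun gn : G => (-1) ^+ n *: (gn ⊗ dif (r : L))).
Proof. by apply: sclin; apply: ((tens_bilin G L).1 _). Qed.
Let dfB : bilin df.
Proof.
split=> [r|g] a x y; rewrite /df scalerDr addrACA.
  by rewrite dif_lin ((tens_bilin G L).1 _) (gsum_lin (dfin r)).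
rewrite ((tens_bilin G L).2 _); congr (_ + _).
rewrite /gsum scaler_sumr -big_split /=; apply: eq_bigr => i _.
by rewrite dif_lin ((tens_bilin G L).2 _) scalerDr !scalerA [a * _]mulrC.
Qed.
Let gd (x : gtens) : gtens := tsum df x.
Let gdL : linear gd. Proof. exact: tsum_lin. Qed.
Let gdE n (g : G) (r : L) : homog n g ->
  gd (g ⊗ r) = dif g ⊗ r + (-1) ^+ n *: (g ⊗ dif r).
Proof. by move=> hg; rewrite /gd tsum_tens // /df (gsum_homog (dfin r) hg). Qed.

Let gr_gr' m n (x : gtens) : ggr m (ggr n x) = if m == n then ggr n x else 0.
Proof.
move: x; apply: hind => [|x y hx hy|p q u v hu hv].
- by rewrite !(lin0 (grL _)); case: ifP.
- by rewrite !(linD (grL _)) hx hy; case: ifP; rewrite ?addr0.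
rewrite (grE n hu hv); have [->|ne] := eqVneq n (p + q)%N; first exact: grE.
by rewrite (lin0 (grL _)); case: ifP.
Qed.

Let gr_fin' (x : gtens) : exists N, x = \sum_(n < N) ggr n x.
Proof.
suff [N hN] : exists N, forall M, (N <= M)%N -> x = \sum_(n < M) ggr n x.
  by exists N; apply: hN.
move: x; apply: hind => [|x y [N hN] [N' hN']|p q u v hu hv].
- by exists 0 => M _; rewrite big1 // => i _; rewrite (lin0 (grL _)).
- exists (maxn N N') => M; rewrite geq_max => /andP[l l'].
  by rewrite {1}(hN _ l) {1}(hN' _ l') -big_split; apply: eq_bigr => i _;
    rewrite (linD (grL _)).
exists (p + q).+1 => M l; rewrite (bigD1 (Ordinal l)) //= (grE _ hu hv) eqxx.
rewrite big1 ?addr0 // => i ni; rewrite (grE _ hu hv) ifN //.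
Qed.

Let gr_mul' m n (x y : gtens) : ggr m x = x -> ggr n y = y -> ggr (m + n) (x * y) = x * y.
Proof.
move=> <- <-; move: x y.
have zl (z : gtens) : ggr (m + n) (0 * z) = 0 * z by rewrite mul0r (lin0 (grL _)).
have zr N (z : gtens) : ggr N (z * 0) = z * 0 by rewrite mulr0 (lin0 (grL _)).
apply: hind => [y|x x' hx hx' y|p q a b ha hb].
- by rewrite (lin0 (grL m)).
- by rewrite (linD (grL m)) mulrDl (linD (grL _)) hx hx'.
rewrite (grE m ha hb); case: eqP => [->|_] // .
apply: hind => [|y y' hy hy'|r s c d hc hd].
- by rewrite (lin0 (grL n)) zr.
- by rewrite (linD (grL n)) mulrDr (linD (grL _)) hy hy'.
rewrite (grE n hc hd); case: eqP => [->|_] //.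
rewrite (mE' a d hb hc) (linZ (grL _)) (grE _ (gr_mul ha hc) (gr_mul hb hd)).
by rewrite addnACA eqxx.
Qed.

Let dif_gr' n (x : gtens) : ggr n x = x -> ggr n.+1 (gd x) = gd x.
Proof.
move=> <-; move: x; apply: hind => [|x y hx hy|p q u v hu hv].
- by rewrite (lin0 (grL n)) (lin0 gdL) (lin0 (grL _)).
- by rewrite (linD (grL n)) (linD gdL) (linD (grL _)) hx hy.
rewrite (grE n hu hv); case: eqP => [->|_]; last by rewrite (lin0 gdL) (lin0 (grL _)).
rewrite (gdE _ hu) (linD (grL _)) (linZ (grL _)).
by rewrite (grE _ (dif_homog hu) hv) (grE _ hu (dif_homog hv)) addSn addnS eqxx.
Qed.

Let dif_dif' (x : gtens) : gd (gd x) = 0.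
Proof.
move: x; apply: hind => [|x y hx hy|p q u v hu hv]; first by rewrite !(lin0 gdL).
  by rewrite !(linD gdL) hx hy addr0.
rewrite (gdE _ hu) (linD gdL) (linZ gdL) (gdE _ (dif_homog hu)) (gdE _ hu).
by rewrite !dif_dif tens0l tens0r scaler0 addr0 add0r exprS mulN1r scaleNr addNr.
Qed.

Let dif_mul' n (x y : gtens) : ggr n x = x ->
  gd (x * y) = gd x * y + (-1) ^+ n *: (x * gd y).
Proof.
move=> <-; move: x y; apply: hind => [y|x x' hx hx' y|p q a b ha hb].
- by rewrite (lin0 (grL n)) !mul0r (lin0 gdL) mul0r scaler0 addr0.
- by rewrite (linD (grL n)) mulrDl !(linD gdL) hx hx' !mulrDl scalerDr addrACA.
rewrite (grE n ha hb); case: eqP => [->|_]; last first.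
  by move=> y; rewrite !mul0r (lin0 gdL) mul0r scaler0 addr0.
apply: hind => [|y y' hy hy'|r s c d hc hd].
- by rewrite !mulr0 (lin0 gdL) mulr0 scaler0 addr0.
- by rewrite mulrDr !(linD gdL) hy hy' !mulrDr scalerDr addrACA.
rewrite (mE' a d hb hc) (linZ gdL) (gdE _ (gr_mul ha hc)).
rewrite (gdE _ ha) (gdE _ hc) mulrDl mulrDr -uscalerAl -uscalerAr.
rewrite (mE' (dif a) d hb hc).
rewrite (mE' a d (dif_homog hb) hc).
rewrite (mE' a d hb (dif_homog hc)).
rewrite (mE' a (dif d) hb hc).
rewrite (dif_mul _ ha) (dif_mul _ hb) tensDl tensDr tensZl tensZr !scalerDr !scalerA.
rewrite -!addrA; congr (_ + _); rewrite addrCA; congr (_ + _); last congr (_ + _).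
all: rewrite ?mulSn ?mulnS -!exprD; congr (_ *: _);
  rewrite -[LHS]signr_odd -[RHS]signr_odd !oddD;
  by case: (odd p); case: (odd q); case: (odd r); case: (odd (q * r)).
Qed.

Let gr_one' : ggr 0 (1 : gtens) = 1.
Proof. by rewrite [LHS](grE 0 (gr_one G) (gr_one L)). Qed.

Definition gtensor : dga k :=
  @Dga k gtens ggr gd grL gr_gr' gr_fin' gr_one' gr_mul' gdL dif_gr' dif_dif' dif_mul'.

Lemma gtensor_mulE (g w : G) (r t : L) m n : homog m r -> homog n w ->
  (g ⊗ r : gtensor) * (w ⊗ t : gtensor) = (-1) ^+ (m * n) *: ((g * w) ⊗ (r * t)).
Proof. exact: mE. Qed.
Lemma gtensor_difE (g : G) (r : L) n : homog n g ->
  dif (g ⊗ r : gtensor) = dif g ⊗ r + (-1) ^+ n *: (g ⊗ dif r).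
Proof. exact: gdE. Qed.
Lemma gtensor_grE n p q (u : G) (v : L) : homog p u -> homog q v ->
  gr n (u ⊗ v : gtensor) = if n == (p + q)%N then u ⊗ v else 0.
Proof. exact: grE. Qed.
End GradedTensor.

Record dideal (k : fieldType) (G : dga k) := DIdeal {
  dideal_ideal :> tideal G;
  dideal_gr : forall n x, dideal_ideal x -> dideal_ideal (gr n x);
  dideal_dif : forall x, dideal_ideal x -> dideal_ideal (dif x) }.

Section QuotientDga.
Variables (k : fieldType) (G : dga k) (J : dideal G).

Let Q : ualgType k := aquot J.
Let qgr n (x : Q) : Q := aproj J (gr n (arepr x)).
Let qdif (x : Q) : Q := aproj J (dif (arepr x)).

Let qgrE n (x : G) : qgr n (aproj J x) = aproj J (gr n x).
Proof.
apply/aprojP; rewrite -(linB (gr_lin n)); apply: dideal_gr; exact: aproj_repr.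
Qed.
Let qdifE (x : G) : qdif (aproj J x) = aproj J (dif x).
Proof.
apply/aprojP; rewrite -(linB (@dif_lin _ G)); apply: dideal_dif; exact: aproj_repr.
Qed.
Let pL := ah_lin (aproj_hom J).
Let pM := ah_mul (aproj_hom J).

Let qgr_lin n : linear (qgr n).
Proof.
move=> a; elim/aquotW=> x; elim/aquotW=> y.
by rewrite -pL !qgrE gr_lin pL.
Qed.
Let qgr_gr m n x : qgr m (qgr n x) = if m == n then qgr n x else 0.
Proof.
by elim/aquotW: x => x; rewrite !qgrE gr_gr; case: ifP.
Qed.
Let qgr_fin x : exists N, x = \sum_(n < N) qgr n x.
Proof.
elim/aquotW: x => x; have [N hN] := gr_fin x; exists N.
by rewrite {1}hN (lin_sum pL); apply: eq_bigr => i _; rewrite qgrE.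
Qed.
Let qgr_one : qgr 0 1 = 1.
Proof. by rewrite [LHS](qgrE 0 1) gr_one. Qed.
Let qgr_mul m n x y : qgr m x = x -> qgr n y = y -> qgr (m + n) (x * y) = x * y.
Proof.
elim/aquotW: x => x; elim/aquotW: y => y; rewrite (qgrE m x) (qgrE n y) => <- <-.
by rewrite -pM qgrE gr_mul //; apply: homog_gr.
Qed.
Let qdif_lin : linear qdif.
Proof.
move=> a; elim/aquotW=> x; elim/aquotW=> y.
by rewrite -pL !qdifE dif_lin pL.
Qed.
Let qdif_gr n x : qgr n x = x -> qgr n.+1 (qdif x) = qdif x.
Proof.
elim/aquotW: x => x; rewrite qgrE => <-.
by rewrite qdifE qgrE dif_gr //; apply: homog_gr.
Qed.
Let qdif_dif x : qdif (qdif x) = 0.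
Proof. by elim/aquotW: x => x; rewrite !qdifE dif_dif; apply: lin0 pL. Qed.
Let qdif_mul n x y : qgr n x = x ->
  qdif (x * y) = qdif x * y + (-1) ^+ n *: (x * qdif y).
Proof.
elim/aquotW: x => x; elim/aquotW: y => y; rewrite (qgrE n x) => <-.
rewrite -pM !qdifE -!pM (dif_mul _ (homog_gr n x)).
by rewrite (linD pL) (linZ pL).
Qed.

Definition dquot : dga k :=
  @Dga k (aquot J) qgr qdif qgr_lin qgr_gr qgr_fin qgr_one qgr_mul qdif_lin
    qdif_gr qdif_dif qdif_mul.

Definition dproj (x : G) : dquot := aproj J x.
Definition drepr (x : dquot) : G := arepr x.

Lemma dreprK x : dproj (drepr x) = x.
Proof. exact: areprK. Qed.
Lemma dproj_eq0 x : dproj x = 0 <-> J x.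
Proof. exact: aproj_eq0. Qed.
Lemma dprojP x y : dproj x = dproj y <-> J (x - y).
Proof. exact: aprojP. Qed.
Lemma dproj_hom : dga_hom dproj.
Proof.
split; first exact: aproj_hom.
- by move=> n x; rewrite [RHS]qgrE.
- by move=> x; rewrite [RHS]qdifE.
Qed.
End QuotientDga.

Section DifferentialIdeals.
Variables (k : fieldType) (G : dga k).

Definition dideal_add (J K : dideal G) : dideal G.
Proof.
exists (ideal_add J K).
- move=> n _ [x [y [Jx Ky ->]]]; exists (gr n x), (gr n y).
  by split; [exact: dideal_gr|exact: dideal_gr|rewrite (linD (gr_lin n))].
- move=> _ [x [y [Jx Ky ->]]]; exists (dif x), (dif y).
  by split; [exact: dideal_dif|exact: dideal_dif|rewrite (linD (@dif_lin _ G))].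
Defined.

Definition dideal_cap (I : Type) (J : I -> dideal G) : dideal G.
Proof.
unshelve eexists.
- exists (fun x => forall i, J i x).
  + by move=> i; apply: tideal0.
  + by move=> a x y hx hy i; apply: tidealZD.
  + by move=> x y hy i; apply: tidealMl.
  + by move=> x y hx i; apply: tidealMr.
- by move=> n x hx i; apply: dideal_gr.
- by move=> x hx i; apply: dideal_dif.
Defined.

Variable L : dga k.

Definition dideal_pre (f : G -> L) (fH : dga_hom f) (J : dideal L) : dideal G.
Proof.
unshelve eexists.
- exists (fun x => J (f x)).
  + by rewrite (lin0 (ah_lin fH)); apply: tideal0.
  + by move=> a x y hx hy; rewrite (ah_lin fH); apply: tidealZD.
  + by move=> x y hy; rewrite (ah_mul fH); apply: tidealMl.
  + by move=> x y hx; rewrite (ah_mul fH); apply: tidealMr.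
- by move=> n x hx; rewrite /= (dh_gr fH); apply: dideal_gr.
- by move=> x hx; rewrite /= (dh_dif fH); apply: dideal_dif.
Defined.

Definition dker (f : G -> L) (fH : dga_hom f) : dideal G.
Proof.
exists (ker_ideal fH).
- by move=> n x /= hx; rewrite (dh_gr fH) hx (lin0 (gr_lin n)).
- by move=> x /= hx; rewrite (dh_dif fH) hx (lin0 (@dif_lin _ L)).
Defined.

Definition dimage (f : G -> L) (fH : dga_hom f) (fS : forall y, exists x, f x = y)
  (J : dideal G) : dideal L.
Proof.
unshelve eexists.
- exists (fun y => exists2 x, J x & f x = y).
  + by exists 0; [apply: tideal0|apply: lin0 (ah_lin fH)].
  + move=> a _ _ [x Jx <-] [y Jy <-]; exists (a *: x + y); first exact: tidealZD.
    exact: (ah_lin fH).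
  + move=> z _ [x Jx <-]; have [w <-] := fS z; exists (w * x); first exact: tidealMl.
    exact: (ah_mul fH).
  + move=> _ z [x Jx <-]; have [w <-] := fS z; exists (x * w); first exact: tidealMr.
    exact: (ah_mul fH).
- move=> n _ [x Jx <-]; exists (gr n x); first exact: dideal_gr.
  exact: (dh_gr fH).
- move=> _ [x Jx <-]; exists (dif x); first exact: dideal_dif.
  exact: (dh_dif fH).
Defined.
End DifferentialIdeals.

(* [f] maps [A] into the degree zero part of [G]. *)
Record alg_hom0 (k : fieldType) (A : ualgType k) (G : dga k) (f : A -> G) : Prop :=
  AlgHom0 { ah0_hom :> alg_hom f; ah0_deg : forall a, homog 0 (f a) }.

(* [G] is a differential calculus over [A], the identification of [A] with the
   degree zero part of [G] being [f]. *)
Record calculus (k : fieldType) (A : ualgType k) (G : dga k) (f : A -> G) : Prop :=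
  Calculus {
    calc_hom :> alg_hom0 f;
    calc_inj : injective f;
    calc_deg0 : forall x, homog 0 x -> exists a, f a = x;
    calc_gen : forall S : G -> Prop, subalgebra S ->
      (forall a, S (f a)) -> (forall a, S (dif (f a))) -> forall x, S x }.

Lemma dga_hom_surj (k : fieldType) (A : Type) (G L : dga k) (i : A -> L) (f : G -> L) :
  (forall S : L -> Prop, subalgebra S ->
     (forall a, S (i a)) -> (forall a, S (dif (i a))) -> forall x, S x) ->
  dga_hom f -> (forall a, exists x, f x = i a) -> forall y, exists x, f x = y.
Proof.
move=> gen fH h; apply: gen => //; last first.
  by move=> a; have [x <-] := h a; exists (dif x); apply: dh_dif.
split; first by exists 1; apply: ah_one fH.
- by move=> a _ _ [x <-] [y <-]; exists (a *: x + y); apply: (ah_lin fH).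
- by move=> _ _ [x <-] [y <-]; exists (x * y); apply: (ah_mul fH).
Qed.

Section Universal.
Variables (k : fieldType) (A : ualgType k).

(* Noncommutative polynomials in the symbols [a] and [da], for [a] in [A]. *)
Inductive uterm : Type :=
  | UVar of A
  | UDif of A
  | ULin of k & uterm & uterm
  | UMul of uterm & uterm.

HB.instance Definition _ := gen_eqMixin uterm.
HB.instance Definition _ := gen_choiceMixin uterm.

Fixpoint ueval (G : dga k) (f : A -> G) (t : uterm) : G :=
  match t with
  | UVar a => f a
  | UDif a => dif (f a)
  | ULin c s t => c *: ueval f s + ueval f t
  | UMul s t => ueval f s * ueval f t
  end.

(* Two expressions are identified when they agree in every differential algebra. *)
Definition urel (s t : uterm) : bool :=
  `[< forall (G : dga k) (f : A -> G), alg_hom0 f -> ueval f s = ueval f t >].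

Lemma urel_refl : reflexive urel.
Proof. by move=> s; apply/asboolP. Qed.
Lemma urel_sym : symmetric urel.
Proof. by move=> s t; apply/asboolP/asboolP => h G f fH; rewrite h. Qed.
Lemma urel_trans : transitive urel.
Proof.
by move=> t s r /asboolP h1 /asboolP h2; apply/asboolP => G f fH; rewrite h1 // h2.
Qed.

Canonical uequiv := EquivRel urel urel_refl urel_sym urel_trans.

Definition univ := {eq_quot uequiv}.
HB.instance Definition _ := Choice.on univ.

Let up (t : uterm) : univ := \pi_{eq_quot uequiv} t.

(* The extension of [f : A -> G] to a homomorphism of differential algebras. *)
Definition uext (G : dga k) (f : A -> G) (w : univ) : G := ueval f (repr w).

Let uextE (G : dga k) (f : A -> G) t : alg_hom0 f -> uext f (up t) = ueval f t.
Proof.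
move=> fH; have /eqmodP/asboolP h : up (repr (up t)) = up t by apply: reprK.
exact: h.
Qed.
Let ueq (x y : univ) :
  (forall (G : dga k) (f : A -> G), alg_hom0 f -> uext f x = uext f y) -> x = y.
Proof.
move=> h; have e z : up (repr z) = z by apply: reprK.
rewrite -(e x) -(e y); apply/eqmodP/asboolP => G f fH.
by rewrite -!uextE // !e h.
Qed.

Let uadd (x y : univ) := up (ULin 1 (repr x) (repr y)).
Let u0 := up (UVar 0).
Let uscale a (x : univ) := up (ULin a (repr x) (UVar 0)).
Let uopp (x : univ) := uscale (-1) x.
Let u1 := up (UVar 1).
Let um (x y : univ) := up (UMul (repr x) (repr y)).

Section Eval.
Variables (G : dga k) (f : A -> G) (fH : alg_hom0 f).
Let eD x y : uext f (uadd x y) = uext f x + uext f y.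
Proof. by rewrite uextE //= scale1r. Qed.
Let e0 : uext f u0 = 0. Proof. by rewrite uextE //= (lin0 (ah_lin fH)). Qed.
Let eZ a x : uext f (uscale a x) = a *: uext f x.
Proof. by rewrite uextE //= (lin0 (ah_lin fH)) addr0. Qed.
Let eN x : uext f (uopp x) = - uext f x.
Proof. by rewrite eZ scaleN1r. Qed.
Let e1 : uext f u1 = 1. Proof. by rewrite uextE //= (ah_one fH). Qed.
Let eM x y : uext f (um x y) = uext f x * uext f y.
Proof. by rewrite uextE. Qed.
Definition uevE := (eD, e0, eN, eZ, e1, eM).
End Eval.

Let uaddA : associative uadd. Proof. by move=> x y z; apply: ueq => G f fH; rewrite !(uevE fH); rewrite addrA. Qed.
Let uaddC : commutative uadd. Proof. by move=> x y; apply: ueq => G f fH; rewrite !(uevE fH); rewrite addrC. Qed.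
Let uadd0 : left_id u0 uadd. Proof. by move=> x; apply: ueq => G f fH; rewrite !(uevE fH); rewrite add0r. Qed.
Let uaddN : left_inverse u0 uopp uadd. Proof. by move=> x; apply: ueq => G f fH; rewrite !(uevE fH); rewrite addNr. Qed.
HB.instance Definition _ := GRing.isZmodule.Build univ uaddA uaddC uadd0 uaddN.

Let uscaleA (a b : k) (x : univ) : uscale a (uscale b x) = uscale (a * b) x.
Proof. by apply: ueq => G f fH; rewrite !(uevE fH); rewrite scalerA. Qed.
Let uscale1 : left_id 1 uscale. Proof. by move=> x; apply: ueq => G f fH; rewrite !(uevE fH); rewrite scale1r. Qed.
Let uscaleDr : right_distributive uscale uadd.
Proof. by move=> a x y; apply: ueq => G f fH; rewrite !(uevE fH); rewrite scalerDr. Qed.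
Let uscaleDl (x : univ) a b : uscale (a + b) x = uadd (uscale a x) (uscale b x).
Proof. by apply: ueq => G f fH; rewrite !(uevE fH); rewrite scalerDl. Qed.
HB.instance Definition _ :=
  GRing.Zmodule_isLmodule.Build k univ uscaleA uscale1 uscaleDr uscaleDl.

Let umA : associative um. Proof. by move=> x y z; apply: ueq => G f fH; rewrite !(uevE fH); rewrite mulrA. Qed.
Let um1l : left_id u1 um. Proof. by move=> x; apply: ueq => G f fH; rewrite !(uevE fH); rewrite mul1r. Qed.
Let um1r : right_id u1 um. Proof. by move=> x; apply: ueq => G f fH; rewrite !(uevE fH); rewrite mulr1. Qed.
Let umDl : left_distributive um uadd. Proof. by move=> x y z; apply: ueq => G f fH; rewrite !(uevE fH); rewrite mulrDl. Qed.
Let umDr : right_distributive um uadd. Proof. by move=> x y z; apply: ueq => G f fH; rewrite !(uevE fH); rewrite mulrDr. Qed.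
Let umZl (a : k) (x y : univ) : uscale a (um x y) = um (uscale a x) y.
Proof. by apply: ueq => G f fH; rewrite !(uevE fH); rewrite uscalerAl. Qed.
Let umZr (a : k) (x y : univ) : uscale a (um x y) = um x (uscale a y).
Proof. by apply: ueq => G f fH; rewrite !(uevE fH); rewrite uscalerAr. Qed.
HB.instance Definition _ :=
  isUAlgebra.Build k univ umA um1l um1r umDl umDr umZl umZr.
HB.instance Definition _ := GRing.PzRing.copy univ (UAlgebra.sort univ).

Let extH (G : dga k) (f : A -> G) : alg_hom0 f -> alg_hom (uext f).
Proof.
move=> fH; split=> [a x y||x y].
- by rewrite [LHS](uevE fH) [X in X + _](uevE fH).
- by rewrite [LHS](uevE fH).
- by rewrite [LHS](uevE fH).
Qed.

Fixpoint ugr (n : nat) (t : uterm) : uterm :=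
  match t with
  | UVar a => if n == 0%N then UVar a else UVar 0
  | UDif a => if n == 1%N then UDif a else UVar 0
  | ULin c s t => ULin c (ugr n s) (ugr n t)
  | UMul s t =>
      foldr (fun p u => ULin 1 (UMul (ugr p s) (ugr (n - p) t)) u) (UVar 0) (iota 0 n.+1)
  end.
Fixpoint usgn (t : uterm) : uterm :=
  match t with
  | UVar a => UVar a
  | UDif a => ULin (-1) (UDif a) (UVar 0)
  | ULin c s t => ULin c (usgn s) (usgn t)
  | UMul s t => UMul (usgn s) (usgn t)
  end.
Fixpoint udif (t : uterm) : uterm :=
  match t with
  | UVar a => UDif a
  | UDif a => UVar 0
  | ULin c s t => ULin c (udif s) (udif t)
  | UMul s t => ULin 1 (UMul (udif s) t) (UMul (usgn s) (udif t))
  end.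

Section EvalGraded.
Variables (G : dga k) (f : A -> G) (fH : alg_hom0 f).
Let f0 : f 0 = 0. Proof. exact: lin0 (ah_lin fH). Qed.

Lemma ueval_gr n t : ueval f (ugr n t) = gr n (ueval f t).
Proof.
elim: t n => [a|a|c s hs t ht|s hs t ht] n /=.
- by rewrite (homogE n (ah0_deg fH a)); case: eqP => //=; rewrite f0.
- by rewrite (homogE n (dif_homog (ah0_deg fH a))); case: eqP => //=; rewrite f0.
- by rewrite gr_lin hs ht.
rewrite gr_mulE -(big_mkord xpredT (fun p => gr p (ueval f s) * gr (n - p) (ueval f t))).
have aux r : ueval f
    (foldr (fun p u => ULin 1 (UMul (ugr p s) (ugr (n - p) t)) u) (UVar 0) r) =
    \sum_(p <- r) gr p (ueval f s) * gr (n - p) (ueval f t).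
  by elim: r => [|p r IH] /=; rewrite ?big_nil // big_cons scale1r hs ht IH.
by rewrite [LHS](aux (iota 0 n.+1)) /index_iota subn0.
Qed.

Lemma ueval_sgn t : ueval f (usgn t) = sgn (ueval f t).
Proof.
elim: t => [a|a|c s hs t ht|s hs t ht] /=.
- by rewrite (sgn_homog (ah0_deg fH a)) scale1r.
- by rewrite (sgn_homog (dif_homog (ah0_deg fH a))) expr1 f0 addr0.
- by rewrite (sgn_lin c) hs ht.
- by rewrite sgn_mul hs ht.
Qed.

Lemma ueval_dif t : ueval f (udif t) = dif (ueval f t).
Proof.
elim: t => [a|a|c s hs t ht|s hs t ht] //=.
- by rewrite dif_dif.
- by rewrite dif_lin hs ht.
- by rewrite dif_mulE hs ht ueval_sgn scale1r.
Qed.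
End EvalGraded.

Let ggr n (x : univ) : univ := up (ugr n (repr x)).
Let gd (x : univ) : univ := up (udif (repr x)).

Let extgr (G : dga k) (f : A -> G) n x : alg_hom0 f -> uext f (ggr n x) = gr n (uext f x).
Proof. by move=> fH; rewrite uextE // ueval_gr. Qed.
Let extd (G : dga k) (f : A -> G) x : alg_hom0 f -> uext f (gd x) = dif (uext f x).
Proof. by move=> fH; rewrite uextE // ueval_dif. Qed.

Let ggr_lin n : linear (ggr n).
Proof.
move=> a x y; apply: ueq => G f fH.
by rewrite extgr // !(ah_lin (extH fH)) !extgr // gr_lin.
Qed.
Let ggr_gr m n x : ggr m (ggr n x) = if m == n then ggr n x else 0.
Proof.
apply: ueq => G f fH; rewrite !extgr // gr_gr; case: ifP => _; rewrite ?extgr //.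
by rewrite (lin0 (ah_lin (extH fH))).
Qed.
Let ubound (t : uterm) : exists N, forall (G : dga k) (f : A -> G), alg_hom0 f ->
  forall n, (N <= n)%N -> gr n (ueval f t) = 0.
Proof.
elim: t => [a|a|c s [N hN] t [M hM]|s [N hN] t [M hM]] /=.
- exists 1%N => G f fH n hn; rewrite (homogE n (ah0_deg fH a)) ifN //.
  by rewrite -lt0n.
- exists 2%N => G f fH n hn; rewrite (homogE n (dif_homog (ah0_deg fH a))) ifN //.
  by rewrite gtn_eqF.
- exists (maxn N M) => G f fH n; rewrite geq_max => /andP[l l'].
  by rewrite gr_lin hN // hM // scaler0 addr0.
- exists (N + M)%N => G f fH n hn; rewrite gr_mulE big1 // => i _.
  have [l|l] := leqP N i; first by rewrite hN // mul0r.
  rewrite (hM _ _ fH (n - i)%N) ?mulr0 // leq_subRL; last by rewrite -ltnS.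
  by apply: leq_trans hn; rewrite leq_add2r ltnW.
Qed.
Let ggr_fin x : exists N, x = \sum_(n < N) ggr n x.
Proof.
have [N hN] := ubound (repr x); exists N; apply: ueq => G f fH.
rewrite (lin_sum (ah_lin (extH fH))) [LHS](gr_sumE (hN G f fH)).
by apply: eq_bigr => i _; rewrite extgr.
Qed.
Let ggr_one : ggr 0 1 = 1.
Proof. by apply: ueq => G f fH; rewrite extgr // (ah_one (extH fH)) gr_one. Qed.
Let ggr_mul m n x y : ggr m x = x -> ggr n y = y -> ggr (m + n) (x * y) = x * y.
Proof.
move=> hx hy; apply: ueq => G f fH; rewrite extgr // (ah_mul (extH fH)) gr_mul //.
- by rewrite -extgr // hx.
- by rewrite -extgr // hy.
Qed.
Let gd_lin : linear gd.
Proof.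
move=> a x y; apply: ueq => G f fH.
by rewrite extd // !(ah_lin (extH fH)) !extd // dif_lin.
Qed.
Let gd_gr n x : ggr n x = x -> ggr n.+1 (gd x) = gd x.
Proof.
move=> hx; apply: ueq => G f fH; rewrite extgr // extd // dif_gr //.
by rewrite -extgr // hx.
Qed.
Let gd_dif x : gd (gd x) = 0.
Proof.
by apply: ueq => G f fH; rewrite !extd // dif_dif (lin0 (ah_lin (extH fH))).
Qed.
Let gd_mul n x y : ggr n x = x -> gd (x * y) = gd x * y + (-1) ^+ n *: (x * gd y).
Proof.
move=> hx; apply: ueq => G f fH; have eL := ah_lin (extH fH); have eM := ah_mul (extH fH).
rewrite extd // (linD eL) (linZ eL) !eM !extd // (@dif_mul _ _ n) //.
by rewrite -extgr // hx.
Qed.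

Definition Omega : dga k :=
  @Dga k univ ggr gd ggr_lin ggr_gr ggr_fin ggr_one ggr_mul gd_lin gd_gr gd_dif gd_mul.

Definition uinj (a : A) : Omega := up (UVar a).

Lemma uext_hom (G : dga k) (f : A -> G) : alg_hom0 f -> dga_hom (uext f : Omega -> G).
Proof.
by move=> fH; split=> [|n x|x]; [exact: extH|exact: extgr|exact: extd].
Qed.
Lemma uext_inj (G : dga k) (f : A -> G) a : alg_hom0 f -> uext f (uinj a) = f a.
Proof. by move=> fH; rewrite uextE. Qed.

Lemma uinj_hom0 : alg_hom0 uinj.
Proof.
split; last by move=> a; apply: ueq => G f fH; rewrite extgr // !uextE //= (ah0_deg fH).
split=> [c a b||a b]; apply: ueq => G f fH.
- by rewrite (ah_lin (extH fH)) !uextE //= (ah_lin fH).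
- by [].
- by rewrite (ah_mul (extH fH)) !uextE //= (ah_mul fH).
Qed.

Lemma uinj_gen (S : Omega -> Prop) : subalgebra S ->
  (forall a, S (uinj a)) -> (forall a, S (dif (uinj a))) -> forall x, S x.
Proof.
move=> [S1 SL SM] Sa Sd x; have -> : x = up (repr x) by symmetry; apply: reprK.
elim: (repr x) => [a|a|c s hs t ht|s hs t ht].
- exact: Sa.
- have -> : up (UDif a) = gd (uinj a); last exact: Sd.
  by apply: ueq => G f fH; rewrite extd // !uextE.
- have -> : up (ULin c s t) = c *: up s + up t; last exact: SL.
  by apply: ueq => G f fH; rewrite (ah_lin (extH fH)) !uextE.
- have -> : up (UMul s t) = up s * up t; last exact: SM.
  by apply: ueq => G f fH; rewrite (ah_mul (extH fH)) !uextE.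
Qed.

Lemma uext_unique (G : dga k) (g h : Omega -> G) : dga_hom g -> dga_hom h ->
  (forall a, g (uinj a) = h (uinj a)) -> g =1 h.
Proof.
move=> gH hH e; apply: (uinj_gen (S := fun x => g x = h x)) => //.
- split; first by rewrite (ah_one gH) (ah_one hH).
  + by move=> a x y ex ey; rewrite (ah_lin gH) (ah_lin hH) ex ey.
  + by move=> x y ex ey; rewrite (ah_mul gH) (ah_mul hH) ex ey.
- by move=> a; rewrite (dh_dif gH) (dh_dif hH) e.
Qed.
End Universal.

Section DegreeZero.
Variables (k : fieldType) (A : ualgType k).

Let tgr n (x : A) := if n == 0%N then x else 0.
Let tdif (x : A) : A := 0.

(* [A] concentrated in degree zero. *)
Definition dga0 : dga k.
Proof.
refine (@Dga k A tgr tdif _ _ _ _ _ _ _ _ _); rewrite /tgr /tdif.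
- by move=> n a x y; case: ifP => _ //; rewrite scaler0 addr0.
- by move=> [|m] [|n] x //=; case: eqP.
- by move=> x; exists 1%N; rewrite big_ord1.
- by [].
- move=> [|m] [|n] x y //= hx hy; [rewrite -hy mulr0|rewrite -hx mul0r|rewrite -hx mul0r] => //.
- by move=> a x y; rewrite scaler0 addr0.
- by [].
- by [].
- by move=> n x y _; rewrite mulr0 mul0r scaler0 addr0.
Defined.

Lemma uinj_calculus : calculus (@uinj k A).
Proof.
have fH : alg_hom0 (id : A -> dga0) by split=> //; split.
split; [exact: uinj_hom0|move=> a b e| |exact: uinj_gen].
  by have := congr1 (uext (id : A -> dga0)) e; rewrite !uext_inj.
have [[iL i1 iM] i0] := @uinj_hom0 k A.
suff h x : exists a, uinj a = gr 0 (x : Omega A).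
  by move=> x e; have [a] := h x; rewrite e => <-; exists a.
move: x; apply: uinj_gen => [|a|a].
- split; first by exists 1; rewrite i1 gr_one.
  + by move=> c x y [a ha] [b hb]; exists (c *: a + b); rewrite iL gr_lin ha hb.
  + move=> x y [a ha] [b hb]; exists (a * b).
    by rewrite iM gr_mulE big_ord1 subnn ha hb.
- by exists a; rewrite i0.
- by exists 0; rewrite (homogE 0 (dif_homog (i0 a))) (lin0 iL).
Qed.
End DegreeZero.

Section ProductModule.
Variables (k : fieldType) (I : Type) (T : I -> lmodType k).

Definition prodm : Type := forall i, T i.
HB.instance Definition _ := gen_eqMixin prodm.
HB.instance Definition _ := gen_choiceMixin prodm.

Let add (x y : prodm) : prodm := fun i => x i + y i.
Let opp (x : prodm) : prodm := fun i => - x i.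
Let zero : prodm := fun i => 0.
Let scale (a : k) (x : prodm) : prodm := fun i => a *: x i.

Let addA : associative add.
Proof. by move=> x y z; apply: functional_extensionality_dep => i; apply: addrA. Qed.
Let addC : commutative add.
Proof. by move=> x y; apply: functional_extensionality_dep => i; apply: addrC. Qed.
Let add0 : left_id zero add.
Proof. by move=> x; apply: functional_extensionality_dep => i; apply: add0r. Qed.
Let addN : left_inverse zero opp add.
Proof. by move=> x; apply: functional_extensionality_dep => i; apply: addNr. Qed.
HB.instance Definition _ := GRing.isZmodule.Build prodm addA addC add0 addN.

Let scaleA (a b : k) (x : prodm) : scale a (scale b x) = scale (a * b) x.
Proof. by apply: functional_extensionality_dep => i; apply: scalerA. Qed.
Let scale1 : left_id 1 scale.
Proof. by move=> x; apply: functional_extensionality_dep => i; apply: scale1r. Qed.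
Let scaleDr : right_distributive scale add.
Proof. by move=> a x y; apply: functional_extensionality_dep => i; apply: scalerDr. Qed.
Let scaleDl (x : prodm) a b : scale (a + b) x = add (scale a x) (scale b x).
Proof. by apply: functional_extensionality_dep => i; apply: scalerDl. Qed.
HB.instance Definition _ :=
  GRing.Zmodule_isLmodule.Build k prodm scaleA scale1 scaleDr scaleDl.
End ProductModule.

Record subspace (k : fieldType) (V : lmodType k) := Subspace {
  subspace_mem :> V -> Prop;
  subspace0 : subspace_mem 0;
  subspaceZD : forall (a : k) x y,
    subspace_mem x -> subspace_mem y -> subspace_mem (a *: x + y) }.

Section SubspaceModule.
Variables (k : fieldType) (V : lmodType k) (S : subspace V).

Definition subm : Type := {x : V | S x}.
HB.instance Definition _ := gen_eqMixin subm.
HB.instance Definition _ := gen_choiceMixin subm.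

Lemma subm_eq (x y : subm) : sval x = sval y -> x = y.
Proof. by case: x y => x hx [y hy] /= e; apply: eq_exist. Qed.

Let SD x y : S x -> S y -> S (x + y).
Proof. by move=> hx hy; rewrite -[x]scale1r; apply: subspaceZD. Qed.
Let SZ a x : S x -> S (a *: x).
Proof. by move=> hx; rewrite -[_ *: _]addr0; apply: subspaceZD => //; apply: subspace0. Qed.
Let SN x : S x -> S (- x).
Proof. by move=> hx; rewrite -scaleN1r; apply: SZ. Qed.

Let add (x y : subm) : subm := exist _ _ (SD (svalP x) (svalP y)).
Let opp (x : subm) : subm := exist _ _ (SN (svalP x)).
Let zero : subm := exist _ _ (subspace0 S).
Let scale (a : k) (x : subm) : subm := exist _ _ (SZ a (svalP x)).

Let addA : associative add.
Proof. by move=> x y z; apply: subm_eq; apply: addrA. Qed.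
Let addC : commutative add.
Proof. by move=> x y; apply: subm_eq; apply: addrC. Qed.
Let add0 : left_id zero add.
Proof. by move=> x; apply: subm_eq; apply: add0r. Qed.
Let addN : left_inverse zero opp add.
Proof. by move=> x; apply: subm_eq; apply: addNr. Qed.
HB.instance Definition _ := GRing.isZmodule.Build subm addA addC add0 addN.

Let scaleA (a b : k) (x : subm) : scale a (scale b x) = scale (a * b) x.
Proof. by apply: subm_eq; apply: scalerA. Qed.
Let scale1 : left_id 1 scale.
Proof. by move=> x; apply: subm_eq; apply: scale1r. Qed.
Let scaleDr : right_distributive scale add.
Proof. by move=> a x y; apply: subm_eq; apply: scalerDr. Qed.
Let scaleDl (x : subm) a b : scale (a + b) x = add (scale a x) (scale b x).
Proof. by apply: subm_eq; apply: scalerDl. Qed.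
HB.instance Definition _ :=
  GRing.Zmodule_isLmodule.Build k subm scaleA scale1 scaleDr scaleDl.
End SubspaceModule.

Record hopf (k : fieldType) := Hopf {
  hopf_alg :> ualgType k;
  comul : hopf_alg -> tensor hopf_alg hopf_alg;
  counit : hopf_alg -> k;
  antipode : hopf_alg -> hopf_alg;
  comul_hom : alg_hom comul;
  counit_lin : forall (a : k) g h, counit (a *: g + h) = a * counit g + counit h;
  counit_one : counit 1 = 1;
  counit_mul : {morph counit : g h / g * h};
  comul_coassoc : forall h, tassoc (tmap comul id (comul h)) = tmap id comul (comul h);
  comul_counitl : forall h, tsum (fun h1 h2 : hopf_alg => counit h1 *: h2) (comul h) = h;
  comul_counitr : forall h, tsum (fun h1 h2 : hopf_alg => counit h2 *: h1) (comul h) = h;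
  antipode_lin : linear antipode;
  antipodel : forall h, tsum (fun h1 h2 : hopf_alg => antipode h1 * h2) (comul h) = counit h *: (1 : hopf_alg);
  antipoder : forall h, tsum (fun h1 h2 : hopf_alg => h1 * antipode h2) (comul h) = counit h *: (1 : hopf_alg);
  antipode_bij : bijective antipode }.

(* The Sweedler sum of [f h_1 h_2 h_3]. *)
Definition tsum3 (k : fieldType) (H : hopf k) (W : zmodType) (f : H -> H -> H -> W)
    (h : H) : W :=
  tsum (fun h' h3 => tsum (fun h1 h2 => f h1 h2 h3) (comul h')) (comul h).

Record coaction (k : fieldType) (H : hopf k) (V : lmodType k)
    (rho : V -> tensor V H) : Prop := Coaction {
  coaction_lin : linear rho;
  coaction_assoc : forall v, tassoc (tmap rho id (rho v)) = tmap id (@comul k H) (rho v);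
  coaction_counit : forall v, tsum (fun w h => counit h *: w) (rho v) = v }.

Record qpfb (k : fieldType) (H : hopf k) (P B : ualgType k) (I : finType) := Qpfb {
  coact : P -> tensor P H;
  coactP : coaction coact;
  coact_hom : alg_hom coact;
  base_ideal : I -> tideal B;
  base_complete : complete_covering base_ideal;
  chi : forall i, P -> tensor (aquot (base_ideal i)) H;
  chi_hom : forall i, alg_hom (chi i);
  chi_surj : forall i y, exists p, chi i p = y;
  iota : B -> P;
  iota_hom : alg_hom iota;
  iota_inj : injective iota;
  chi_coact : forall i p,
    tmap id (@comul k H) (chi i p) = tassoc (tmap (chi i) id (coact p));
  chi_iota : forall i b, chi i (iota b) = aproj (base_ideal i) b ⊗ (1 : H);
  chi_complete : complete_covering (fun i => ker_ideal (chi_hom i));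
  iota_coinv : forall p, (exists b, iota b = p) <-> coact p = p ⊗ (1 : H) }.

Section Bundle.
Variables (k : fieldType) (H : hopf k) (P B : ualgType k) (I : finType).
Variable Q : qpfb H P B I.

Notation J := (base_ideal Q).

Definition Bi (i : I) : ualgType k := aquot (J i).
Definition Jij (i j : I) : tideal B := ideal_add (J i) (J j).
(* [Bij i j] and [Bij j i] are distinct types, identified by [qproj]. *)
Definition Bij (i j : I) : ualgType k := aquot (Jij i j).

Definition pil (i j : I) : Bi i -> Bij i j := @qproj k B (J i) (Jij i j).
Definition pir (i j : I) : Bi j -> Bij i j := @qproj k B (J j) (Jij i j).

(* The isomorphisms [phi_ij], which are uniquely determined by [Q]. *)
Record transitions := Transitions {
  phi : forall i j, tensor (Bij i j) H -> tensor (Bij i j) H;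
  phi_hom : forall i j, alg_hom (@phi i j);
  phi_bij : forall i j, bijective (@phi i j);
  phi_chi : forall i j p,
    tmap (@pil i j) id (chi Q i p) = phi (tmap (@pir i j) id (chi Q j p)) }.

(* [tauji T i j] is [tau_ji] and [tauij T i j] is [tau_ij], both with values in
   [Bij i j]. *)
Definition tauji (T : transitions) (i j : I) (h : H) : Bij i j :=
  tsum (fun a g => counit g *: a) (phi T ((1 : Bij i j) ⊗ h)).
Definition tauij (T : transitions) (i j : I) (h : H) : Bij i j :=
  qproj (Jij i j) (tauji T j i h).

Record diff_structure := DiffStructure {
  GB : I -> dga k;
  jB : forall i, Bi i -> GB i;
  GB_calculus : forall i, calculus (@jB i);
  GH : dga k;
  jH : H -> GH;
  GH_calculus : calculus jH;
  coactH : GH -> tensor GH H;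
  coactHP : coaction coactH;
  coactH_formula : forall (h0 : H) (hs : seq H),
    coactH (jH h0 * \prod_(h <- hs) dif (jH h)) =
    tmap jH id (comul h0) * \prod_(h <- hs) tmap (fun g => dif (jH g)) id (comul h) }.

Arguments jB : clear implicits.
Arguments jH : clear implicits.
Arguments coactH : clear implicits.

Section Forms.
Variable D : diff_structure.

Local Notation GB := (GB D).
Local Notation GH := (GH D).
Local Notation jB := (jB D).
Local Notation jH := (jH D).

Lemma jB_hom0 i : alg_hom0 (jB i). Proof. exact: GB_calculus. Qed.
Lemma jH_hom0 : alg_hom0 jH. Proof. exact: GH_calculus. Qed.

(* The differential algebra [Gamma(B_i) (x) Gamma(H)]. *)
Definition GBH (i : I) : dga k := gtensor (GB i) GH.

Lemma tmap_hom0 i : alg_hom0 (tmap (jB i) jH : tensor (Bi i) H -> GBH i).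
Proof.
have [[bL b1 bM] b0] := jB_hom0 i; have [[hL h1 hM] h0] := jH_hom0.
have tL := tmap_lin bL hL.
split; last first.
  elim/tensor_ind => [|x y hx hy|b h]; first by rewrite (lin0 tL); apply: homog0.
    by rewrite (linD tL) /homog (linD (gr_lin _)) hx hy.
  by rewrite tmap_tens // /homog (gtensor_grE 0 (b0 b) (h0 h)).
split=> //; first by rewrite -tens_one tmap_tens // b1 h1.
elim/tensor_ind => [y|x x' hx hx' y|b h]; first by rewrite mul0r (lin0 tL) mul0r.
  by rewrite mulrDl !(linD tL) hx hx' mulrDl.
elim/tensor_ind => [|y y' hy hy'|b' h']; first by rewrite mulr0 (lin0 tL) mulr0.
  by rewrite mulrDr !(linD tL) hy hy' mulrDr.
rewrite tens_mul !tmap_tens // bM hM.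
by rewrite (gtensor_mulE _ _ (h0 h) (b0 b')) scale1r.
Qed.

Lemma tens1l_hom i : dga_hom (fun g => g ⊗ (1 : GH) : GBH i).
Proof.
split.
- split=> [a x y||x y]; [exact: (tens_bilin _ _).1|by []|].
  move: x y; apply: homog_ind => [y|x x' hx hx' y|n x hx].
  + by rewrite mul0r tens0l mul0r.
  + by rewrite mulrDl !tensDl hx hx' mulrDl.
  apply: homog_ind => [|y y' hy hy'|m y hy]; first by rewrite mulr0 tens0l mulr0.
    by rewrite mulrDr !tensDl hy hy' mulrDr.
  by rewrite (gtensor_mulE _ _ (gr_one GH) hy) mul0n scale1r mulr1.
- move=> n; apply: homog_ind => [|x y hx hy|m x hx].
  + by rewrite (lin0 (gr_lin n)) tens0l (lin0 (gr_lin n)).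
  + by rewrite (linD (gr_lin n)) !tensDl hx hy (linD (gr_lin n)).
  rewrite (homogE n hx) (gtensor_grE n hx (gr_one GH)) addn0.
  by case: eqP => //; rewrite tens0l.
- apply: homog_ind => [|x y hx hy|m x hx].
  + by rewrite (lin0 (@dif_lin _ _)) tens0l (lin0 (@dif_lin _ _)).
  + by rewrite (linD (@dif_lin _ _)) !tensDl hx hy (linD (@dif_lin _ _)).
  by rewrite (gtensor_difE _ hx) dif_one tens0r scaler0 addr0.
Qed.

Lemma tens1r_hom i : dga_hom (fun r => (1 : GB i) ⊗ r : GBH i).
Proof.
split.
- split=> [a x y||x y]; [exact: (tens_bilin _ _).2|by []|].
  move: x y; apply: homog_ind => [y|x x' hx hx' y|n x hx y].
  + by rewrite mul0r tens0r mul0r.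
  + by rewrite mulrDl !tensDr hx hx' mulrDl.
  by rewrite (gtensor_mulE _ _ hx (gr_one (GB i))) muln0 scale1r mulr1.
- move=> n; apply: homog_ind => [|x y hx hy|m x hx].
  + by rewrite (lin0 (gr_lin n)) tens0r (lin0 (gr_lin n)).
  + by rewrite (linD (gr_lin n)) !tensDr hx hy (linD (gr_lin n)).
  rewrite (homogE n hx) (gtensor_grE n (gr_one (GB i)) hx) add0n.
  by case: eqP => //; rewrite tens0r.
- move=> x; rewrite (gtensor_difE _ (gr_one (GB i))) dif_one tens0l add0r.
  by rewrite expr0 scale1r.
Qed.

Lemma GBH_gen i (S : GBH i -> Prop) : subalgebra S ->
  (forall y, S (tmap (jB i) jH y)) -> (forall y, S (dif (tmap (jB i) jH y : GBH i))) ->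
  forall x, S x.
Proof.
move=> [S1 SL SM] Sa Sd.
have [[bL b1 bM] b0] := jB_hom0 i; have [[hL h1 hM] h0] := jH_hom0.
have S0 : S 0 by rewrite -[0](addNr 1) -scaleN1r; apply: SL.
have Sl g : S (g ⊗ (1 : GH)).
  have gH := tens1l_hom i.
  move: g; apply: (calc_gen (GB_calculus D i)) => [|b|b].
  - split; first exact: S1.
    + by move=> a x y Sx Sy; rewrite (ah_lin gH); apply: SL.
    + by move=> x y Sx Sy; rewrite (ah_mul gH); apply: SM.
  - by have := Sa (b ⊗ (1 : H)); rewrite tmap_tens // h1.
  - by have := Sd (b ⊗ (1 : H)); rewrite tmap_tens // h1 -(dh_dif gH).
have Sr r : S ((1 : GB i) ⊗ r).
  have gH := tens1r_hom i.
  move: r; apply: (calc_gen (GH_calculus D)) => [|b|b].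
  - split; first exact: S1.
    + by move=> a x y Sx Sy; rewrite (ah_lin gH); apply: SL.
    + by move=> x y Sx Sy; rewrite (ah_mul gH); apply: SM.
  - by have := Sa ((1 : Bi i) ⊗ b); rewrite tmap_tens // b1.
  - by have := Sd ((1 : Bi i) ⊗ b); rewrite tmap_tens // b1 -(dh_dif gH).
apply: tensor_ind => [//|x y Sx Sy|g r].
  by rewrite -[x]scale1r; apply: SL.
have -> : g ⊗ r = (g ⊗ (1 : GH) : GBH i) * ((1 : GB i) ⊗ r : GBH i); last exact: SM.
by rewrite (gtensor_mulE _ _ (gr_one GH) (gr_one (GB i))) mulr1 mul1r scale1r.
Qed.

(* The maps [chi_i : Omega(P) -> Gamma(B_i) (x) Gamma(H)]. *)
Definition chi0 (i : I) (p : P) : GBH i := tmap (jB i) jH (chi Q i p).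
Lemma chi0_hom0 i : alg_hom0 (chi0 i).
Proof.
have [h h0] := tmap_hom0 i; split; last by move=> p; apply: h0.
by apply: (alg_hom_comp h); apply: chi_hom.
Qed.
Definition chiO (i : I) : Omega P -> GBH i := uext (chi0 i).
Lemma chiO_hom i : dga_hom (chiO i). Proof. exact/uext_hom/chi0_hom0. Qed.

(* [Gamma(P)] and the induced maps [chi_i : Gamma(P) -> Gamma(B_i) (x) Gamma(H)]. *)
Definition GP : dga k := dquot (dideal_cap (fun i => dker (chiO_hom i))).
Definition chiG (i : I) (x : GP) : GBH i := chiO i (drepr x).

Lemma chiG_proj i w : chiG i (dproj _ w) = chiO i w.
Proof.
have /dprojP/(_ i) /= := dreprK (dproj (dideal_cap (fun i => dker (chiO_hom i))) w); rewrite (linB (ah_lin (chiO_hom i))) => /eqP.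
by rewrite subr_eq0 => /eqP.
Qed.
Lemma chiG_hom i : dga_hom (chiG i).
Proof.
have pH := dproj_hom (dideal_cap (fun i => dker (chiO_hom i))).
have cH := chiO_hom i.
have e := dreprK (J := dideal_cap (fun i => dker (chiO_hom i))).
split; first split.
- by move=> a x y; rewrite -(e x) -(e y) -(ah_lin pH) !chiG_proj (ah_lin cH).
- by rewrite -(ah_one pH) chiG_proj (ah_one cH).
- by move=> x y; rewrite -(e x) -(e y) -(ah_mul pH) !chiG_proj (ah_mul cH).
- by move=> n x; rewrite -(e x) -(dh_gr pH) !chiG_proj (dh_gr cH).
- by move=> x; rewrite -(e x) -(dh_dif pH) !chiG_proj (dh_dif cH).
Qed.
Lemma chiG_surj i y : exists x, chiG i x = y.
Proof.
move: y; apply: (dga_hom_surj (@GBH_gen i) (chiG_hom i)) => y.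
have [p <-] := chi_surj y; exists (dproj _ (uinj p)).
by rewrite chiG_proj /chiO uext_inj //; apply: chi0_hom0.
Qed.

(* [Gij i j] is [Gamma^i(B_ij (x) H)], [qij i j] the map [(pi^i_j (x) id)_Gamma]. *)
Definition Nij (i j : I) : dideal (GBH i) :=
  dimage (chiG_hom i) (@chiG_surj i) (dker (chiG_hom j)).
Definition Gij (i j : I) : dga k := dquot (Nij i j).
Definition qij (i j : I) (x : GBH i) : Gij i j := dproj (Nij i j) x.
Arguments qij : clear implicits.

(* For [L = J_i + J_j], the inclusion of [B/L (x) H] as degree zero part of
   [Gij i j]: [a] is lifted to [B_i], the choice of the lift being irrelevant
   (see [incG_tens]). *)
Definition incG (L : tideal B) (i j : I) : tensor (aquot L) H -> Gij i j :=
  tsum (fun (a : aquot L) (h : H) => qij i j (jB i (qproj (J i) a) ⊗ jH h)).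

Section Inclusion.
Variables (L : tideal B) (i j : I).
Hypothesis LJ : forall b, L b -> Jij i j b.

Let c (b : B) (h : H) : Gij i j := qij i j (jB i (aproj (J i) b) ⊗ jH h).
Let qH : dga_hom (qij i j). Proof. exact: dproj_hom. Qed.

Let c_bilin : bilin c.
Proof.
have bL := lin_comp (ah_lin (jB_hom0 i)) (ah_lin (aproj_hom (J i))).
have hL := ah_lin jH_hom0.
have tB := bilin_comp (tens_bilin (GB i) GH) bL hL.
split=> [h|b] a x y; rewrite /c.
  by rewrite -(ah_lin qH); congr (qij i j _); apply: (tB.1 h).
by rewrite -(ah_lin qH); congr (qij i j _); apply: (tB.2 b).
Qed.

Let c0 b h : L b -> c b h = 0.
Proof.
move=> /LJ [x [y [Jx Jy ->]]]; rewrite (linD (c_bilin.1 h)).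
have [[bL b1 bM] b0] := jB_hom0 i; have [[hL h1 hM] h0] := jH_hom0.
have -> : c x h = 0.
  rewrite /c; have -> : aproj (J i) x = 0 by apply/aproj_eq0.
  by rewrite (lin0 bL) tens0l (lin0 (ah_lin qH)).
rewrite add0r; have [p hp] := @chi_surj _ _ _ _ _ Q i ((1 : Bi i) ⊗ h).
apply/dproj_eq0; exists (dproj _ (uinj (iota Q y * p))) => /=.
  rewrite chiG_proj /chiO uext_inj; last exact: chi0_hom0.
  rewrite /chi0 (ah_mul (chi_hom Q j)) chi_iota.
  have -> : aproj (J j) y = 0 by apply/aproj_eq0.
  by rewrite tens0l mul0r (lin0 (ah_lin (tmap_hom0 j))).
rewrite chiG_proj /chiO uext_inj; last exact: chi0_hom0.
rewrite /chi0 (ah_mul (chi_hom Q i)) chi_iota hp.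
by rewrite tens_mul mulr1 mul1r tmap_tens.
Qed.

Let cr (a : aquot L) h : qij i j (jB i (qproj (J i) a) ⊗ jH h) = c (arepr a) h.
Proof. by []. Qed.
Let crE b h : c (arepr (aproj L b)) h = c b h.
Proof.
apply/eqP; rewrite -subr_eq0 -(linB (c_bilin.1 h)); apply/eqP/c0.
exact: aproj_repr.
Qed.

Let inc_bilin :
  bilin (fun (a : aquot L) (h : H) => qij i j (jB i (qproj (J i) a) ⊗ jH h)).
Proof.
split=> [h|a] x y z; last by rewrite !cr (c_bilin.2 _).
elim/aquotW: y => y; elim/aquotW: z => z.
by rewrite -(ah_lin (aproj_hom L)) !cr !crE (c_bilin.1 h).
Qed.

Lemma incG_tens b h :
  incG i j (aproj L b ⊗ h) = qij i j (jB i (aproj (J i) b) ⊗ jH h).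
Proof. by rewrite /incG tsum_tens // cr crE. Qed.

Lemma incG_hom0 : alg_hom0 (@incG L i j).
Proof.
have iL : linear (@incG L i j) by apply: tsum_lin.
have [[bL b1 bM] b0] := jB_hom0 i; have [[hL h1 hM] h0] := jH_hom0.
have [pL p1 pM] := aproj_hom (J i).
split.
  split=> //.
  - have -> : 1 = aproj L 1 ⊗ (1 : H) :> tensor (aquot L) H by [].
    by rewrite incG_tens p1 b1 h1; apply: ah_one qH.
  elim/tensor_ind => [y|x x' hx hx' y|b h]; first by rewrite mul0r (lin0 iL) mul0r.
    by rewrite mulrDl !(linD iL) hx hx' mulrDl.
  elim/tensor_ind => [|y y' hy hy'|b' h']; first by rewrite mulr0 (lin0 iL) mulr0.
    by rewrite mulrDr !(linD iL) hy hy' mulrDr.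
  elim/aquotW: b => b; elim/aquotW: b' => b'.
  rewrite tens_mul -aprojM !incG_tens -(ah_mul qH).
  by rewrite (gtensor_mulE _ _ (h0 h) (b0 _)) scale1r pM bM hM.
elim/tensor_ind => [|x y hx hy|b h]; first by rewrite (lin0 iL); apply: homog0.
  by rewrite (linD iL) /homog (linD (gr_lin _)) hx hy.
elim/aquotW: b => b; rewrite incG_tens /homog -(dh_gr qH).
by rewrite (gtensor_grE 0 (b0 _) (h0 h)).
Qed.
End Inclusion.

Lemma JijC i j b : Jij i j b -> Jij j i b.
Proof. by move=> [x [y [hx hy ->]]]; exists y, x; split=> //; rewrite addrC. Qed.

Definition incl (i j : I) : tensor (Bij i j) H -> Gij i j := @incG (Jij i j) i j.
Definition incr (i j : I) : tensor (Bij i j) H -> Gij j i := @incG (Jij i j) j i.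
Lemma incl_hom0 i j : alg_hom0 (@incl i j). Proof. exact: incG_hom0. Qed.
Lemma incr_hom0 i j : alg_hom0 (@incr i j).
Proof. by apply: incG_hom0 => b; apply: JijC. Qed.

(* The extensions of [phi_ij] to isomorphisms of differential algebras; these are
   uniquely determined, [Gij j i] being generated by its degree zero part. *)
Record transition_ext (T : transitions) := TransitionExt {
  phiG : forall i j, Gij j i -> Gij i j;
  phiG_hom : forall i j, dga_hom (@phiG i j);
  phiG_bij : forall i j, bijective (@phiG i j);
  phiG_ext : forall i j x, phiG (@incr i j x) = @incl i j (phi T x) }.

(* The differential ideal [J^i(B_ij (x) H)]. *)
Definition Jl (i j : I) : dideal (Omega (tensor (Bij i j) H)) :=
  dker (uext_hom (incl_hom0 i j)).

Lemma tens1_hom0 i j : alg_hom0 (fun a : Bij i j => uinj (a ⊗ (1 : H))).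
Proof.
have [uH u0] := @uinj_hom0 k (tensor (Bij i j) H).
split; last by move=> a; apply: u0.
apply: (alg_hom_comp uH); split=> [a x y||x y]; first exact: (tens_bilin _ _).1.
  by [].
by rewrite tens_mul mulr1.
Qed.

(* [J^i(B_ij (x) H)] intersected with [Omega(B_ij (x) 1)], as an ideal of
   [Omega(B_ij)]. *)
Definition Jm (i j : I) : dideal (Omega (Bij i j)) :=
  dideal_pre (uext_hom (tens1_hom0 i j)) (Jl i j).
Definition Gm (i j : I) : dga k := dquot (Jm i j).
Definition jm (i j : I) (a : Bij i j) : Gm i j := dproj (Jm i j) (uinj a).

(* The injections of [Gamma_m(B_ij)] into [Gamma^i(B_ij (x) H)] and into
   [Gamma^j(B_ij (x) H)]. *)
Definition iotal (i j : I) (x : Gm i j) : Gij i j :=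
  uext (fun a : Bij i j => incl (a ⊗ (1 : H))) (drepr x).
Definition iotar (i j : I) (x : Gm i j) : Gij j i :=
  uext (fun a : Bij i j => incr (a ⊗ (1 : H))) (drepr x).

(* [pi^i_j] and [pi^j_i] with values in [Gamma_m(B_ij)]: the unique preimages under
   the above injections. *)
Definition piml (i j : I) (g : GB i) : Gm i j :=
  xget 0 [set x | iotal x = qij i j (g ⊗ (1 : GH))].
Definition pimr (i j : I) (g : GB j) : Gm i j :=
  xget 0 [set x | iotar x = qij j i (g ⊗ (1 : GH))].
Arguments piml : clear implicits.
Arguments pimr : clear implicits.

(* [Gamma(B)] with the induced maps [pi_i : Gamma(B) -> Gamma(B_i)]. *)
Definition pi0 (i : I) (b : B) : GB i := jB i (aproj (J i) b).
Lemma pi0_hom0 i : alg_hom0 (pi0 i).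
Proof.
have [h h0] := jB_hom0 i; split; last by move=> b; apply: h0.
by apply: (alg_hom_comp h); apply: aproj_hom.
Qed.
Definition piO (i : I) : Omega B -> GB i := uext (pi0 i).
Lemma piO_hom i : dga_hom (piO i). Proof. exact/uext_hom/pi0_hom0. Qed.
Definition GBase : dga k := dquot (dideal_cap (fun i => dker (piO_hom i))).
Definition piG (i : I) (x : GBase) : GB i := piO i (drepr x).

Lemma piG_proj i w : piG i (dproj _ w) = piO i w.
Proof.
have /dprojP/(_ i) /= := dreprK (dproj (dideal_cap (fun i => dker (piO_hom i))) w); rewrite (linB (ah_lin (piO_hom i))) => /eqP.
by rewrite subr_eq0 => /eqP.
Qed.
Lemma piG_hom i : dga_hom (piG i).
Proof.
have pH := dproj_hom (dideal_cap (fun i => dker (piO_hom i))).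
have cH := piO_hom i.
have e := dreprK (J := dideal_cap (fun i => dker (piO_hom i))).
split; first split.
- by move=> a x y; rewrite -(e x) -(e y) -(ah_lin pH) !piG_proj (ah_lin cH).
- by rewrite -(ah_one pH) piG_proj (ah_one cH).
- by move=> x y; rewrite -(e x) -(e y) -(ah_mul pH) !piG_proj (ah_mul cH).
- by move=> n x; rewrite -(e x) -(dh_gr pH) !piG_proj (dh_gr cH).
- by move=> x; rewrite -(e x) -(dh_dif pH) !piG_proj (dh_dif cH).
Qed.

(* [rho] belongs to [Gamma_c(B)]; the image of [rho i] in
   [Gamma(B)/(ker pi_i + ker pi_j)] is that of any of its lifts to [Gamma(B)]. *)
Definition in_GcB (rho : forall i, GB i) : Prop :=
  forall i j, exists w w' : GBase,
    [/\ piG i w = rho i, piG j w' = rho j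
      & let K := dideal_add (dker (piG_hom i)) (dker (piG_hom j)) in
        dproj K w = dproj K w'].
Definition GcB : Type := {rho : forall i, GB i | in_GcB rho}.

Section Completion.
Variables (T : transitions) (E : transition_ext T).

Definition in_GcP (x : prodm GBH) : Prop :=
  forall i j, qij i j (x i) = phiG E (qij j i (x j)).

Definition horizontal (i : I) (x : GBH i) : Prop :=
  exists t : tensor (GB i) H, x = tmap id jH t.

Lemma horizontal0 i : horizontal (0 : GBH i).
Proof.
exists 0; rewrite (lin0 (tmap_lin _ _)) //; exact: (ah_lin jH_hom0).
Qed.
Lemma horizontalZD i (a : k) (x y : GBH i) :
  horizontal x -> horizontal y -> horizontal (a *: x + y).
Proof.
move=> [s ->] [t ->]; exists (a *: s + t).
by rewrite (tmap_lin _ (ah_lin jH_hom0)).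
Qed.
Lemma horizontalMl i (g : GB i) (x : GBH i) :
  horizontal x -> horizontal ((g ⊗ (1 : GH) : GBH i) * x).
Proof.
have tL := tmap_lin (@lin_id k (GB i)) (ah_lin jH_hom0).
move=> [t ->]; elim/tensor_ind: t => [|s t hs ht|w h].
- by rewrite (lin0 tL) mulr0; apply: horizontal0.
- by rewrite (linD tL) mulrDr -[_ * _]scale1r; apply: horizontalZD.
move: w; apply: homog_ind => [|w w' hw hw'|n w hw].
- by rewrite tens0l (lin0 tL) mulr0; apply: horizontal0.
- by rewrite tensDl (linD tL) mulrDr -[_ * _]scale1r; apply: horizontalZD.
exists ((g * w) ⊗ h); rewrite !tmap_tens //; try exact: (ah_lin jH_hom0).
by rewrite (gtensor_mulE _ _ (gr_one GH) hw) mul0n scale1r mul1r.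
Qed.
Lemma horizontalMr i (g : GB i) (x : GBH i) :
  horizontal x -> horizontal (x * (g ⊗ (1 : GH) : GBH i)).
Proof.
have tL := tmap_lin (@lin_id k (GB i)) (ah_lin jH_hom0).
move=> [t ->]; elim/tensor_ind: t => [|s t hs ht|w h].
- by rewrite (lin0 tL) mul0r; apply: horizontal0.
- by rewrite (linD tL) mulrDl -[_ * _]scale1r; apply: horizontalZD.
move: g; apply: homog_ind => [|g g' hg hg'|n g hg].
- by rewrite tens0l mulr0; apply: horizontal0.
- by rewrite tensDl mulrDr -[_ * _]scale1r; apply: horizontalZD.
exists ((w * g) ⊗ h); rewrite !tmap_tens //; try exact: (ah_lin jH_hom0).
by rewrite (gtensor_mulE _ _ (ah0_deg jH_hom0 h) hg) mul0n scale1r mulr1.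
Qed.

Definition hor_subspace : subspace (prodm GBH).
Proof.
exists (fun x => in_GcP x /\ forall i, horizontal (x i)).
- split=> [i j|i]; last exact: horizontal0.
  rewrite (lin0 (ah_lin (phiG_hom E i j)) : phiG E 0 = 0) //.
- move=> a x y [cx hx] [cy hy]; split=> [i j|i]; last exact: horizontalZD.
  have qL i' j' := ah_lin (dproj_hom (Nij i' j')).
  have := cx i j; have := cy i j.
  rewrite /qij => ey ex; rewrite !qL ex ey.
  by rewrite (ah_lin (phiG_hom E i j)).
Defined.
Definition hor : Type := subm hor_subspace.
HB.instance Definition _ := GRing.Lmodule.on hor.

Definition hchi (i : I) (x : hor) : GBH i := sval x i.

Lemma hor_one_subproof : hor_subspace (fun i => 1).
Proof.
split=> [i j|i].
  by rewrite /qij !(ah_one (dproj_hom _)) (ah_one (phiG_hom E i j)).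
exists ((1 : GB i) ⊗ (1 : H)).
by rewrite tmap_tens ?(ah_one jH_hom0) //; apply: (ah_lin jH_hom0).
Qed.
Definition hor_one : hor := exist _ _ hor_one_subproof.

(* [iota_Gc : Gamma_c(B) -> Gamma_c(P)] *)
Definition iotaG (g : GcB) (i : I) : GBH i := sval g i ⊗ (1 : GH).

Lemma iotaG_in g : in_GcP (iotaG g : prodm GBH).
Proof.
have tH := tens1l_hom.
have qH i j := dproj_hom (Nij i j).
have key i j (w : GBase) :
    qij i j (piG i w ⊗ (1 : GH)) = phiG E (qij j i (piG j w ⊗ (1 : GH))).
  rewrite -(dreprK w).
  rewrite !piG_proj; move: (drepr w).
  have h1 := dga_hom_comp (dga_hom_comp (qH i j) (tH i)) (piO_hom i).
  have h2 := dga_hom_comp (phiG_hom E i j)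
    (dga_hom_comp (dga_hom_comp (qH j i) (tH j)) (piO_hom j)).
  refine (uext_unique h1 h2 _) => b.
  have pu l : piO l (uinj b) = pi0 l b by apply: uext_inj; apply: pi0_hom0.
  rewrite !pu.
  have el := @incG_tens (Jij i j) i j (fun b h => h) b 1.
  have er := @incG_tens (Jij i j) j i (@JijC i j) b 1.
  have j1 := ah_one jH_hom0; rewrite j1 in el er.
  rewrite /pi0 -[LHS]/(qij i j _) -el -[X in phiG E X]/(qij j i _) -er.
  rewrite [RHS](phiG_ext E (aproj (Jij i j) b ⊗ (1 : H))); congr (incG _ _ _).
  have pE (l : I) (hl : forall x, J l x -> Jij i j x) (x : B) :
      qproj (Jij i j) (aproj (J l) x) = aproj (Jij i j) x.
    by apply/aprojP/hl; apply: aproj_repr.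
  have pL (l : I) (hl : forall x, J l x -> Jij i j x) :
      linear (@qproj k B (J l) (Jij i j)).
    move=> a; elim/aquotW=> x; elim/aquotW=> y.
    by rewrite -(ah_lin (aproj_hom (J l))) !pE // (ah_lin (aproj_hom _)).
  have hli x : J i x -> Jij i j x.
    by move=> h; exists x, 0; split=> //; [apply: tideal0|rewrite addr0].
  have hlj x : J j x -> Jij i j x.
    by move=> h; exists 0, x; split=> //; [apply: tideal0|rewrite add0r].
  have := phi_chi T i j (iota Q b); rewrite !chi_iota.
  by rewrite !tmap_tens ?/pil ?/pir ?pE //; apply: pL.
move=> i j; have [w [w' [ew ew' /dprojP [x [y [/= hx hy e]]]]]] := svalP g i j.
assert (ei : sval g i = piG i (w' + y)).
  have ew2 : w = x + (w' + y) by rewrite addrCA -e addrC subrK.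
  by rewrite -ew ew2 (linD (ah_lin (piG_hom i)) x) hx add0r.
assert (ej : sval g j = piG j (w' + y)).
  by rewrite (linD (ah_lin (piG_hom j)) w') hy addr0 ew'.
assert (h := key i j (w' + y)).
refine (etrans (congr1 (fun z => qij i j (z ⊗ (1 : GH))) ei) (etrans h _)).
exact: (congr1 (fun z => phiG E (qij j i (z ⊗ (1 : GH)))) (esym ej)).
Qed.

Lemma hor_mull_subproof (g : GcB) (x : hor) :
  hor_subspace (fun i => iotaG g i * hchi i x).
Proof.
split=> [i j|i]; last exact: horizontalMl _ ((svalP x).2 i).
have qH i' j' := dproj_hom (Nij i' j').
rewrite /qij !(ah_mul (qH _ _)) (ah_mul (phiG_hom E i j)).
by have := iotaG_in g i j; have := (svalP x).1 i j; rewrite /qij => -> ->.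
Qed.
Definition hor_mull (g : GcB) (x : hor) : hor := exist _ _ (hor_mull_subproof g x).

Lemma hor_mulr_subproof (x : hor) (g : GcB) :
  hor_subspace (fun i => hchi i x * iotaG g i).
Proof.
split=> [i j|i]; last exact: horizontalMr _ ((svalP x).2 i).
have qH i' j' := dproj_hom (Nij i' j').
rewrite /qij !(ah_mul (qH _ _)) (ah_mul (phiG_hom E i j)).
by have := iotaG_in g i j; have := (svalP x).1 i j; rewrite /qij => -> ->.
Qed.
Definition hor_mulr (x : hor) (g : GcB) : hor := exist _ _ (hor_mulr_subproof x g).

Definition homog_hor (n : nat) (x : hor) : Prop := forall i, homog n (hchi i x).
Definition homog_GcB (n : nat) (g : GcB) : Prop := forall i, homog n (sval g i).

(* The coaction on [hor Gamma_c(P)]: the unique element of the tensor product of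
   [hor Gamma_c(P)] and [H] with the components [(id (x) Delta^Gamma)(x_i)]. *)
Definition hor_coact (x : hor) : tensor hor H :=
  xget 0 [set t | forall i,
    tassoc (tmap (hchi i) id t) = tmap id (coactH D) (hchi i x)].

Record covariant (N : hor -> hor) : Prop := Covariant {
  cov_lin : linear N;
  cov_deg : forall n x, homog_hor n x -> homog_hor n.+1 (N x);
  cov_one : N hor_one = 0;
  cov_coact : forall x, tmap N id (hor_coact x) = hor_coact (N x);
  cov_ker : forall i x, hchi i x = 0 -> hchi i (N x) = 0 }.

Definition left_covariant_derivative (N : hor -> hor) : Prop :=
  covariant N /\
  forall n (g : GcB) (x : hor), homog_GcB n g -> forall i,
    hchi i (N (hor_mull g x)) =
    dif (iotaG g i) * hchi i x + (-1) ^+ n *: (iotaG g i * hchi i (N x)).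

Definition right_covariant_derivative (N : hor -> hor) : Prop :=
  covariant N /\
  forall n (x : hor) (g : GcB), homog_hor n x -> forall i,
    hchi i (N (hor_mulr x g)) =
    hchi i (N x) * iotaG g i + (-1) ^+ n *: (hchi i x * dif (iotaG g i)).
End Completion.

Record connection_forms (T : transitions) (A : forall i, H -> GB i) : Prop := {
  cf_lin : forall i, linear (A i);
  cf_deg : forall i h, homog 1 (A i h);
  cf_one : forall i, A i 1 = 0;
  cf_glue : forall i j h,
    piml i j (A i h) =
      tsum3 (fun h1 h2 h3 =>
        jm (tauij T i j h1) * pimr i j (A j h2) * jm (tauji T i j h3)) h
      + tsum (fun h1 h2 => jm (tauij T i j h1) * dif (jm (tauji T i j h2))) (comul h) }.

(* [A i] is the map [h |-> - (id (x) eps) (N_i (1 (x) h))], where [N_i] is the map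
   induced by [N] on [Gamma(B_i) (x) H]; with the opposite sign the
   inhomogeneous term of [cf_glue] would change sign. *)
Definition local_forms (T : transitions) (E : transition_ext T)
    (N : hor E -> hor E) (A : forall i, H -> GB i) : Prop :=
  forall i h (x : hor E), hchi i x = (1 : GB i) ⊗ jH h ->
    hchi i (N x) = - tsum (fun h1 h2 => A i h1 ⊗ jH h2) (comul h).
End Forms.
End Bundle.

(* Main.v *)
Require Import Defs.
From mathcomp Require Import all_boot all_order all_algebra.
From mathcomp Require Import boolp classical_sets reals.
From mathcomp.real_closed Require Import complex.

(* A covariant derivative preserves the kernels of the projections to the charts, so
   it is a family of maps [D_i] on [Gamma(B_i) (x) H]. By the Leibniz rule [D_i] is
   determined by [D_i(1 (x) h)], and by covariance
   [D_i(1 (x) h) = - sum A_i(h_1) (x) h_2] with [A_i(h) = - (id (x) eps) D_i(1 (x) h)].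

   The gluing condition is compared inside the convolution algebra of linear maps from
   [H] to [Gamma^i(B_ij (x) H)]. There [eta(h) = 1 (x) h] is invertible with inverse
   [eta o S], [tau_ji] has inverse [tau_ij], and [phi_ij(1 (x) h) = (tau_ji * eta)(h)].
   Compatibility of [D_i] and [D_j] on [1 (x) h] reads
   [(d tau_ji - tau_ji * A_i) * eta = - A_j * tau_ji * eta]; cancelling [eta] and
   multiplying by [tau_ij] gives the transformation law of the forms.

   Conversely, [Gamma^i(B_ij (x) H)] is an [H]-comodule algebra, and the cleaving map
   [eta] yields a linear map sending [X eta(h)] to [X (x) h] for coinvariant [X].
   Hence the local formula for [D_i] descends to the overlaps, where it agrees with the
   one for [D_j] as soon as the law holds. In the right case one uses in addition that
   [tau_ji] commutes, and [d tau_ji] commutes up to sign, with the forms coming from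
   the base. *)

Set Implicit Arguments.
Unset Strict Implicit.
Unset Printing Implicit Defensive.

Import GRing.Theory.
Local Open Scope ring_scope.

(** * Tensors over a field *)

(** Several obstacles separate the local computation from the definitions. The Leibniz rules speak
    of global forms only; surjectivity of [chi i] and of [piG i] supplies a global horizontal
    element with component [1 ⊗ h] and a homogeneous global form with a prescribed component. The
    coaction on [hor] is a choice of a tensor over [hor], and tensors are classes of formal sums
    without bases; finite-rank resolutions by functionals, obtained from Zorn's lemma, replace bases
    and also give exactness of the tensor product. No coaction on an overlap is given: its defining
    ideal, the image under one chart of the kernel of another, must be shown to be a subcomodule,
    which is done above all charts at once, in [Omega P]. Finally an overlap is not known to be a
    graded tensor product of base forms and [Gamma(H)], so its elements have no evident coordinates
    [X ⊗ h]; these are what the cleaving map restores. In the right case [g ⊗ h] is read as [1 ⊗ h]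
    times [g], which is the same element since [h] has degree zero, so a flag [b] covers both
    cases. *)

Section LinearAlgebra.
Variable k : fieldType.

(** A subspace maximal among those containing [S] and missing [x] has the line through [x] as a
    complement; [f] is the coordinate along [x]. *)
Lemma functional_separation (V : lmodType k) (S : subspace V) (x : V) : ~ S x ->
  exists f : V -> k^o, [/\ linear f, forall y, S y -> f y = 0 & f x = 1].
Proof.
move=> Sx.
pose lin_closed (M : set V) := forall (a : k) y z, M y -> M z -> M (a *: y + z).
pose good (M : set V) :=
  M = set0 \/ [/\ lin_closed M, forall y, S y -> M y & ~ M x].
have [F Fgood Ftot|M [Mgood Mmax]] := @Zorn_bigcup V good.
  have [[X [FX X0]]|noX] := pselect (exists X, F X /\ X <> set0); last first.
    left; apply/seteqP; split=> // y [X FX Xy].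
    by case: noX; exists X; split=> // X0; rewrite X0 in Xy.
  right; split.
  - move=> a y z [Y FY Yy] [Z FZ Zz].
    have comb W : F W -> W y -> W z -> (\bigcup_(W in F) W)%classic (a *: y + z).
      move=> FW Wy Wz; exists W => //.
      by case: (Fgood _ FW) Wy => [->//|[WL _ _] Wy]; apply: WL.
    by case: (Ftot _ _ FY FZ) => sub; [apply: (comb Z) => //|apply: (comb Y) => //];
      apply: sub.
  - by move=> y Sy; exists X => //; case: (Fgood _ FX) => // -[_ SX _]; apply: SX.
  - by move=> [Y FY Yx]; case: (Fgood _ FY) Yx => [->//|[_ _ Yx] /Yx].
have SM : good S by right; split=> // a y z; apply: subspaceZD.
case: Mgood => [M0|[ML MS Mx]].
  case: (Mmax S) => //; rewrite M0 properEneq; split; last exact: sub0set.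
  apply/eqP => S0; have : (S : set V) 0 by apply: subspace0.
  by rewrite -S0.
have M0 : M 0 by apply: MS; apply: subspace0.
have MZ (a : k) y : M y -> M (a *: y).
  by move=> My; rewrite -[_ *: _]addr0; apply: ML.
have MB y z : M y -> M z -> M (y - z).
  by move=> My Mz; rewrite addrC -scaleN1r; apply: ML.
have coord v : exists c : k, M (v - c *: x).
  apply: contrapT => noc.
  have Mv : ~ M v by move=> Mv; apply: noc; exists 0; rewrite scale0r subr0.
  pose N : set V := fun y => exists m c, M m /\ y = m + c *: v.
  apply: (Mmax N).
    split=> [y My|sub]; first by exists y, 0; rewrite scale0r addr0.
    by apply/Mv/sub; exists 0, 1; rewrite add0r scale1r.
  right; split.
  - move=> a _ _ [m [c [Mm ->]]] [m' [c' [Mm' ->]]].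
    exists (a *: m + m'), (a * c + c'); split; first exact: ML.
    by rewrite scalerDr scalerDl scalerA addrACA.
  - by move=> y Sy; exists y, 0; rewrite scale0r addr0; split=> //; apply: MS.
  (* If [x = m + c v], then [c] is nonzero as [x] is not in [M], and [v] equals [c^-1 x] modulo
     [M]. *)
  move=> [m [c [Mm xE]]]; apply: noc; exists c^-1.
  have c0 : c != 0 by apply/eqP => c0; apply: Mx; rewrite xE c0 scale0r addr0.
  rewrite xE scalerDr scalerA mulVf // scale1r opprD addrCA subrr addr0.
  by rewrite -scaleN1r; apply/MZ/MZ.
pose f v : k^o := projT1 (cid (coord v)).
have fP v : M (v - f v *: x) by rewrite /f; case: cid.
have fU v c : M (v - c *: x) -> f v = c.
  move=> h; apply/eqP; rewrite -subr_eq0; apply/eqP; apply: contrapT => /eqP ne.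
  apply: Mx; have := MZ (f v - c)^-1 _ (MB _ _ h (fP v)).
  by rewrite opprB [_ + (_ - v)]addrC subrKA -scalerBl scalerA mulVf ?scale1r.
exists f; split=> [a y z|y Sy|].
- apply: fU; rewrite scalerDl opprD addrACA -scalerA -scalerBr; apply: ML; exact: fP.
- by apply: fU; rewrite scale0r subr0; apply: MS.
- by apply: fU; rewrite scale1r subrr.
Qed.

Definition span_subspace (V : lmodType k) (s : seq V) : subspace V.
Proof.
exists (fun x => forall S : subspace V, (forall y, y \in s -> S y) -> S x).
- by move=> S _; apply: subspace0.
- by move=> a x y hx hy S hS; apply: subspaceZD; [apply: hx|apply: hy].
Defined.

(** Substitute for a dual basis: a finite-rank operator fixing every element of [s]. A vector
    outside the span of the earlier ones is fixed by a rank-one correction whose functional vanishes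
    on that span. *)
Lemma finite_resolution (V : lmodType k) (s : seq V) :
  exists r : seq (V * {f : V -> k^o | linear f}),
    forall x, x \in s -> x = \sum_(p <- r) (sval p.2 x : k) *: p.1.
Proof.
elim: s => [|x s [r hr]]; first by exists [::].
pose proj v := \sum_(p <- r) (sval p.2 v : k) *: p.1.
have projL : linear proj.
  move=> a u v; rewrite /proj scaler_sumr -big_split; apply: eq_bigr => p _ /=.
  by rewrite (svalP p.2) scalerDl scalerA.
have [/(_ (Subspace _ _))|nS] := pselect (span_subspace s x).
  move=> h; exists r => y; rewrite inE => /orP[/eqP ->|/hr //].
  have fix0 : 0 = proj 0 by rewrite (lin0 projL).
  have fixL a u v : u = proj u -> v = proj v -> a *: u + v = proj (a *: u + v).
    by move=> hu hv; rewrite projL -hu -hv.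
  by apply: (h (fun v => v = proj v) fix0 fixL).
have [f [fL f0 f1]] := functional_separation nS.
exists ((x - proj x, exist _ f fL) :: r) => y; rewrite inE big_cons /= -/(proj y).
case/orP=> [/eqP ->|ys]; first by rewrite f1 scale1r subrK.
rewrite f0 ?scale0r ?add0r; first exact: hr.
by move=> S; apply.
Qed.

Lemma scale_bilin (V : lmodType k) (f : V -> k^o) (U : lmodType k) :
  linear f -> bilin (fun (u : U) v => (f v : k) *: u).
Proof.
move=> fL; split=> [v|u] a x y; first by rewrite scalerDr !scalerA mulrC.
by rewrite fL scalerDl scalerA.
Qed.

Definition slice (U V : lmodType k) (f : V -> k^o) (t : tensor U V) : U :=
  tsum (fun u v => (f v : k) *: u) t.

Section Slice.
Variables (U V : lmodType k) (f : V -> k^o).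
Hypothesis fL : linear f.

Lemma slice_lin : linear (@slice U V f).
Proof. exact/tsum_lin/scale_bilin. Qed.
Lemma slice_tens u v : slice f (u ⊗ v) = (f v : k) *: u :> U.
Proof. exact/tsum_tens/scale_bilin. Qed.
End Slice.

Lemma slice_tmap (U U' V : lmodType k) (g : U -> U') (f : V -> k^o) t :
  linear g -> linear f -> slice f (tmap g id t) = g (slice f t).
Proof.
move=> gL fL; move: t; apply: tensor_lin_eq.
- exact: lin_comp (slice_lin fL) (tmap_lin gL (@lin_id _ _)).
- exact: lin_comp gL (slice_lin fL).
by move=> u v; rewrite tmap_tens // !slice_tens // (linZ gL).
Qed.

(** The functionals are chosen for the second legs of all [t i] together. Having one [r] for every
    [i] is what allows slices taken in different charts to be glued in [hor_coactE]. *)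
Lemma tensor_resolution (I : finType) (U : I -> lmodType k) (V : lmodType k)
    (t : forall i, tensor (U i) V) :
  exists r : seq (V * {f : V -> k^o | linear f}),
    forall i, t i = \sum_(p <- r) slice (sval p.2) (t i) ⊗ p.1.
Proof.
have [r hr] := finite_resolution
  (flatten [seq [seq p.2 | p <- repr (t i)] | i <- enum I]).
exists r => i; rewrite {1}(tensE (t i)) {1}/tsum /psum.
transitivity (\sum_(q <- r) \sum_(p <- repr (t i))
    (((sval q.2 p.2 : k) *: p.1) ⊗ q.1 : tensor (U i) V)).
  rewrite exchange_big big_seq [RHS]big_seq; apply: eq_bigr => p hp /=.
  rewrite {1}(hr p.2); last first.
    apply/flattenP; exists [seq p.2 | p <- repr (t i)]; last exact: map_f.
    by apply: (map_f (fun i => [seq p.2 | p <- repr (t i)])); rewrite mem_enum.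
  rewrite (lin_sum ((tens_bilin _ _).2 p.1)); apply: eq_bigr => q _.
  by rewrite tensZr -tensZl.
apply: eq_bigr => q _.
by rewrite -(lin_sum (f := fun u => u ⊗ q.1)) //; apply: (tens_bilin _ _).1.
Qed.

Lemma tmap_comp (U1 U2 U3 V1 V2 V3 : lmodType k) (f : U2 -> U3) (g : U1 -> U2)
    (f' : V2 -> V3) (g' : V1 -> V2) t :
  linear f -> linear g -> linear f' -> linear g' ->
  tmap f f' (tmap g g' t) = tmap (fun x => f (g x)) (fun x => f' (g' x)) t.
Proof.
move=> fL gL fL' gL'; move: t; apply: tensor_lin_eq.
- exact: lin_comp (tmap_lin fL fL') (tmap_lin gL gL').
- exact: tmap_lin (lin_comp fL gL) (lin_comp fL' gL').
move=> u v; rewrite !tmap_tens //; exact: lin_comp.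
Qed.

(** Exactness of the tensor product over a field: slicing commutes with [tmap f id], so the slices
    in a resolution of [t] lie in the kernel of [f]. *)
Lemma tmap_eq0 (U U' V : lmodType k) (f : U -> U') (t : tensor U V) : linear f ->
  tmap f id t = 0 ->
  exists r : seq ({u : U | f u = 0} * V), t = \sum_(p <- r) sval p.1 ⊗ p.2.
Proof.
move=> fL ft; have [r /(_ tt) tE] := @tensor_resolution unit (fun _ => U) V (fun _ => t).
have f0 (p : V * {f : V -> k^o | linear f}) : f (slice (sval p.2) t) = 0.
  by rewrite -(slice_tmap _ fL (svalP p.2)) ft (lin0 (slice_lin (svalP p.2))).
by exists [seq (exist _ _ (f0 p), p.1) | p <- r]; rewrite big_map.
Qed.

Lemma tsum_linear (U V : lmodType k) (W W' : lmodType k) (g : W -> W') (f : U -> V -> W) t :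
  linear g -> g (tsum f t) = tsum (fun u v => g (f u v)) t.
Proof. by move=> gL; rewrite /tsum /psum (lin_sum gL). Qed.

Lemma eq_tsum (U V : lmodType k) (W : zmodType) (f g : U -> V -> W) t :
  (forall u v, f u v = g u v) -> tsum f t = tsum g t.
Proof. by move=> h; apply: eq_bigr => p _; apply: h. Qed.

Lemma tsum_tmap (U V U' V' W : lmodType k) (b : U' -> V' -> W) (f : U -> U')
    (g : V -> V') t : bilin b -> linear f -> linear g ->
  tsum b (tmap f g t) = tsum (fun u v => b (f u) (g v)) t.
Proof.
move=> bB fL gL; move: t; apply: tensor_lin_eq.
- exact: lin_comp (tsum_lin bB) (tmap_lin fL gL).
- exact/tsum_lin/bilin_comp.
by move=> u v; rewrite tmap_tens // !tsum_tens //; apply: bilin_comp.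
Qed.

Section Reassociation.
Variables (U V W : lmodType k).

Let inB (w : W) : bilin (fun (u : U) (v : V) => u ⊗ (v ⊗ w)).
Proof.
split=> [v|u] a x y; first by rewrite ((tens_bilin _ _).1 _).
by rewrite ((tens_bilin _ _).1 _) ((tens_bilin _ _).2 _).
Qed.
Let outB : bilin (fun (uv : tensor U V) (w : W) => tsum (fun u v => u ⊗ (v ⊗ w)) uv).
Proof.
split=> [w|uv]; first exact: tsum_lin.
move=> a x y; rewrite /tsum /psum scaler_sumr -big_split; apply: eq_bigr => p _ /=.
by rewrite ((tens_bilin _ _).2 _) ((tens_bilin _ _).2 _).
Qed.
Lemma tassoc_lin : linear (@tassoc k U V W).
Proof. exact: tsum_lin. Qed.
Lemma tassoc_tens u v w : tassoc ((u ⊗ v) ⊗ w) = u ⊗ (v ⊗ w) :> tensor U (tensor V W).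
Proof. by rewrite /tassoc (tsum_tens _ _ outB) tsum_tens. Qed.

Definition tassocV (t : tensor U (tensor V W)) : tensor (tensor U V) W :=
  tsum (fun u vw => tsum (fun v w => (u ⊗ v) ⊗ w) vw) t.
Let inB' (u : U) : bilin (fun (v : V) (w : W) => (u ⊗ v) ⊗ w).
Proof.
split=> [w|v] a x y; last by rewrite ((tens_bilin _ _).2 _).
by rewrite ((tens_bilin _ _).2 _) ((tens_bilin _ _).1 _).
Qed.
Let outB' : bilin (fun (u : U) (vw : tensor V W) => tsum (fun v w => (u ⊗ v) ⊗ w) vw).
Proof.
split=> [vw|u]; last exact: tsum_lin.
move=> a x y; rewrite /tsum /psum scaler_sumr -big_split; apply: eq_bigr => p _ /=.
by rewrite ((tens_bilin _ _).1 _) ((tens_bilin _ _).1 _).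
Qed.
Lemma tassocV_lin : linear tassocV.
Proof. exact: tsum_lin. Qed.
Lemma tassocV_tens u v w : tassocV (u ⊗ (v ⊗ w)) = (u ⊗ v) ⊗ w.
Proof. by rewrite /tassocV (tsum_tens _ _ outB') tsum_tens. Qed.

Lemma tensor3_lin_eq (X : lmodType k) (f g : tensor U (tensor V W) -> X) :
  linear f -> linear g -> (forall u v w, f (u ⊗ (v ⊗ w)) = g (u ⊗ (v ⊗ w))) -> f =1 g.
Proof.
move=> fL gL h; apply: tensor_lin_eq => // u; apply: tensor_lin_eq => //.
  exact: lin_comp fL ((tens_bilin _ _).2 u).
exact: lin_comp gL ((tens_bilin _ _).2 u).
Qed.
Lemma tensor3l_lin_eq (X : lmodType k) (f g : tensor (tensor U V) W -> X) :
  linear f -> linear g -> (forall u v w, f ((u ⊗ v) ⊗ w) = g ((u ⊗ v) ⊗ w)) -> f =1 g.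
Proof.
move=> fL gL h; apply: tensor_lin_eq => // uv w; move: uv; apply: tensor_lin_eq => //.
  exact: lin_comp fL ((tens_bilin _ _).1 w).
exact: lin_comp gL ((tens_bilin _ _).1 w).
Qed.
Lemma tassocK : cancel (@tassoc k U V W) tassocV.
Proof.
apply: tensor3l_lin_eq; [exact: lin_comp tassocV_lin tassoc_lin|exact: lin_id|].
by move=> u v w; rewrite tassoc_tens tassocV_tens.
Qed.
Lemma tassocVK : cancel tassocV (@tassoc k U V W).
Proof.
apply: tensor3_lin_eq; [exact: lin_comp tassoc_lin tassocV_lin|exact: lin_id|].
by move=> u v w; rewrite tassocV_tens tassoc_tens.
Qed.

Variables (X : lmodType k) (f : U -> V -> W -> X).
Hypotheses (f1 : forall w, bilin (fun u v => f u v w)) (f2 : forall u, bilin (f u)).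
Lemma tsum3_bilin : bilin (fun u vw => tsum (f u) vw).
Proof.
split=> [vw|u]; last exact: tsum_lin.
move=> a x y; rewrite /tsum /psum scaler_sumr -big_split; apply: eq_bigr => p _ /=.
by rewrite ((f1 _).1 _).
Qed.
Lemma tsum3_bilinl : bilin (fun uv w => tsum (fun u v => f u v w) uv).
Proof.
split=> [w|uv]; first exact: tsum_lin.
move=> a x y; rewrite /tsum /psum scaler_sumr -big_split; apply: eq_bigr => p _ /=.
by rewrite ((f2 _).2 _).
Qed.
Lemma tsum_tassoc t :
  tsum (fun u vw => tsum (f u) vw) (tassoc t) =
  tsum (fun uv w => tsum (fun u v => f u v w) uv) t.
Proof.
move: t; apply: tensor3l_lin_eq => [||u v w].
- exact: lin_comp (tsum_lin tsum3_bilin) tassoc_lin.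
- exact: tsum_lin tsum3_bilinl.
by rewrite tassoc_tens (tsum_tens _ _ tsum3_bilin) (tsum_tens _ _ tsum3_bilinl)
  !tsum_tens.
Qed.
End Reassociation.
End LinearAlgebra.

(** * Convolution *)

Section Convolution.
Variables (k : fieldType) (H : hopf k).
Let comulL := ah_lin (@comul_hom k H).

Section Coassociativity.
Variables (W : lmodType k) (f : H -> H -> H -> W).
Hypotheses (f1 : forall w, bilin (fun u v => f u v w)) (f2 : forall u, bilin (f u)).
Lemma sweedler_coassoc h :
  tsum (fun h' h3 => tsum (fun h1 h2 => f h1 h2 h3) (comul h')) (comul h) =
  tsum (fun h1 h' => tsum (fun h2 h3 => f h1 h2 h3) (comul h')) (comul h).
Proof.
have := congr1 (tsum (fun u vw => tsum (f u) vw)) (comul_coassoc h).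
rewrite tsum_tassoc // (tsum_tmap _ (tsum3_bilinl f1 f2) comulL (@lin_id _ _)).
by rewrite (tsum_tmap _ (tsum3_bilin f1 f2) (@lin_id _ _) comulL).
Qed.
End Coassociativity.

Variable G : ualgType k.
Definition conv (f g : H -> G) (h : H) : G :=
  tsum (fun h1 h2 => f h1 * g h2) (comul h).
Definition conv_unit (h : H) : G := counit h *: (1 : G).

Lemma conv_bilin (f g : H -> G) :
  linear f -> linear g -> bilin (fun h1 h2 => f h1 * g h2).
Proof. by move=> fL gL; apply: bilin_comp (umul_bilin G) fL gL. Qed.
Lemma conv_lin (f g : H -> G) : linear f -> linear g -> linear (conv f g).
Proof. by move=> fL gL; apply: lin_comp (tsum_lin (conv_bilin fL gL)) comulL. Qed.

Lemma convA (f g e : H -> G) : linear f -> linear g -> linear e ->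
  conv f (conv g e) = conv (conv f g) e.
Proof.
move=> fL gL eL; apply: funext => h; rewrite /conv.
transitivity
  (tsum (fun h1 h' => tsum (fun h2 h3 => f h1 * g h2 * e h3) (comul h')) (comul h)).
  apply: eq_tsum => u v; rewrite (tsum_linear _ _ ((umul_bilin G).2 _)).
  by apply: eq_tsum => x y; rewrite mulrA.
rewrite -sweedler_coassoc => [|w|u].
- apply: eq_tsum => u v.
  by rewrite (tsum_linear (g := fun x : G => x * e v) _ _ ((umul_bilin G).1 (e v))).
- by split=> [v|u] a x y;
    rewrite ?fL ?gL ?mulrDl ?mulrDr ?mulrDl -?uscalerAr -!uscalerAl.
- by split=> [w|v] a x y;
    rewrite ?gL ?eL mulrDr ?mulrDl -uscalerAr -?uscalerAl.
Qed.

Lemma counit_linear : linear (@counit k H : H -> k^o).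
Proof. exact: counit_lin. Qed.
Lemma conv1f (f : H -> G) : linear f -> conv conv_unit f = f.
Proof.
move=> fL; apply: funext => h; rewrite -{2}(comul_counitl h) (tsum_linear _ _ fL).
by apply: eq_tsum => u v; rewrite /conv_unit -uscalerAl mul1r (linZ fL).
Qed.
Lemma convf1 (f : H -> G) : linear f -> conv f conv_unit = f.
Proof.
move=> fL; apply: funext => h; rewrite -{2}(comul_counitr h) (tsum_linear _ _ fL).
by apply: eq_tsum => u v; rewrite /conv_unit -uscalerAr mulr1 (linZ fL).
Qed.
Lemma conv_antipoder (f : H -> G) : alg_hom f ->
  conv f (fun h => f (antipode h)) = conv_unit.
Proof.
move=> [fL f1 fM]; apply: funext => h; rewrite /conv_unit -f1 -(linZ fL) -antipoder.
by rewrite (tsum_linear _ _ fL); apply: eq_tsum => u v; rewrite fM.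
Qed.
Lemma conv_cancelr (s f g e : H -> G) : linear s -> linear f -> linear g -> linear e ->
  conv e s = conv_unit -> conv f e = conv g e -> f = g.
Proof.
move=> sL fL gL eL es fg.
by rewrite -(convf1 fL) -es convA // fg -convA // es convf1.
Qed.
Lemma convDl (f g e : H -> G) : conv (fun h => f h + g h) e = fun h => conv f e h + conv g e h.
Proof.
apply: funext => h; rewrite /conv /tsum /psum -big_split; apply: eq_bigr => p _ /=.
by rewrite mulrDl.
Qed.
Lemma convDr (f g e : H -> G) : conv e (fun h => f h + g h) = fun h => conv e f h + conv e g h.
Proof.
apply: funext => h; rewrite /conv /tsum /psum -big_split; apply: eq_bigr => p _ /=.
by rewrite mulrDr.
Qed.
Lemma conv_mull (f g : H -> G) x h : conv (fun h => x * f h) g h = x * conv f g h.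
Proof.
rewrite /conv (tsum_linear _ _ ((umul_bilin G).2 x)).
by apply: eq_tsum => u v; rewrite mulrA.
Qed.
Lemma conv_mulr (f g : H -> G) x h : conv f (fun h => g h * x) h = conv f g h * x.
Proof.
rewrite /conv (tsum_linear (g := fun y : G => y * x) _ _ ((umul_bilin G).1 x)).
by apply: eq_tsum => u v; rewrite mulrA.
Qed.
End Convolution.

Lemma conv_hom (k : fieldType) (H : hopf k) (G L : ualgType k) (p : G -> L)
    (f g : H -> G) h : alg_hom p ->
  p (conv f g h) = conv (fun h => p (f h)) (fun h => p (g h)) h.
Proof.
move=> [pL p1 pM]; rewrite /conv (tsum_linear _ _ pL).
by apply: eq_tsum => u v; rewrite pM.
Qed.

Lemma tensor_bilin_eq (k : fieldType) (U V U' V' W : lmodType k)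
    (f g : tensor U V -> tensor U' V' -> W) : bilin f -> bilin g ->
  (forall u v u' v', f (u ⊗ v) (u' ⊗ v') = g (u ⊗ v) (u' ⊗ v')) ->
  forall x y, f x y = g x y.
Proof.
move=> fB gB h x y; move: y; apply: tensor_lin_eq => [||u' v'].
- exact: fB.2.
- exact: gB.2.
move: x; apply: (@tensor_lin_eq _ _ _ _ (f^~ (u' ⊗ v')) (g^~ (u' ⊗ v'))) => [||u v].
- exact: fB.1.
- exact: gB.1.
exact: h.
Qed.

Lemma bilin_post (k : fieldType) (U V W W' : lmodType k) (g : W -> W') (b : U -> V -> W) :
  linear g -> bilin b -> bilin (fun u v => g (b u v)).
Proof.
move=> gL bB; split=> [v|u]; first exact: lin_comp gL (bB.1 v).
exact: lin_comp gL (bB.2 u).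
Qed.

Lemma bilinD (k : fieldType) (U V W : lmodType k) (b c : U -> V -> W) :
  bilin b -> bilin c -> bilin (fun u v => b u v + c u v).
Proof.
move=> bB cB; split=> [v|u] a x y; rewrite scalerDr addrACA.
  by rewrite (bB.1 v) (cB.1 v).
by rewrite (bB.2 u) (cB.2 u).
Qed.

Lemma mul_bilin (k : fieldType) (U V : lmodType k) (A : ualgType k) (f : U -> A) (g : V -> A) :
  linear f -> linear g -> bilin (fun u v => f u * g v).
Proof. by move=> fL gL; apply: bilin_comp (umul_bilin A) fL gL. Qed.

Lemma tmap_alg_hom (k : fieldType) (A A' C : ualgType k) (f : A -> A') : alg_hom f ->
  alg_hom (tmap f id : tensor A C -> tensor A' C).
Proof.
move=> [fL f1 fM]; have tL := tmap_lin fL (@lin_id _ C).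
split=> //; first by rewrite -tens_one tmap_tens // f1.
move=> x y; move: x y; apply: tensor_bilin_eq => [||u v u' v'].
- exact: bilin_post tL (umul_bilin _).
- exact: mul_bilin.
by rewrite tens_mul !tmap_tens // tens_mul fM.
Qed.

Lemma tmap_gr_mul (k : fieldType) (G : dga k) (C : ualgType k) n (x y : tensor G C) :
  tmap (gr n) id (x * y) =
  \sum_(p < n.+1) tmap (gr p) id x * tmap (gr (n - p)) id y :> tensor G C.
Proof.
have tL p := tmap_lin (@gr_lin _ G p) (@lin_id _ C).
pose f (x y : tensor G C) : tensor G C := tmap (gr n) id (x * y).
pose g (x y : tensor G C) : tensor G C :=
  \sum_(p < n.+1) tmap (gr p) id x * tmap (gr (n - p)) id y.
apply: (@tensor_bilin_eq _ _ _ _ _ _ f g) => [||u v u' v']; rewrite /f /g.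
- exact: bilin_post (tL n) (umul_bilin _).
- split=> [z|z] a s t; rewrite scaler_sumr -big_split /=; apply: eq_bigr => p _.
    exact: (mul_bilin (tL p) (tL (n - p)%N)).1.
  exact: (mul_bilin (tL p) (tL (n - p)%N)).2.
rewrite tens_mul !tmap_tens //; try exact: gr_lin.
rewrite gr_mulE (lin_sum ((tens_bilin _ _).1 (v * v'))); apply: eq_bigr => p _.
rewrite !tmap_tens ?tens_mul //; exact: gr_lin.
Qed.

(** * Right covariant calculi *)

Section Monomials.
Variables (k : fieldType) (A : ualgType k) (G : dga k) (j : A -> G).
Hypothesis jC : calculus j.

(** The span of the monomials is stable under left multiplication by [j h] and by [dif (j h)], hence
    is everything. A right covariant calculus prescribes its coaction on monomials only. *)
Lemma monomial_ind (S : G -> Prop) :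
  (forall (a : k) x y, S x -> S y -> S (a *: x + y)) ->
  (forall h hs, S (j h * \prod_(g <- hs) dif (j g))) -> forall x, S x.
Proof.
pose span y := forall S : G -> Prop,
  (forall (a : k) x y, S x -> S y -> S (a *: x + y)) ->
  (forall h hs, S (j h * \prod_(g <- hs) dif (j g))) -> S y.
have [[[jL j1 jM] j0] _ _ jgen] := jC.
have spanL (a : k) x y : span x -> span y -> span (a *: x + y).
  by move=> hx hy S' SL Sm; exact: (SL _ _ _ (hx _ SL Sm) (hy _ SL Sm)).
have spanM h hs : span (j h * \prod_(g <- hs) dif (j g)) by move=> S' SL; apply.
have all_span x : forall y, span y -> span (x * y).
  move: x; apply: jgen => [|h y hy|h y hy].
  - split=> [y|a x x' hx hx' y hy|x x' hx hx' y hy]; first by rewrite mul1r.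
      by rewrite mulrDl -uscalerAl; exact (spanL a _ _ (hx y hy) (hx' y hy)).
    rewrite -mulrA; exact (hx _ (hx' y hy)).
  - apply: (hy (fun y => span (j h * y))) => [a x x' hx hx'|h' hs]; first by
      rewrite mulrDr -uscalerAr; exact (spanL a _ _ hx hx').
    by rewrite mulrA -jM; apply: spanM.
  - apply: (hy (fun y => span (dif (j h) * y))) => [a x x' hx hx'|h' hs]; first by
      rewrite mulrDr -uscalerAr; exact (spanL a _ _ hx hx').
    (* Leibniz rule: [dh h' w = d(h h') w - h dh' w], with [w] the remaining product of
       differentials. *)
    have := spanL (-1) _ _ (spanM h (h' :: hs)) (spanM 1 ((h * h') :: hs)).
    rewrite !big_cons j1 mul1r jM (dif_mul _ (j0 h)) expr0 scale1r mulrDl -!mulrA.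
    by rewrite scaleN1r addrCA addNr addr0.
move=> SL Sm x; rewrite -[x]mulr1; apply: all_span => // S' SL' Sm'.
by have := Sm' 1 [::]; rewrite big_nil mulr1 j1.
Qed.
End Monomials.

Section CovariantCalculus.
Variables (k : fieldType) (H : hopf k) (G : dga k) (j : H -> G).
Hypothesis jC : calculus j.
Variable delta : G -> tensor G H.
Hypothesis deltaL : linear delta.
Hypothesis deltaE : forall (h0 : H) (hs : seq H),
  delta (j h0 * \prod_(h <- hs) dif (j h)) =
  tmap j id (comul h0) * \prod_(h <- hs) tmap (fun g => dif (j g)) id (comul h).

Let jL := ah_lin jC.
Let j1 := ah_one jC.
Let jM := ah_mul jC.
Let comulH := comul_hom H.
Let tjH := tmap_alg_hom H jC.
Let djL : linear (fun g => dif (j g)) := lin_comp (@dif_lin _ G) jL.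

Lemma delta_alg h : delta (j h) = tmap j id (comul h).
Proof. by have := deltaE h [::]; rewrite !big_nil !mulr1. Qed.
Lemma delta_dif h : delta (dif (j h)) = tmap (fun g => dif (j g)) id (comul h).
Proof.
have := deltaE 1 [:: h]; rewrite !big_seq1 j1 mul1r => ->.
by rewrite (ah_one comulH) (ah_one tjH) mul1r.
Qed.

Lemma tmap_dif_mul (x y : tensor H H) :
  tmap (fun g => dif (j g)) id (x * y) =
  tmap (fun g => dif (j g)) id x * tmap j id y +
  tmap j id x * tmap (fun g => dif (j g)) id y :> tensor G H.
Proof.
have tL := tmap_lin jL (@lin_id _ H); have dL := tmap_lin djL (@lin_id _ H).
move: x y; apply: tensor_bilin_eq => [||u v u' v'].
- exact: bilin_post dL (umul_bilin _).
- by apply: bilinD; apply: mul_bilin.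
rewrite tens_mul !tmap_tens // !tens_mul -tensDl jM (dif_mul _ (ah0_deg jC u)).
by rewrite expr0 scale1r.
Qed.

(** The [x] that satisfy [delta (x * y) = delta x * delta y] for all [y] form a subalgebra, so it is
    enough to take [j h] and [dif (j h)] against monomials. *)
Lemma delta_hom : alg_hom delta.
Proof.
have d1 : delta 1 = 1 by rewrite -j1 delta_alg (ah_one comulH) (ah_one tjH).
split=> // x y; move: x y.
apply: (calc_gen jC (S := fun x => forall y, delta (x * y) = delta x * delta y))
  => [|h|h].
- split=> [y|a x x' hx hx' y|x x' hx hx' y].
  + by rewrite mul1r d1 mul1r.
  + by rewrite mulrDl -uscalerAl !deltaL hx hx' mulrDl -uscalerAl.
  + by rewrite -mulrA hx hx' hx mulrA.
- apply: (monomial_ind jC) => [a x y hx hy|h' hs].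
    by rewrite mulrDr -uscalerAr !deltaL hx hy mulrDr -uscalerAr.
  by rewrite mulrA -jM !deltaE delta_alg (ah_mul comulH) (ah_mul tjH) mulrA.
- apply: (monomial_ind jC) => [a x y hx hy|h' hs].
    by rewrite mulrDr -uscalerAr !deltaL hx hy mulrDr -uscalerAr.
  (* The product [dh h' w] is not a monomial; it is the difference of the monomials [d(h h') w] and
     [h dh' w], whose images are known. *)
  have := deltaE 1 ((h * h') :: hs); have := deltaE h (h' :: hs).
  rewrite !big_cons j1 mul1r jM (dif_mul _ (ah0_deg jC h)) expr0 scale1r.
  rewrite (ah_one comulH) (ah_one tjH) mul1r mulrDl (linD deltaL) -!mulrA => ->.
  rewrite (ah_mul comulH) tmap_dif_mul mulrDl -!mulrA => /addIr ->.
  by rewrite delta_dif deltaE.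
Qed.

Lemma delta_gr n x : delta (gr n x) = tmap (gr n) id (delta x).
Proof.
have tL p := tmap_lin (@gr_lin _ G p) (@lin_id _ H).
have [_ d1 dM] := delta_hom.
move: x n; apply: (calc_gen jC) => [|h n|h n].
- split=> [n|a x y hx hy n|x y hx hy n].
  + have tgr (z : G) m : homog m z -> tmap (gr n) id (z ⊗ (1 : H)) =
        if n == m then z ⊗ (1 : H) else 0.
      move=> hz; rewrite tmap_tens //; last exact: gr_lin.
      by rewrite (homogE n hz); case: ifP; rewrite ?tens0l.
    rewrite d1 -tens_one (tgr _ _ (gr_one G)) (homogE n (gr_one G)).
    by case: ifP; rewrite ?d1 ?(lin0 deltaL).
  + by rewrite gr_lin !deltaL tL hx hy.
  + rewrite gr_mulE (lin_sum deltaL) dM tmap_gr_mul.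
    by apply: eq_bigr => p _; rewrite dM hx hy.
- rewrite (homogE n (ah0_deg jC h)) delta_alg tmap_comp //; try exact: gr_lin.
  case: eqP => [->|ne]; rewrite ?delta_alg ?(lin0 deltaL).
    by congr tsum; apply: funext => u; apply: funext => v; rewrite (ah0_deg jC).
  rewrite /tmap /tsum /psum big1 // => p _.
  by rewrite (homogE n (ah0_deg jC _)); case: eqP ne => // _ _; rewrite tens0l.
- rewrite (homogE n (dif_homog (ah0_deg jC h))) delta_dif tmap_comp //; try exact: gr_lin.
  case: eqP => [->|ne]; rewrite ?delta_dif ?(lin0 deltaL).
    congr tsum; apply: funext => u; apply: funext => v.
    by rewrite (dif_homog (ah0_deg jC _)).
  rewrite /tmap /tsum /psum big1 // => p _.
  by rewrite (homogE n (dif_homog (ah0_deg jC _))); case: eqP ne => // _ _; rewrite tens0l.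
Qed.
End CovariantCalculus.

(** * Coactions on the charts and the overlaps *)

Section GradedTensorCoaction.
Variables (k : fieldType) (H : hopf k) (G L : dga k) (delta : L -> tensor L H).
Hypothesis deltaH : alg_hom delta.
Hypothesis delta_gr : forall n x, delta (gr n x) = tmap (gr n) id (delta x).

Definition gcoact (x : gtensor G L) : tensor (gtensor G L) H :=
  tassocV (tmap id delta x).

Let ins (g : G) (l : L) : gtensor G L := g ⊗ l.
Let insL g : linear (ins g). Proof. exact: (tens_bilin G L).2. Qed.

Lemma gcoact_lin : linear gcoact.
Proof. exact: lin_comp (@tassocV_lin _ _ _ _) (tmap_lin (@lin_id _ _) (ah_lin deltaH)). Qed.

Lemma gcoact_tens (g : G) (l : L) :
  gcoact (g ⊗ l) = tmap (fun l => g ⊗ l : gtensor G L) id (delta l).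
Proof.
rewrite /gcoact tmap_tens //; last exact: ah_lin deltaH.
move: (delta l); apply: tensor_lin_eq => [||u v].
- exact: lin_comp (@tassocV_lin _ _ _ _) ((tens_bilin _ _).2 g).
- exact: tmap_lin (insL g) (@lin_id _ _).
by rewrite tassocV_tens tmap_tens //; apply: insL.
Qed.

Let grL m := tmap_lin (@gr_lin _ L m) (@lin_id _ H).

Let ins_mul m n (g w : G) (R T : tensor L H) : homog n w ->
  tmap (ins g) id (tmap (gr m) id R) * tmap (ins w) id T =
  (-1) ^+ (m * n) *: tmap (ins (g * w)) id (tmap (gr m) id R * T) :> tensor (gtensor G L) H.
Proof.
have iL g' := tmap_lin (insL g') (@lin_id _ H).
move=> hw; move: R T; apply: tensor_bilin_eq => [||u v u' v'].
- exact: mul_bilin (lin_comp (iL g) (grL m)) (iL w).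
- apply: bilin_post; last first.
    by apply: bilin_post (iL _) _; apply: mul_bilin (grL m) (@lin_id _ _).
  by move=> a x y; rewrite scalerDr !scalerA mulrC.
rewrite !tmap_tens //; try exact: gr_lin; try exact: insL.
rewrite !tens_mul /= [ins g _ * ins w _](gtensor_mulE _ _ (homog_gr m u) hw).
by rewrite tensZl tmap_tens //; apply: insL.
Qed.

(** The Koszul sign for moving [r] past [w] depends only on their degrees, and by [delta_gr] the
    first legs of [delta r] keep the degree of [r]; the same sign thus appears on both sides. *)
Lemma gcoact_hom : alg_hom gcoact.
Proof.
have cL := gcoact_lin.
split=> //.
  have -> : (1 : gtensor G L) = (1 : G) ⊗ (1 : L) by [].
  by rewrite gcoact_tens (ah_one deltaH) -tens_one tmap_tens //; apply: insL.
move=> x y; move: x y; apply: tensor_bilin_eq => [||g r w t].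
- exact: bilin_post cL (umul_bilin (gtensor G L)).
- exact: mul_bilin.
move: r w; apply: homog_ind => [w|r r' hr hr' w|m r hr].
- by rewrite tens0r mul0r (lin0 cL) mul0r.
- by rewrite tensDr mulrDl !(linD cL) hr hr' mulrDl.
apply: homog_ind => [|w w' hw hw'|n w hw].
- by rewrite tens0l mulr0 (lin0 cL) mulr0.
- by rewrite tensDl mulrDr !(linD cL) hw hw' mulrDr.
rewrite (gtensor_mulE _ _ hr hw) (linZ cL) !gcoact_tens (ah_mul deltaH).
by rewrite -hr delta_gr; apply: (esym (@ins_mul m n g w _ _ hw)).
Qed.
End GradedTensorCoaction.

Section Coaction.
Variables (k : fieldType) (H : hopf k) (P B : ualgType k) (I : finType).
Variables (Q : qpfb H P B I) (D : diff_structure Q).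

Local Notation GB := (GB D).
Local Notation GH := (GH D).
Local Notation jB i := (@jB _ _ _ _ _ _ D i).
Local Notation jH := (jH D).
Local Notation GBH := (GBH D).
Local Notation qij i j := (@qij _ _ _ _ _ _ D i j).

Lemma coactH_hom : alg_hom (@coactH _ _ _ _ _ _ D).
Proof. exact (delta_hom (GH_calculus D) (coaction_lin (coactHP D)) (coactH_formula D)). Qed.
Lemma coactH_gr n x : coactH (gr n x) = tmap (gr n) id (@coactH _ _ _ _ _ _ D x).
Proof.
exact (delta_gr (GH_calculus D) (coaction_lin (coactHP D)) (coactH_formula D) n x).
Qed.
Lemma coactH_alg h : coactH (jH h) = tmap jH id (comul h).
Proof. exact (delta_alg (coactH_formula D) h). Qed.
Lemma coactH_dif h : coactH (dif (jH h)) = tmap (fun g => dif (jH g)) id (comul h).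
Proof. exact (delta_dif (GH_calculus D) (coactH_formula D) h). Qed.

Definition coactBH (i : I) : GBH i -> tensor (GBH i) H :=
  @gcoact k H (GB i) GH (@coactH _ _ _ _ _ _ D).
Lemma coactBH_hom i : alg_hom (@coactBH i).
Proof. exact (gcoact_hom (GB i) coactH_hom coactH_gr). Qed.
Lemma coactBH_tens i (g : GB i) l :
  coactBH (g ⊗ l : GBH i) = tmap (fun l => g ⊗ l : GBH i) id (coactH l).
Proof. exact (gcoact_tens coactH_hom _ _). Qed.

Let jHL := ah_lin (jH_hom0 D).
Let jBL i := ah_lin (jB_hom0 D i).
Let insL i g : linear (fun l => g ⊗ l : GBH i). Proof. exact: (tens_bilin (GB i) GH).2. Qed.

Lemma coactBH_jBH i (u : tensor (Bi Q i) H) :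
  coactBH (tmap (jB i) jH u : GBH i) =
  tmap (tmap (jB i) jH : tensor (Bi Q i) H -> GBH i) id (tassocV (tmap id (@comul k H) u)).
Proof.
have bL := @jBL i; have tL := tmap_lin bL jHL.
have cL := ah_lin (coactBH_hom i).
have comulL := ah_lin (@comul_hom k H).
move: u; apply: tensor_lin_eq => [||b h].
- exact: lin_comp cL tL.
- apply: lin_comp (tmap_lin tL (@lin_id _ _)) _.
  exact: lin_comp (@tassocV_lin _ _ _ _) (tmap_lin (@lin_id _ _) comulL).
rewrite !tmap_tens // coactBH_tens coactH_alg tmap_comp //; try exact: insL.
move: (comul h); apply: tensor_lin_eq => [||g g'].
- exact: tmap_lin (lin_comp (insL _) jHL) (@lin_id _ _).
- apply: lin_comp (tmap_lin tL (@lin_id _ _)) _.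
  exact: lin_comp (@tassocV_lin _ _ _ _) ((tens_bilin _ _).2 b).
by rewrite tassocV_tens !tmap_tens //; apply: (lin_comp (insL _) jHL).
Qed.

(** Degree zero suffices, because [chiO_coact] tests differentials on generators only. *)
Lemma coactBH_dif i (u : tensor (Bi Q i) H) :
  coactBH (dif (tmap (jB i) jH u : GBH i)) =
  tmap (@dif _ (GBH i)) id (coactBH (tmap (jB i) jH u : GBH i)).
Proof.
have bL := @jBL i; have tL := tmap_lin bL jHL.
have cL := ah_lin (coactBH_hom i).
have dL := @dif_lin _ (GBH i).
move: u; apply: tensor_lin_eq => [||b h].
- exact: lin_comp cL (lin_comp dL tL).
- exact: lin_comp (tmap_lin dL (@lin_id _ _)) (lin_comp cL tL).
have b0 := ah0_deg (jB_hom0 D i) b.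
rewrite !tmap_tens // (gtensor_difE _ b0) expr0 scale1r (linD cL) !coactBH_tens.
rewrite coactH_alg coactH_dif !tmap_comp //; try exact: insL; try exact: dif_lin;
  try exact: lin_comp (insL _) jHL; try exact: lin_comp (@dif_lin _ _) jHL;
  try exact: lin_comp dL (insL _).
rewrite /tmap /tsum /psum -big_split; apply: eq_bigr => p _; cbv beta.
by rewrite (gtensor_difE _ b0) expr0 scale1r tensDl.
Qed.

Lemma chi_coact' i p :
  tassocV (tmap id (@comul k H) (chi Q i p)) = tmap (chi Q i) id (coact Q p).
Proof. by rewrite chi_coact tassocK. Qed.

(* The universal calculus of [P] is right covariant: the coaction can be followed
   through all the charts simultaneously. *)
Lemma chiO_coact (w : Omega P) :
  exists t : tensor (Omega P) H, forall i,
    tmap (chiO D i) id t = coactBH (chiO D i w).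
Proof.
have cH i := chiO_hom D i; have cL i := ah_lin (cH i).
have tH i := tmap_alg_hom H (cH i).
have uL := ah_lin (uinj_hom0 P).
have cu i p : chiO D i (uinj p) = tmap (jB i) jH (chi Q i p).
  by rewrite /chiO uext_inj //; apply: chi0_hom0.
have chL i := ah_lin (chi_hom Q i).
have tL i := tmap_lin (jBL (i := i)) jHL.
have coactBH_chi i p : coactBH (chiO D i (uinj p)) =
    tmap (fun p => chiO D i (uinj p)) id (coact Q p).
  rewrite cu coactBH_jBH chi_coact' tmap_comp //; try exact: tL; try exact: chL.
  by congr tmap; apply: funext => p'; rewrite cu.
move: w; apply: uinj_gen => [|p|p].
- split=> [|a x y [s hs] [t ht]|x y [s hs] [t ht]].
  + by exists 1 => i; rewrite (ah_one (tH i)) (ah_one (cH i)) (ah_one (coactBH_hom i)).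
  + exists (a *: s + t) => i.
    by rewrite (ah_lin (tH i)) hs ht (cL i) (ah_lin (coactBH_hom i)).
  + exists (s * t) => i.
    by rewrite (ah_mul (tH i)) hs ht (ah_mul (cH i)) (ah_mul (coactBH_hom i)).
- exists (tmap (@uinj k P) id (coact Q p)) => i.
  by rewrite (tmap_comp _ (cL i) uL (@lin_id _ _) (@lin_id _ _)) coactBH_chi.
- exists (tmap (fun p => dif (uinj p)) id (coact Q p)) => i.
  have duL := lin_comp (@dif_lin _ (Omega P)) uL.
  rewrite (tmap_comp _ (cL i) duL (@lin_id _ _) (@lin_id _ _)).
  rewrite (dh_dif (cH i)) cu coactBH_dif -cu coactBH_chi.
  have dL := @dif_lin _ (GBH i); have cuL := lin_comp (cL i) uL.
  rewrite (tmap_comp _ dL cuL (@lin_id _ _) (@lin_id _ _)).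
  by congr tmap; apply: funext => p'; rewrite (dh_dif (cH i)).
Qed.

Let qH i j : dga_hom (qij i j). Proof. exact: dproj_hom. Qed.
Let qL i j := ah_lin (qH i j).

Lemma chiO_surj i y : exists w : Omega P, chiO D i w = y.
Proof.
by have [x <-] := chiG_surj y; exists (drepr x).
Qed.

Lemma qij_chiO_eq0 i j (w : Omega P) : chiO D j w = 0 -> qij i j (chiO D i w) = 0.
Proof.
move=> w0; apply/dproj_eq0; exists (dproj _ w) => /=; by rewrite chiG_proj.
Qed.

Lemma qij_eq0_chiO i j (x : GBH i) : qij i j x = 0 ->
  exists2 w : Omega P, chiO D j w = 0 & chiO D i w = x.
Proof. by move/dproj_eq0 => [v vj vi]; exists (drepr v). Qed.

(** Lift [x] to some [w] in [Omega P] killed in chart [j]. Its coaction tensor is killed by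
    [chiO D j] on the first leg, so by exactness its first legs can be taken in that kernel, and
    [qij] annihilates their images in chart [i]. *)
Lemma qij_coact_eq0 i j (x : GBH i) : qij i j x = 0 ->
  tmap (qij i j) id (coactBH x) = 0.
Proof.
move=> /qij_eq0_chiO[w wj wi]; have [t tE] := chiO_coact w.
have cL := ah_lin (chiO_hom D i); have qcL := lin_comp (@qL i j) cL.
have chj : tmap (chiO D j) id t = 0 by rewrite tE wj (lin0 (ah_lin (coactBH_hom j))).
rewrite -wi -tE (tmap_comp _ (@qL i j) cL (@lin_id _ _) (@lin_id _ _)).
have [r ->] := tmap_eq0 (ah_lin (chiO_hom D j)) chj.
rewrite (lin_sum (tmap_lin qcL (@lin_id _ H))) big1 // => p _.
by rewrite tmap_tens // qij_chiO_eq0 ?tens0l //; apply: svalP p.1.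
Qed.

Definition coactG (i j : I) (z : Gij D i j) : tensor (Gij D i j) H :=
  tmap (qij i j) id (coactBH (drepr z : GBH i)).

Lemma coactG_q i j x : coactG (qij i j x) = tmap (qij i j) id (coactBH x).
Proof.
have cL := ah_lin (coactBH_hom i); have tL := tmap_lin (@qL i j) (@lin_id _ H).
apply/eqP; rewrite -subr_eq0 -(linB tL) -(linB cL); apply/eqP/qij_coact_eq0.
by rewrite (linB (@qL i j)) [qij i j (drepr _)]dreprK subrr.
Qed.

Lemma qij_surj i j z : exists x, qij i j x = z.
Proof. by exists (drepr z); apply: dreprK. Qed.

Lemma coactG_hom i j : alg_hom (@coactG i j).
Proof.
have [cL c1 cM] := coactBH_hom i; have [tL t1 tM] := tmap_alg_hom H (qH i j).
split.
- move=> a x y; have [x' <-] := qij_surj x; have [y' <-] := qij_surj y.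
  by rewrite -(@qL i j) !coactG_q cL tL.
- by rewrite -(ah_one (qH i j)) coactG_q c1 t1.
- move=> x y; have [x' <-] := qij_surj x; have [y' <-] := qij_surj y.
  by rewrite -(ah_mul (qH i j)) !coactG_q cM tM.
Qed.
End Coaction.

(** * Cleft comodule algebras *)

Section CleftExtension.
Variables (k : fieldType) (H : hopf k) (G : ualgType k).
Variables (rho : G -> tensor G H) (eta : H -> G).
Hypotheses (rhoH : alg_hom rho) (etaH : alg_hom eta).
Hypothesis rho_eta : forall h, rho (eta h) = tmap eta id (comul h).

Let etaL := ah_lin etaH.
Let comulL := ah_lin (@comul_hom k H).
Let SL := @antipode_lin k H.

Let split_term (x : G) (g1 g2 : H) : tensor G H := (x * eta (antipode g1)) ⊗ g2.
Let split1 g2 : bilin (fun x g1 => split_term x g1 g2).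
Proof.
exact (bilin_post ((tens_bilin G H).1 g2) (mul_bilin (@lin_id _ _) (lin_comp etaL SL))).
Qed.
Let split2 x : bilin (split_term x).
Proof.
apply: bilin_comp (tens_bilin _ _) _ (@lin_id _ _).
exact: lin_comp ((umul_bilin G).2 x) (lin_comp etaL SL).
Qed.
Let split3 : bilin (fun x g => tsum (split_term x) (comul g)).
Proof. exact: bilin_comp (tsum3_bilin split1 split2) (@lin_id _ _) comulL. Qed.

(* [z |-> sum z_0 eta(S z_1) (x) z_2]. *)
Definition cleft_split (z : G) : tensor G H :=
  tsum (fun x g => tsum (split_term x) (comul g)) (rho z).

Lemma cleft_split_lin : linear cleft_split.
Proof. exact: lin_comp (tsum_lin split3) (ah_lin rhoH). Qed.

(** The terms are [X eta(h_1) eta(S h_2) ⊗ h_3], and the antipode collapses the two values of [eta]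
    to the counit. As [cleft_split] depends on the product alone, formulas in [X ⊗ h] become well
    defined on products [X eta(h)]. *)
Lemma cleft_splitM X h : rho X = X ⊗ (1 : H) -> cleft_split (X * eta h) = X ⊗ h.
Proof.
move=> hX; rewrite /cleft_split (ah_mul rhoH) hX rho_eta.
have XL : linear (fun g => X * eta g) := lin_comp ((umul_bilin G).2 X) etaL.
have -> : (X ⊗ (1 : H)) * tmap eta id (comul h) =
    tmap (fun g => X * eta g) id (comul h) :> tensor G H.
  move: (comul h); apply: tensor_lin_eq => [||u v].
  - exact: lin_comp ((umul_bilin _).2 _) (tmap_lin etaL (@lin_id _ _)).
  - exact: tmap_lin XL (@lin_id _ _).
  by rewrite !tmap_tens // tens_mul mul1r.
rewrite (tsum_tmap _ split3 XL (@lin_id _ _)) -[RHS]/(X ⊗ id h) -{2}(comul_counitl h).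
rewrite -(sweedler_coassoc (f := fun h1 g1 g2 => split_term (X * eta h1) g1 g2)) => [|w|u].
- rewrite (tsum_linear _ _ ((tens_bilin G H).2 X)); apply: eq_tsum => u v.
  rewrite -[LHS](tsum_linear (g := fun y => y ⊗ v)); last exact: (tens_bilin _ _).1.
  rewrite tensZr -tensZl; congr (_ ⊗ _).
  have := congr1 (fun f => X * f u) (conv_antipoder etaH).
  rewrite /conv_unit -uscalerAr mulr1 => <-.
  rewrite /conv (tsum_linear _ _ ((umul_bilin G).2 X)).
  by apply: eq_tsum => u' v'; rewrite mulrA.
- exact: bilin_comp (split1 w) XL (@lin_id _ _).
- exact: split2.
Qed.

Section Coinvariants.
Variables (a : H -> G) (f : H -> G) (X : G).
Hypotheses (aL : linear a) (fL : linear f).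
Hypothesis rho_a : forall h, rho (a h) = a h ⊗ (1 : H).
Hypothesis rho_f : forall h, rho (f h) = tmap f id (comul h).
Hypothesis rho_X : rho X = X ⊗ (1 : H).

Let idL := @lin_id k H.
Let mulX : linear (fun y : G => X * y) := (umul_bilin G).2 X.
Let mulrX : linear (fun y : G => y * X) := (umul_bilin G).1 X.

Lemma rho_mull h : rho (X * f h) = tmap (fun g => X * f g) id (comul h).
Proof.
rewrite (ah_mul rhoH) rho_X rho_f; move: (comul h); apply: tensor_lin_eq => [||u v].
- exact: lin_comp ((umul_bilin _).2 _) (tmap_lin fL idL).
- exact: tmap_lin (lin_comp mulX fL) idL.
by rewrite (tmap_tens _ _ fL idL) (tmap_tens _ _ (lin_comp mulX fL) idL) tens_mul mul1r.
Qed.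
Lemma rho_mulr h : rho (f h * X) = tmap (fun g => f g * X) id (comul h).
Proof.
rewrite (ah_mul rhoH) rho_X rho_f; move: (comul h); apply: tensor_lin_eq => [||u v].
- exact: (lin_comp (f := fun y : tensor G H => y * (X ⊗ (1 : H)))
    ((umul_bilin _).1 _) (tmap_lin fL idL)).
- exact: tmap_lin (lin_comp mulrX fL) idL.
by rewrite (tmap_tens _ _ fL idL) (tmap_tens _ _ (lin_comp mulrX fL) idL) tens_mul mulr1.
Qed.

Lemma rho_conv h : rho (conv a eta h) = tmap (conv a eta) id (comul h).
Proof.
have tB := tens_bilin G H.
transitivity (tsum (fun u v =>
    tsum (fun v1 v2 => (a u * eta v1) ⊗ v2) (comul v)) (comul h)).
  rewrite /conv (tsum_linear _ _ (ah_lin rhoH)); apply: eq_tsum => u v.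
  rewrite (ah_mul rhoH) rho_a rho_eta /tmap (tsum_linear _ _ ((umul_bilin _).2 _)).
  by apply: eq_tsum => x y; rewrite tens_mul mul1r.
rewrite -(sweedler_coassoc (f := fun u v1 v2 => (a u * eta v1) ⊗ v2)) => [|w|u].
- by apply: eq_tsum => u v; rewrite /conv (tsum_linear (g := fun y => y ⊗ v) _ _ (tB.1 v)).
- exact: (bilin_post (tB.1 w) (mul_bilin aL etaL)).
- exact: (bilin_comp tB (lin_comp ((umul_bilin G).2 (a u)) etaL) idL).
Qed.
End Coinvariants.
End CleftExtension.

(** * Derivatives on a cleft algebra and change of frame *)

Section LocalDerivative.
Variables (k : fieldType) (G : dga k).

(* [b] distinguishes left derivatives, where a form is commuted past the derivation,
   from right ones. *)
Definition sided (b : bool) (x w : G) : G := if b then sgn x * w else w * x.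
Lemma sided_bilin b : bilin (sided b).
Proof.
case: b; first exact: mul_bilin (@sgn_lin _ _) (@lin_id _ _).
by split=> [w|x]; [apply: (umul_bilin G).2|apply: (umul_bilin G).1].
Qed.

Variables (H : hopf k) (rho : G -> tensor G H) (eta : H -> G).
Hypotheses (rhoH : alg_hom rho) (etaH : alg_hom eta).
Hypothesis rho_eta : forall h, rho (eta h) = tmap eta id (comul h).
Let etaL := ah_lin etaH.

Variables (b : bool) (a : H -> G).
Hypothesis aL : linear a.
Let aetaL : linear (conv a eta) := conv_lin aL etaL.

(** The value that the Leibniz rule forces on [X * eta h] when [eta h] is sent to [- conv a eta h];
    in the right case the product is read as [eta h * X]. *)
Definition local_term (X : G) (h : H) : G :=
  dif X * eta h - sided b X (conv a eta h).
Lemma local_term_bilin : bilin local_term.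
Proof.
apply: bilinD; first exact: mul_bilin (@dif_lin _ _) etaL.
apply: bilin_post; last exact: bilin_comp (sided_bilin b) (@lin_id _ _) aetaL.
by move=> c x y; rewrite opprD scalerN.
Qed.
Definition local_derivative (z : G) : G := tsum local_term (cleft_split rho eta z).
Lemma local_derivative_lin : linear local_derivative.
Proof. exact: lin_comp (tsum_lin local_term_bilin) (cleft_split_lin rhoH etaH). Qed.
Lemma local_derivativeM X h : rho X = X ⊗ (1 : H) ->
  local_derivative (X * eta h) = local_term X h.
Proof.
move=> hX; rewrite /local_derivative (cleft_splitM rhoH etaH rho_eta _ hX) tsum_tens //.
exact: local_term_bilin.
Qed.

Variable t : H -> G.
Hypothesis tL : linear t.
Hypothesis t0 : forall h, homog 0 (t h).
Hypothesis rho_t : forall h, rho (t h) = t h ⊗ (1 : H).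
Hypothesis t_eta : forall h g, t h * eta g = eta g * t h.
Hypothesis t_a : forall h g, t h * a g = a g * t h.

(** Each term [X t(h_1) eta(h_2)] has the coinvariant coefficient [X t(h_1)], so the formula on
    products applies; [t] has degree zero and adds no sign. *)
Lemma local_derivative_twisted X h : rho X = X ⊗ (1 : H) ->
  (forall g, X * t g = t g * X) ->
  local_derivative (X * conv t eta h) =
  dif X * conv t eta h + sgn X * conv (fun g => dif (t g)) eta h
    - sided b X (conv t (conv a eta) h).
Proof.
move=> hX Xt; pose dt g := dif (t g).
have sidedN y : sided b X (- y) = - sided b X y by rewrite (linN ((sided_bilin b).2 X)).
have sidedNL : linear (fun y => sided b X (- y)).
  by move=> c x y; rewrite opprD -scalerN ((sided_bilin b).2 X).
(* For the right case, where the coefficient stands behind the form: [t] moves to the front because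
   it commutes with [X], [a] and [eta]. *)
have tw g u : conv a eta u * (X * t g) = t g * conv a eta u * X.
  rewrite Xt mulrA; congr (_ * X); rewrite -conv_mull -conv_mulr.
  by apply: eq_tsum => x y; rewrite mulrA t_a -!mulrA t_eta.
rewrite -conv_mull /conv (tsum_linear _ _ local_derivative_lin).
transitivity (tsum (fun h1 h2 => (dif X * (t h1 * eta h2) + sgn X * (dt h1 * eta h2))
    + sided b X (- (t h1 * conv a eta h2))) (comul h)).
  apply: eq_tsum => u v; rewrite local_derivativeM; last first.
    by rewrite (ah_mul rhoH) hX rho_t tens_mul mulr1.
  rewrite /local_term dif_mulE mulrDl -!mulrA sidedN; congr (_ - _).
  rewrite /sided; case: b; last by rewrite tw.
  by rewrite sgn_mul (sgn_homog (t0 u)) expr0 scale1r mulrA.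
have sum2 (f g : H -> H -> G) (y : tensor H H) :
    tsum (fun u v => f u v + g u v) y = tsum f y + tsum g y.
  by rewrite /tsum /psum -big_split.
rewrite sum2 sum2 -!(tsum_linear _ _ ((umul_bilin G).2 _)).
by rewrite -(tsum_linear _ _ sidedNL) sidedN.
Qed.

Variable a' : H -> G.
Hypothesis aL' : linear a'.
Hypothesis glue : forall h, conv t a h = dif (t h) + conv a' t h.

(** After substitution of [glue] the terms in [dif (t _)] cancel, at once in the left case and by
    their graded commutation with [X] in the right case. What remains is the same local formula in
    the frame [conv t eta] with the form [a']. *)
Lemma local_derivative_glued X h : rho X = X ⊗ (1 : H) ->
  (forall g, X * t g = t g * X) -> (forall g, X * eta g = eta g * X) ->
  (forall g, dif (t g) * X = sgn X * dif (t g)) ->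
  local_derivative (X * conv t eta h) =
  dif X * conv t eta h - sided b X (conv a' (conv t eta) h).
Proof.
move=> hX Xt Xeta Xdt; pose dt g := dif (t g).
have dtL : linear dt := lin_comp (@dif_lin _ _) tL.
have glue' : conv t (conv a eta) = fun g => conv dt eta g + conv a' (conv t eta) g.
  rewrite convA // (_ : conv t a = fun g => dt g + conv a' t g); last exact/funext.
  by rewrite convDl; apply: funext => g; rewrite -convA.
rewrite local_derivative_twisted // -/dt glue' (linD ((sided_bilin b).2 X)).
rewrite opprD addrA addrAC -!addrA; congr (_ + _); rewrite addrCA -[RHS]addr0; congr (_ + _).
rewrite /sided; case: b; first by rewrite subrr.
rewrite -conv_mulr -conv_mull /conv; apply/eqP; rewrite subr_eq0; apply/eqP.
by apply: eq_tsum => u v; rewrite -Xeta mulrA Xdt.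
Qed.

(** All factors other than [eta] are coinvariant, so the coaction acts on [eta] alone. *)
Lemma rho_local_term X h : (forall u, rho (a u) = a u ⊗ (1 : H)) ->
  rho X = X ⊗ (1 : H) -> rho (sgn X) = sgn X ⊗ (1 : H) -> rho (dif X) = dif X ⊗ (1 : H) ->
  rho (local_term X h) = tmap (local_term X) id (comul h).
Proof.
move=> rho_a hX hsX hdX; rewrite /local_term (linB (ah_lin rhoH)).
have wE := rho_conv rhoH etaH rho_eta aL rho_a.
rewrite (rho_mull rhoH etaL rho_eta hdX).
have -> : rho (sided b X (conv a eta h)) =
    tmap (fun g => sided b X (conv a eta g)) id (comul h).
  rewrite /sided; case: b; first exact: rho_mull.
  exact: rho_mulr.
rewrite /tmap /tsum /psum -sumrB; apply: eq_bigr => p _.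
by rewrite -(linB ((tens_bilin G H).1 _)).
Qed.
End LocalDerivative.

(** * Transition functions *)

Section QuotientProjection.
Variables (k : fieldType) (A : ualgType k) (J K : tideal A).
Hypothesis JK : forall x, J x -> K x.
Lemma qproj_aproj x : qproj K (aproj J x) = aproj K x.
Proof. by apply/aprojP/JK; apply: aproj_repr. Qed.
Lemma qproj_hom : alg_hom (@qproj k A J K).
Proof.
have [jL j1 jM] := aproj_hom J; have [kL k1 kM] := aproj_hom K.
split=> [a||].
- by elim/aquotW=> x; elim/aquotW=> y; rewrite -jL !qproj_aproj kL.
- by rewrite -j1 qproj_aproj k1.
- by elim/aquotW=> x; elim/aquotW=> y; rewrite -jM !qproj_aproj kM.
Qed.
End QuotientProjection.

Section Counit.
Variables (k : fieldType) (H : hopf k) (U : lmodType k).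
Let comulL := ah_lin (@comul_hom k H).
Let idL := @lin_id k H.
Let sL := slice_lin (U := U) (@counit_linear k H).

Lemma counit_middle (t : tensor U H) :
  tmap (slice (@counit k H)) id (tassocV (tmap id (@comul k H) t)) = t.
Proof.
have eB : bilin (fun h1 h2 : H => counit h1 *: h2).
  split=> [v|u] a x y; first by rewrite counit_lin scalerDl scalerA.
  by rewrite scalerDr !scalerA mulrC.
move: t; apply: tensor_lin_eq => [||a g].
- apply: lin_comp (tmap_lin sL idL) _.
  exact: lin_comp (@tassocV_lin _ _ _ _) (tmap_lin (@lin_id _ _) comulL).
- exact: lin_id.
rewrite tmap_tens // -{2}(comul_counitl g).
move: (comul g); apply: tensor_lin_eq => [||x y].
- apply: lin_comp (tmap_lin sL idL) _.
  exact: lin_comp (@tassocV_lin _ _ _ _) ((tens_bilin _ _).2 _).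
- exact: lin_comp ((tens_bilin _ _).2 a) (tsum_lin eB).
rewrite tassocV_tens tmap_tens // slice_tens ?tsum_tens ?tensZl ?tensZr //.
exact: counit_linear.
Qed.

Lemma tassocV_tmap1 (u : U) (V W : lmodType k) (t : tensor V W) :
  tassocV (u ⊗ t) = tmap (fun v => u ⊗ v) id t.
Proof.
have uL := (tens_bilin U V).2 u.
move: t; apply: tensor_lin_eq => [||x y].
- exact: lin_comp (@tassocV_lin _ _ _ _) ((tens_bilin _ _).2 _).
- exact: tmap_lin uL (@lin_id _ _).
by rewrite tassocV_tens tmap_tens.
Qed.
End Counit.

Section TransitionFunctions.
Variables (k : fieldType) (H : hopf k) (P B : ualgType k) (I : finType).
Variables (Q : qpfb H P B I) (T : transitions Q).
Local Notation J := (base_ideal Q).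
Local Notation pil i j := (@pil _ _ _ _ _ Q i j).
Local Notation pir i j := (@pir _ _ _ _ _ Q i j).
Local Notation phi i j := (@phi _ _ _ _ _ _ T i j).
Let comulL := ah_lin (@comul_hom k H).
Let idL := @lin_id k H.

Lemma ideal_Jijl i j x : J i x -> Jij Q i j x.
Proof. by move=> h; exists x, 0; split=> //; [apply: tideal0|rewrite addr0]. Qed.
Lemma ideal_Jijr i j x : J j x -> Jij Q i j x.
Proof. by move=> h; exists 0, x; split=> //; [apply: tideal0|rewrite add0r]. Qed.
Lemma pil_aproj i j b : pil i j (aproj (J i) b) = aproj (Jij Q i j) b.
Proof. exact: qproj_aproj (@ideal_Jijl i j) b. Qed.
Lemma pir_aproj i j b : pir i j (aproj (J j) b) = aproj (Jij Q i j) b.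
Proof. exact: qproj_aproj (@ideal_Jijr i j) b. Qed.
Lemma pil_hom i j : alg_hom (pil i j).
Proof. exact: qproj_hom (@ideal_Jijl i j). Qed.
Lemma pir_hom i j : alg_hom (pir i j).
Proof. exact: qproj_hom (@ideal_Jijr i j). Qed.
Lemma pil_surj i j a : exists b, pil i j b = a.
Proof. by elim/aquotW: a => b; exists (aproj _ b); rewrite pil_aproj. Qed.
Lemma pir_surj i j a : exists b, pir i j b = a.
Proof. by elim/aquotW: a => b; exists (aproj _ b); rewrite pir_aproj. Qed.

Lemma tmap_surj (U U' V : lmodType k) (f : U -> U') : linear f ->
  (forall u', exists u, f u = u') -> forall t : tensor U' V, exists s, tmap f id s = t.
Proof.
move=> fL fS; have tL := tmap_lin fL (@lin_id _ V).
apply: tensor_ind => [|_ _ [s <-] [t <-]|u' v].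
- by exists 0; rewrite (lin0 tL).
- by exists (s + t); rewrite (linD tL).
- by have [u <-] := fS u'; exists (u ⊗ v); rewrite tmap_tens.
Qed.

Lemma pir_chi_surj i j (u : tensor (Bij Q i j) H) :
  exists p, tmap (pir i j) id (chi Q j p) = u.
Proof.
have [s <-] := tmap_surj (ah_lin (pir_hom i j)) (@pir_surj i j) u.
by have [p <-] := @chi_surj _ _ _ _ _ Q j s; exists p.
Qed.

Lemma phi_base1 i j a : phi i j (a ⊗ (1 : H)) = a ⊗ (1 : H).
Proof.
elim/aquotW: a => b; have := phi_chi T i j (Defs.iota Q b); rewrite !chi_iota.
have pL := ah_lin (pil_hom i j); have rL := ah_lin (pir_hom i j).
by rewrite !tmap_tens // pil_aproj pir_aproj.
Qed.

(** Covariance is not part of [transitions]. It is inherited from that of the two charts, since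
    every [u] is the image of some [p] in [P]. *)
Lemma phi_covariant i j (u : tensor (Bij Q i j) H) :
  tassocV (tmap id (@comul k H) (phi i j u)) =
  tmap (phi i j) id (tassocV (tmap id (@comul k H) u)).
Proof.
have pL := ah_lin (pil_hom i j); have rL := ah_lin (pir_hom i j).
have fL := ah_lin (phi_hom T i j); have cL l := ah_lin (chi_hom Q l).
have swap (U U' : lmodType k) (f : U -> U') (s : tensor U H) : linear f ->
    tassocV (tmap id (@comul k H) (tmap f id s)) =
    tmap (tmap f id) id (tassocV (tmap id (@comul k H) s)).
  move=> gL; have tL := tmap_lin gL idL.
  move: s; apply: tensor_lin_eq => [||v h].
  - apply: lin_comp (@tassocV_lin _ _ _ _) _.
    exact: lin_comp (tmap_lin (@lin_id _ _) comulL) tL.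
  - apply: lin_comp (tmap_lin tL idL) _.
    exact: lin_comp (@tassocV_lin _ _ _ _) (tmap_lin (@lin_id _ _) comulL).
  rewrite !tmap_tens //; move: (comul h); apply: tensor_lin_eq => [||x y].
  - exact: lin_comp (@tassocV_lin _ _ _ _) ((tens_bilin _ _).2 _).
  - apply: lin_comp (tmap_lin tL idL) _.
    exact: lin_comp (@tassocV_lin _ _ _ _) ((tens_bilin _ _).2 _).
  by rewrite !tassocV_tens !tmap_tens.
have [p <-] := pir_chi_surj u.
rewrite -(phi_chi T) !swap // !chi_coact'.
rewrite (tmap_comp _ (tmap_lin pL idL) (cL i) idL idL).
rewrite (tmap_comp _ (tmap_lin rL idL) (cL j) idL idL).
rewrite (tmap_comp _ fL (lin_comp (tmap_lin rL idL) (cL j)) idL idL).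
by congr tmap; apply: funext => x; rewrite (phi_chi T).
Qed.

Lemma tauji_lin i j : linear (tauji T i j).
Proof.
apply: lin_comp (slice_lin (@counit_linear k H)) _.
exact: lin_comp (ah_lin (phi_hom T i j)) ((tens_bilin _ _).2 _).
Qed.

(** The counit is applied to the middle leg of [phi_covariant]: on the left it restores [phi], on
    the right it produces [tauji]. *)
Lemma phi_tau i j h : phi i j ((1 : Bij Q i j) ⊗ h) = tmap (tauji T i j) id (comul h).
Proof.
have fL := ah_lin (phi_hom T i j); have sL := slice_lin (U := Bij Q i j) (@counit_linear k H).
have := congr1 (tmap (slice (@counit k H)) id) (phi_covariant ((1 : Bij Q i j) ⊗ h)).
rewrite (tmap_comp _ sL fL idL idL) tmap_tens //.
rewrite counit_middle => ->.
rewrite tassocV_tmap1 (tmap_comp _ (lin_comp sL fL) ((tens_bilin _ _).2 _) idL idL).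
by [].
Qed.

Lemma phiE i j a h :
  phi i j (a ⊗ h) = (a ⊗ (1 : H)) * tmap (tauji T i j) id (comul h).
Proof.
rewrite -phi_tau -phi_base1 -(ah_mul (phi_hom T i j)); congr (phi _ _ _).
by rewrite tens_mul mulr1 mul1r.
Qed.

Local Notation cb i j := (@qproj k B (Jij Q j i) (Jij Q i j)).
Lemma cb_hom i j : alg_hom (cb i j).
Proof. exact: qproj_hom (@JijC _ _ _ _ _ Q j i). Qed.
Lemma tauij_lin i j : linear (tauij T i j).
Proof. exact: lin_comp (ah_lin (cb_hom i j)) (tauji_lin j i). Qed.

(** [phi i j] and [phi j i] act over the distinct types [Bij i j] and [Bij j i], identified by [cb].
    Both compare the images of [chi i] and [chi j], in opposite directions. *)
Lemma phi_swap i j u :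
  phi i j (tmap (cb i j) id (phi j i u)) = tmap (cb i j) id u.
Proof.
have cL := ah_lin (cb_hom i j).
have [p <-] := pir_chi_surj u; rewrite -(phi_chi T).
have pL := ah_lin (pil_hom j i); have rL := ah_lin (pir_hom j i).
rewrite (tmap_comp _ cL pL idL idL) (tmap_comp _ cL rL idL idL).
have e1 : (fun x => cb i j (pil j i x)) = pir i j.
  apply: funext; elim/aquotW => x; rewrite pil_aproj pir_aproj.
  exact: (qproj_aproj (@JijC _ _ _ _ _ Q j i)).
have e2 : (fun x => cb i j (pir j i x)) = pil i j.
  apply: funext; elim/aquotW => x; rewrite pil_aproj pir_aproj.
  exact: (qproj_aproj (@JijC _ _ _ _ _ Q j i)).
by rewrite e1 e2 -(phi_chi T).
Qed.

(** The counit of [phi_swap] at [1 ⊗ h]: the inner map contributes [tauij(h_1) ⊗ h_2], the outer one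
    [tauji(h_2)]. *)
Lemma conv_tau i j : conv (tauij T i j) (tauji T i j) = @conv_unit k H (Bij Q i j).
Proof.
have cL := ah_lin (cb_hom i j); have fL := ah_lin (phi_hom T i j).
have jiL := tauji_lin i j.
apply: funext => h; have := @phi_swap i j ((1 : Bij Q j i) ⊗ h).
rewrite phi_tau (tmap_comp _ cL (tauji_lin j i) idL idL) tmap_tens //.
move=> /(congr1 (slice (@counit k H))).
have sL := slice_lin (U := Bij Q i j) (@counit_linear k H).
rewrite slice_tens; last exact: counit_linear.
rewrite (ah_one (cb_hom i j)) -[RHS]/(conv_unit _ h) => <-.
rewrite /tmap (tsum_linear _ _ fL) (tsum_linear _ _ sL); apply: eq_tsum => u v.
rewrite phiE.
have mL : linear (fun y : tensor (Bij Q i j) H => (tauij T i j u ⊗ (1 : H)) * y).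
  exact: (umul_bilin _).2.
rewrite /tmap (tsum_linear _ _ mL) (tsum_linear _ _ sL).
rewrite -{1}(comul_counitr v) (tsum_linear _ _ jiL).
rewrite (tsum_linear _ _ ((umul_bilin (Bij Q i j)).2 _)).
apply: eq_tsum => x y; rewrite tens_mul mul1r slice_tens; last exact: counit_linear.
by rewrite (linZ jiL) uscalerAr.
Qed.

Lemma conv_tau' i j : conv (tauji T i j) (tauij T i j) = @conv_unit k H (Bij Q i j).
Proof.
apply: funext => h; have := congr1 (fun f => cb i j (f h)) (conv_tau j i).
have cH := cb_hom i j.
rewrite /conv_unit (linZ (ah_lin cH)) (ah_one cH) => <-.
rewrite (conv_hom _ _ _ cH); apply: eq_tsum => u v; congr (_ * _).
rewrite /tauij; elim/aquotW: (tauji T i j u) => x.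
by rewrite (qproj_aproj (@JijC _ _ _ _ _ Q i j)) (qproj_aproj (@JijC _ _ _ _ _ Q j i)).
Qed.
End TransitionFunctions.

(** * Forms on the overlaps *)

Section Overlaps.
Variables (k : fieldType) (H : hopf k) (P B : ualgType k) (I : finType).
Variables (Q : qpfb H P B I) (D : diff_structure Q).
Local Notation GB := (GB D).
Local Notation GH := (GH D).
Local Notation jB i := (@jB _ _ _ _ _ _ D i).
Local Notation jH := (jH D).
Local Notation GBH := (GBH D).
Local Notation qij i j := (@qij _ _ _ _ _ _ D i j).
Local Notation pil i j := (@pil _ _ _ _ _ Q i j).
Local Notation pir i j := (@pir _ _ _ _ _ Q i j).
Local Notation incl i j := (@incl _ _ _ _ _ _ D i j).
Local Notation incr i j := (@incr _ _ _ _ _ _ D i j).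

Let qH i j : dga_hom (qij i j). Proof. exact: dproj_hom. Qed.
Let idL := @lin_id k H.

Definition lform (i : I) (g : GB i) : GBH i := g ⊗ (1 : GH).
Definition hpart (i : I) (h : H) : GBH i := (1 : GB i) ⊗ jH h.
Lemma lform_hom i : dga_hom (@lform i).
Proof. exact: tens1l_hom. Qed.
Lemma hpart_hom i : alg_hom (@hpart i).
Proof. exact: alg_hom_comp (tens1r_hom D i) (jH_hom0 D). Qed.
Lemma lform_hpart i g h : lform g * hpart i h = g ⊗ jH h.
Proof.
by rewrite /lform /hpart (gtensor_mulE _ _ (gr_one GH) (gr_one (GB i)))
  mulr1 mul1r scale1r.
Qed.
Lemma hpart_lform i g h : hpart i h * lform g = g ⊗ jH h.
Proof.
move: g; apply: homog_ind => [|g g' hg hg'|n g hg].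
- by rewrite (lin0 (ah_lin (lform_hom i))) mulr0 tens0l.
- by rewrite (linD (ah_lin (lform_hom i))) mulrDr hg hg' tensDl.
rewrite /lform /hpart (gtensor_mulE _ _ (ah0_deg (jH_hom0 D) h) hg).
by rewrite mulr1 mul1r mul0n scale1r.
Qed.
Lemma lform_hpartC i g h : lform g * hpart i h = hpart i h * lform g.
Proof. by rewrite lform_hpart hpart_lform. Qed.

Definition base (i j : I) (g : GB i) : Gij D i j := qij i j (lform g).
Definition eta (i j : I) (h : H) : Gij D i j := qij i j (hpart i h).
Lemma base_hom i j : dga_hom (@base i j).
Proof. exact: dga_hom_comp (qH i j) (lform_hom i). Qed.
Lemma eta_hom i j : alg_hom (@eta i j).
Proof. exact: alg_hom_comp (qH i j) (hpart_hom i). Qed.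
Lemma base_etaC i j g h : base j g * eta i j h = eta i j h * base j g.
Proof. by rewrite -!(ah_mul (qH i j)) lform_hpartC. Qed.

Let insL i g : linear (fun l => g ⊗ l : GBH i). Proof. exact: (tens_bilin (GB i) GH).2. Qed.
Let jHL := ah_lin (jH_hom0 D).
Lemma coactBH_lform i (g : GB i) : coactBH (lform g) = lform g ⊗ (1 : H).
Proof.
rewrite coactBH_tens (ah_one (@coactH_hom _ _ _ _ _ _ D)) -tens_one tmap_tens //.
exact: insL.
Qed.
Lemma coactBH_hpart i h : coactBH (hpart i h) = tmap (@hpart i) id (comul h).
Proof. by rewrite coactBH_tens coactH_alg (tmap_comp _ (insL _) jHL idL idL). Qed.
Lemma coactG_base i j (g : GB i) : coactG (base j g) = base j g ⊗ (1 : H).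
Proof. by rewrite coactG_q coactBH_lform tmap_tens //; apply: ah_lin (qH i j). Qed.
Lemma coactG_eta i j h : coactG (eta i j h) = tmap (@eta i j) id (comul h).
Proof.
rewrite coactG_q coactBH_hpart.
by rewrite (tmap_comp _ (ah_lin (qH i j)) (ah_lin (hpart_hom i)) idL idL).
Qed.

Lemma incl_pil i j (u : tensor (Bi Q i) H) :
  incl i j (tmap (pil i j) id u) = qij i j (tmap (jB i) jH u).
Proof.
have pL := ah_lin (pil_hom Q i j); have jBL := ah_lin (jB_hom0 D i).
move: u; apply: tensor_lin_eq => [||b h].
- exact: lin_comp (ah_lin (incl_hom0 D i j)) (tmap_lin pL idL).
- exact: lin_comp (ah_lin (qH i j)) (tmap_lin jBL jHL).
elim/aquotW: b => b; rewrite !tmap_tens // pil_aproj.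
exact: (@incG_tens _ _ _ _ _ _ D (Jij Q i j) i j (fun b h => h)).
Qed.
Lemma incr_pir i j (u : tensor (Bi Q j) H) :
  incr i j (tmap (pir i j) id u) = qij j i (tmap (jB j) jH u).
Proof.
have pL := ah_lin (pir_hom Q i j); have jBL := ah_lin (jB_hom0 D j).
move: u; apply: tensor_lin_eq => [||b h].
- exact: lin_comp (ah_lin (incr_hom0 D i j)) (tmap_lin pL idL).
- exact: lin_comp (ah_lin (qH j i)) (tmap_lin jBL jHL).
elim/aquotW: b => b; rewrite !tmap_tens // pir_aproj.
exact: (@incG_tens _ _ _ _ _ _ D (Jij Q i j) j i (@JijC _ _ _ _ _ Q i j)).
Qed.
Lemma incl_eta i j h : incl i j ((1 : Bij Q i j) ⊗ h) = eta i j h.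
Proof.
have pH := pil_hom Q i j; have jBH := jB_hom0 D i.
rewrite -(ah_one pH) -(tmap_tens _ _ (ah_lin pH) idL) incl_pil.
by rewrite (tmap_tens _ _ (ah_lin jBH) jHL) (ah_one jBH).
Qed.
Lemma incr_eta i j h : incr i j ((1 : Bij Q i j) ⊗ h) = eta j i h.
Proof.
have pH := pir_hom Q i j; have jBH := jB_hom0 D j.
rewrite -(ah_one pH) -(tmap_tens _ _ (ah_lin pH) idL) incr_pir.
by rewrite (tmap_tens _ _ (ah_lin jBH) jHL) (ah_one jBH).
Qed.
Lemma incl_base i j b : incl i j (pil i j b ⊗ (1 : H)) = base j (jB i b).
Proof.
have pH := pil_hom Q i j; have jBH := jB_hom0 D i.
rewrite -(tmap_tens _ _ (ah_lin pH) idL) incl_pil.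
by rewrite (tmap_tens _ _ (ah_lin jBH) jHL) (ah_one (jH_hom0 D)).
Qed.
Lemma incr_base i j b : incr i j (pir i j b ⊗ (1 : H)) = base i (jB j b).
Proof.
have pH := pir_hom Q i j; have jBH := jB_hom0 D j.
rewrite -(tmap_tens _ _ (ah_lin pH) idL) incr_pir.
by rewrite (tmap_tens _ _ (ah_lin jBH) jHL) (ah_one (jH_hom0 D)).
Qed.

Lemma piG_surj i (g : GB i) : exists w : GBase D, piG i w = g.
Proof.
move: g; apply: (dga_hom_surj (fun S => @calc_gen _ _ _ _ (GB_calculus D i) S)
  (piG_hom D i)); elim/aquotW=> b.
exists (dproj _ (uinj b)); rewrite piG_proj /piO uext_inj //; exact: pi0_hom0.
Qed.

(** A lift of [g] to [Gamma(B)], cut down to degree [n], has compatible components in all charts. It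
    makes the Leibniz rules, stated for global forms, usable with any homogeneous local form. *)
Lemma GcB_surj i n (g : GB i) : homog n g ->
  exists2 c : GcB D, homog_GcB n c & sval c i = g.
Proof.
move=> hg; have [w wg] := piG_surj g.
have inB : in_GcB (fun l => piG l (gr n w)).
  by move=> i' j'; exists (gr n w), (gr n w).
exists (exist _ _ inB) => [l|] /=.
  by rewrite /homog -(dh_gr (piG_hom D l)) gr_gr eqxx.
by rewrite (dh_gr (piG_hom D i)) wg.
Qed.

Variables (T : transitions Q) (E : transition_ext D T).
Local Notation phi i j := (@phi _ _ _ _ _ _ T i j).
Local Notation phiG i j := (@phiG _ _ _ _ _ _ D T E i j).

Lemma phiG_q i j (p : P) :
  qij i j (chi0 D i p) = phiG i j (qij j i (chi0 D j p)).
Proof. by rewrite /chi0 -incl_pil -incr_pir phiG_ext (phi_chi T). Qed.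

Lemma phiG_chiO i j (w : Omega P) :
  qij i j (chiO D i w) = phiG i j (qij j i (chiO D j w)).
Proof.
have h1 := dga_hom_comp (qH i j) (chiO_hom D i).
have h2 := dga_hom_comp (phiG_hom E i j) (dga_hom_comp (qH j i) (chiO_hom D j)).
apply: (uext_unique h1 h2) => p.
by rewrite /chiO !uext_inj; [exact: phiG_q|exact: chi0_hom0|exact: chi0_hom0].
Qed.

(** One tensor over [Omega P] computes the coaction in charts [i] and [j] at once, and [phiG_chiO]
    compares its two images. *)
Lemma coactG_phi i j z : coactG (phiG i j z) = tmap (phiG i j) id (coactG z).
Proof.
have [x <-] := qij_surj z; have [w <-] := chiO_surj x.
rewrite -phiG_chiO !coactG_q; have [t tE] := chiO_coact D w; rewrite -!tE.
have qL i j := ah_lin (qH i j); have cL i := ah_lin (chiO_hom D i).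
have fL := ah_lin (phiG_hom E i j).
rewrite (tmap_comp _ (qL i j) (cL i) idL idL) (tmap_comp _ (qL j i) (cL j) idL idL).
rewrite (tmap_comp _ fL (lin_comp (qL j i) (cL j)) idL idL).
by congr tmap; apply: funext => y; rewrite phiG_chiO.
Qed.

Lemma base_glue i j (c : GcB D) : base j (sval c i) = phiG i j (base i (sval c j)).
Proof. exact: iotaG_in E c i j. Qed.

Definition tau (i j : I) (h : H) : Gij D i j := incl i j (tauji T i j h ⊗ (1 : H)).
Definition tauV (i j : I) (h : H) : Gij D i j := incl i j (tauij T i j h ⊗ (1 : H)).

Let incl1_hom i j : alg_hom (fun a : Bij Q i j => incl i j (a ⊗ (1 : H))).
Proof.
apply: alg_hom_comp (incl_hom0 D i j) _; split=> [a x y||x y].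
- exact: (tens_bilin _ _).1.
- by [].
by rewrite tens_mul mulr1.
Qed.
Lemma tau_lin i j : linear (tau i j).
Proof. exact: lin_comp (ah_lin (incl1_hom i j)) (tauji_lin T i j). Qed.
Lemma tauV_lin i j : linear (tauV i j).
Proof. exact: lin_comp (ah_lin (incl1_hom i j)) (tauij_lin T i j). Qed.
Lemma tauVK i j : conv (tauV i j) (tau i j) = @conv_unit k H (Gij D i j).
Proof.
apply: funext => h; rewrite -[LHS](conv_hom _ _ _ (incl1_hom i j)) conv_tau.
by rewrite /conv_unit (linZ (ah_lin (incl1_hom i j))) (ah_one (incl1_hom i j)).
Qed.
Lemma tauKV i j : conv (tau i j) (tauV i j) = @conv_unit k H (Gij D i j).
Proof.
apply: funext => h; rewrite -[LHS](conv_hom _ _ _ (incl1_hom i j)) conv_tau'.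
by rewrite /conv_unit (linZ (ah_lin (incl1_hom i j))) (ah_one (incl1_hom i j)).
Qed.
Lemma tau_base i j h : exists g : GB i, tau i j h = base j g.
Proof.
have [b bE] := pil_surj (tauji T i j h).
by exists (jB i b); rewrite /tau -bE incl_base.
Qed.
Lemma tau_homog i j h : homog 0 (tau i j h).
Proof. exact: ah0_deg (incl_hom0 D i j) _. Qed.

Lemma phiG_eta i j h : phiG i j (eta j i h) = conv (tau i j) (eta i j) h.
Proof.
rewrite -incr_eta phiG_ext phi_tau /tmap.
rewrite (tsum_linear _ _ (ah_lin (incl_hom0 D i j))); apply: eq_tsum => u v.
rewrite -incl_eta -(ah_mul (incl_hom0 D i j)); congr (incl _ _ _).
by rewrite tens_mul mulr1 mul1r.
Qed.

Let etaS i j h := eta i j (antipode h).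
Lemma eta_antipode i j : conv (eta i j) (etaS i j) = @conv_unit k H (Gij D i j).
Proof. exact: conv_antipoder (eta_hom i j). Qed.
Lemma etaS_lin i j : linear (etaS i j).
Proof. exact: lin_comp (ah_lin (eta_hom i j)) (@antipode_lin _ H). Qed.
Lemma conv_eta_inj i j (f g : H -> Gij D i j) : linear f -> linear g ->
  conv f (eta i j) = conv g (eta i j) -> f = g.
Proof.
move=> fL gL; apply: (conv_cancelr (etaS_lin i j)) => //.
- exact: ah_lin (eta_hom i j).
- exact: eta_antipode.
Qed.

(* [phi(1 (x) h) = sum tau(h_1) eta(h_2)] commutes with forms coming from the base
   because [1 (x) h] does; the factor [eta] is then cancelled by its convolution
   inverse. *)
Lemma tau_baseC i j g h : base j g * tau i j h = tau i j h * base j g.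
Proof.
have tL := tau_lin i j; have bL x := (umul_bilin (Gij D i j)).2 x.
have bR x := (umul_bilin (Gij D i j)).1 x; have fH := phiG_hom E i j.
suff e : (fun h => base j g * tau i j h) = (fun h => tau i j h * base j g).
  exact (congr1 (fun f : H -> Gij D i j => f h) e).
move: g; apply: homog_ind => [|g g' hg hg'|n g hg].
- by apply: funext => u; rewrite (lin0 (ah_lin (base_hom i j))) mul0r mulr0.
- apply: funext => u; rewrite (linD (ah_lin (base_hom i j))) mulrDl mulrDr.
  by rewrite -[_ * _]/((fun h => base j g * tau i j h) u) hg
    -[base j g' * _]/((fun h => base j g' * tau i j h) u) hg'.
(* A global lift of [g] presents [base j g] as the [phiG]-image of a base form of chart [j], which
   commutes with [eta j i]. *)
have [c _ <-] := GcB_surj hg; rewrite base_glue.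
apply: (conv_eta_inj (lin_comp (bL _) tL) (lin_comp (bR _) tL)).
apply: funext => u; rewrite conv_mull -phiG_eta -(ah_mul fH) base_etaC (ah_mul fH) phiG_eta.
rewrite -base_glue -conv_mulr; apply: eq_tsum => x y.
by rewrite -base_etaC mulrA.
Qed.

(** The differential of [tau_baseC]; the terms containing [dif g] cancel because [dif g] again comes
    from the base. *)
Lemma dtau_base i j g h :
  dif (tau i j h) * base j g = sgn (base j g) * dif (tau i j h).
Proof.
have := congr1 (@dif _ _) (tau_baseC j g h).
rewrite !dif_mulE (sgn_homog (tau_homog i j h)) expr0 scale1r.
rewrite -(dh_dif (base_hom i j)) -tau_baseC addrC => /addIr ->.
by [].
Qed.
End Overlaps.

Section QuotientFactor.
Variables (k : fieldType) (G L : dga k) (K : dideal G) (f : G -> L).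
Hypotheses (fH : dga_hom f) (fK : forall x, K x -> f x = 0).
Lemma drepr_factor w : f (drepr (dproj K w)) = f w.
Proof.
apply/eqP; rewrite -subr_eq0 -(linB (ah_lin fH)); apply/eqP/fK.
by apply/dprojP; rewrite dreprK.
Qed.
Lemma drepr_hom : dga_hom (fun x : dquot K => f (drepr x)).
Proof.
have pH := dproj_hom K; have e := dreprK (J := K).
split; first split.
- by move=> a x y; rewrite -(e x) -(e y) -(ah_lin pH) !drepr_factor (ah_lin fH).
- by rewrite -(ah_one pH) drepr_factor (ah_one fH).
- by move=> x y; rewrite -(e x) -(e y) -(ah_mul pH) !drepr_factor (ah_mul fH).
- by move=> n x; rewrite -(e x) -(dh_gr pH) !drepr_factor (dh_gr fH).
- by move=> x; rewrite -(e x) -(dh_dif pH) !drepr_factor (dh_dif fH).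
Qed.
End QuotientFactor.

(** * Transport of the transformation law to the overlap algebra *)

Section Gluing.
Variables (k : fieldType) (H : hopf k) (P B : ualgType k) (I : finType).
Variables (Q : qpfb H P B I) (D : diff_structure Q).
Variables (T : transitions Q) (E : transition_ext D T).
Local Notation GB := (GB D).
Local Notation pil i j := (@pil _ _ _ _ _ Q i j).
Local Notation pir i j := (@pir _ _ _ _ _ Q i j).
Local Notation incl i j := (@incl _ _ _ _ _ _ D i j).
Local Notation incr i j := (@incr _ _ _ _ _ _ D i j).
Local Notation phiG i j := (@phiG _ _ _ _ _ _ D T E i j).
Local Notation iotal i j := (@iotal _ _ _ _ _ _ D i j).
Local Notation iotar i j := (@iotar _ _ _ _ _ _ D i j).
Local Notation jm i j := (@jm _ _ _ _ _ _ D i j).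
Local Notation base i j := (@base _ _ _ _ _ _ D i j).
Local Notation tau := (tau D T).
Local Notation tauV := (tauV D T).

Let tens1_hom (A : ualgType k) : alg_hom (fun a : A => a ⊗ (1 : H)).
Proof.
split=> [a x y||x y]; [exact: (tens_bilin _ _).1|by []|].
by rewrite tens_mul mulr1.
Qed.
Let incl1_hom0 i j : alg_hom0 (fun a : Bij Q i j => incl i j (a ⊗ (1 : H))).
Proof.
split; last by move=> a; apply: ah0_deg (incl_hom0 D i j) _.
exact: alg_hom_comp (incl_hom0 D i j) (tens1_hom _).
Qed.
Let incr1_hom0 i j : alg_hom0 (fun a : Bij Q i j => incr i j (a ⊗ (1 : H))).
Proof.
split; last by move=> a; apply: ah0_deg (incr_hom0 D i j) _.
exact: alg_hom_comp (incr_hom0 D i j) (tens1_hom _).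
Qed.
Let ul i j := uext (fun a : Bij Q i j => incl i j (a ⊗ (1 : H))).
Let ur i j := uext (fun a : Bij Q i j => incr i j (a ⊗ (1 : H))).
Let ulH i j := uext_hom (incl1_hom0 i j).
Let urH i j := uext_hom (incr1_hom0 i j).

Lemma Jm_incl i j w : Jm D i j w <-> ul w = 0.
Proof.
have h := dga_hom_comp (uext_hom (incl_hom0 D i j)) (uext_hom (tens1_hom0 Q i j)).
have e : uext (incl i j) (uext (fun a : Bij Q i j => uinj (a ⊗ (1 : H))) w) = ul w.
  apply: (uext_unique h (ulH i j)) => a.
  rewrite (uext_inj _ (tens1_hom0 Q i j)) (uext_inj _ (incl_hom0 D i j)).
  by rewrite /ul (uext_inj _ (incl1_hom0 i j)).
by rewrite -e.
Qed.
Lemma phiG_ur i j w : phiG i j (ur w) = ul w.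
Proof.
have h := dga_hom_comp (phiG_hom E i j) (urH i j).
apply: (uext_unique h (ulH i j)) => a.
rewrite /ur /ul (uext_inj _ (incl1_hom0 i j)) (uext_inj _ (incr1_hom0 i j)).
by rewrite phiG_ext phi_base1.
Qed.
(** [Gm] is defined through the ideal of chart [i]. As [phiG] is injective and carries [ur] to [ul],
    that ideal also dies on the side of chart [j], so [iotar] is well defined. *)
Lemma Jm_incr i j w : Jm D i j w -> ur w = 0.
Proof.
move/Jm_incl; rewrite -phiG_ur => h; apply: (bij_inj (phiG_bij E i j)).
by rewrite h (lin0 (ah_lin (phiG_hom E i j))).
Qed.

Lemma iotal_hom i j : dga_hom (iotal i j).
Proof. exact: drepr_hom (ulH i j) (fun w => proj1 (@Jm_incl i j w)). Qed.
Lemma iotar_hom i j : dga_hom (iotar i j).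
Proof. exact: drepr_hom (urH i j) (@Jm_incr i j). Qed.
Lemma iotal_inj i j : injective (iotal i j).
Proof.
move=> x y /eqP; rewrite -subr_eq0 -(linB (ah_lin (iotal_hom i j))) => /eqP h.
apply/eqP; rewrite -subr_eq0; apply/eqP; rewrite -[x - y]dreprK.
by apply/dproj_eq0/Jm_incl.
Qed.
Lemma phiG_iotar i j x : phiG i j (iotar i j x) = iotal i j x.
Proof. exact: phiG_ur. Qed.
Lemma iotal_jm i j a : iotal i j (jm i j a) = incl i j (a ⊗ (1 : H)).
Proof.
rewrite /Defs.iotal /Defs.jm (drepr_factor (ulH i j) (fun w => proj1 (@Jm_incl i j w))).
exact: uext_inj (incl1_hom0 i j).
Qed.
Lemma iotar_jm i j a : iotar i j (jm i j a) = incr i j (a ⊗ (1 : H)).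
Proof.
rewrite /Defs.iotar /Defs.jm (drepr_factor (urH i j) (@Jm_incr i j)).
exact: uext_inj (incr1_hom0 i j).
Qed.

(** The default of [xget] is never taken: the forms whose image lies in the range of [iotal] make up
    a subalgebra that contains the generators. *)
Lemma iotal_piml i j g : iotal i j (piml j g) = base i j g.
Proof.
apply: (@xgetPex _ 0 (fun x => iotal i j x = base i j g)).
have iH := iotal_hom i j; have bH := base_hom D i j.
move: g; apply: (calc_gen (GB_calculus D i)) => [|b|b].
- split; first by exists 1; rewrite (ah_one iH) (ah_one bH).
  + by move=> a x y [u hu] [v hv]; exists (a *: u + v); rewrite (ah_lin iH) (ah_lin bH) hu hv.
  + by move=> x y [u hu] [v hv]; exists (u * v); rewrite (ah_mul iH) (ah_mul bH) hu hv.
- by exists (jm i j (pil i j b)); rewrite iotal_jm incl_base.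
- exists (dif (jm i j (pil i j b))).
  by rewrite (dh_dif iH) (dh_dif bH) iotal_jm incl_base.
Qed.
Lemma iotar_pimr i j g : iotar i j (pimr i g) = base j i g.
Proof.
apply: (@xgetPex _ 0 (fun x => iotar i j x = base j i g)).
have iH := iotar_hom i j; have bH := base_hom D j i.
move: g; apply: (calc_gen (GB_calculus D j)) => [|b|b].
- split; first by exists 1; rewrite (ah_one iH) (ah_one bH).
  + by move=> a x y [u hu] [v hv]; exists (a *: u + v); rewrite (ah_lin iH) (ah_lin bH) hu hv.
  + by move=> x y [u hu] [v hv]; exists (u * v); rewrite (ah_mul iH) (ah_mul bH) hu hv.
- by exists (jm i j (pir i j b)); rewrite iotar_jm incr_base.
- exists (dif (jm i j (pir i j b))).
  by rewrite (dh_dif iH) (dh_dif bH) iotar_jm incr_base.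
Qed.

Variable A : forall i, H -> GB i.
Hypothesis AL : forall i, linear (A i).

(* [cf_glue] transported to [Gamma^i(B_ij (x) H)] and solved for the term
   containing [A i], which is where the derivatives are compared. *)
Lemma glue_conv i j :
  (forall h, piml j (A i h) =
      tsum3 (fun h1 h2 h3 =>
        jm i j (tauij T i j h1) * pimr i (A j h2) * jm i j (tauji T i j h3)) h
      + tsum (fun h1 h2 => jm i j (tauij T i j h1) * dif (jm i j (tauji T i j h2))) (comul h))
  <-> forall h, conv (tau i j) (fun h => base i j (A i h)) h =
    dif (tau i j h) + conv (fun h => phiG i j (base j i (A j h))) (tau i j) h.
Proof.
pose a h := base i j (A i h); pose a' h := phiG i j (base j i (A j h)).
pose dt h := dif (tau i j h).
have tL := tau_lin D T i j; have vL := tauV_lin D T i j.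
have aL : linear a := lin_comp (ah_lin (base_hom D i j)) (AL i).
have aL' : linear a'.
  exact: lin_comp (ah_lin (phiG_hom E i j)) (lin_comp (ah_lin (base_hom D j i)) (AL j)).
have dtL : linear dt := lin_comp (@dif_lin _ _) tL.
have iH := iotal_hom i j; have iL := ah_lin iH.
pose rhs h := conv (conv (tauV i j) a') (tau i j) h + conv (tauV i j) dt h.
have rhsE h : rhs h = iotal i j
    (tsum3 (fun h1 h2 h3 =>
        jm i j (tauij T i j h1) * pimr i (A j h2) * jm i j (tauji T i j h3)) h
      + tsum (fun h1 h2 => jm i j (tauij T i j h1) * dif (jm i j (tauji T i j h2))) (comul h)).
  rewrite (linD iL) /tsum3 !(tsum_linear _ _ iL) /rhs; congr (_ + _); last first.
    by apply: eq_tsum => u v; rewrite (ah_mul iH) (dh_dif iH) !iotal_jm.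
  apply: eq_tsum => u v; rewrite (tsum_linear _ _ iL) /conv.
  rewrite (tsum_linear (g := fun y : Gij D i j => y * tau i j v)); last exact: (umul_bilin _).1.
  apply: eq_tsum => x y; rewrite !(ah_mul iH) !iotal_jm.
  by rewrite -phiG_iotar iotar_pimr.
(* Left convolution with [tau] or with its inverse [tauV] passes from one side to the other. *)
have glueE : a = rhs <-> conv (tau i j) a = fun h => dt h + conv a' (tau i j) h.
  have vaL := conv_lin vL aL'; have rhsE' : rhs = fun h =>
      conv (tauV i j) (fun h => conv a' (tau i j) h + dt h) h.
    by rewrite convDr convA.
  rewrite rhsE'; split=> [->|e].
    rewrite convA //; last by move=> c x y; rewrite (conv_lin aL' tL) dtL scalerDr addrACA.
    rewrite tauKV conv1f; first by apply: funext => h; rewrite addrC.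
    by move=> c x y; rewrite (conv_lin aL' tL) dtL scalerDr addrACA.
  rewrite -[LHS](conv1f aL) -(tauVK D T i j) -convA // e.
  by congr conv; apply: funext => h; rewrite addrC.
split=> [e h|e h].
  have /glueE -> // : a = rhs.
  by apply: funext => g; rewrite rhsE -e iotal_piml.
apply: (@iotal_inj i j); rewrite iotal_piml -rhsE -[LHS]/(a h).
by rewrite (proj2 glueE) //; apply: funext.
Qed.
End Gluing.

Lemma dga_hom_sgn (k : fieldType) (G L : dga k) (f : G -> L) x :
  dga_hom f -> f (sgn x) = sgn (f x).
Proof.
move=> fH; have fL := ah_lin fH.
move: x; apply: homog_ind => [|x y hx hy|n x hx].
- by rewrite !(lin0 (@sgn_lin _ _)) !(lin0 fL) (lin0 (@sgn_lin _ _)).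
- by rewrite !(linD (@sgn_lin _ _)) !(linD fL) !(linD (@sgn_lin _ _)) hx hy.
rewrite (sgn_homog hx) (linZ fL) (@sgn_homog _ _ n) //.
by rewrite /homog -(dh_gr fH) hx.
Qed.

(** * Horizontal forms *)

Section Horizontal.
Variables (k : fieldType) (H : hopf k) (P B : ualgType k) (I : finType).
Variables (Q : qpfb H P B I) (D : diff_structure Q).
Local Notation GB := (GB D).
Local Notation GH := (GH D).
Local Notation jH := (jH D).
Local Notation GBH := (GBH D).
Local Notation lform := (@lform _ _ _ _ _ _ D _).
Local Notation hpart := (@hpart _ _ _ _ _ _ D).
Let idL := @lin_id k H.
Let jHL := ah_lin (jH_hom0 D).

Definition hinc (i : I) (u : tensor (GB i) H) : GBH i := tmap id jH u.
Lemma hinc_lin i : linear (@hinc i).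
Proof. exact: tmap_lin (@lin_id _ _) jHL. Qed.
Lemma hinc_tens i (g : GB i) h : hinc (g ⊗ h) = lform g * hpart i h.
Proof. by rewrite /hinc (tmap_tens _ _ (@lin_id _ _) jHL) lform_hpart. Qed.
Lemma hinc1 i h : hinc ((1 : GB i) ⊗ h) = hpart i h.
Proof. by rewrite hinc_tens (ah_one (lform_hom D i)) mul1r. Qed.

Lemma jH_retract_ex (x : GH) : exists h, jH h = gr 0 x.
Proof. exact: calc_deg0 (GH_calculus D) _ (homog_gr 0 x). Qed.
(** Projection to degree zero followed by the inverse of [jH]. Being a linear left inverse of [jH],
    it yields the uniqueness of the coefficient tensor of a horizontal form. *)
Definition jH_retract (x : GH) : H := projT1 (cid (jH_retract_ex x)).
Lemma jH_retractE x : jH (jH_retract x) = gr 0 x.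
Proof. by rewrite /jH_retract; case: cid. Qed.
Lemma jH_retract_lin : linear jH_retract.
Proof.
move=> a x y; apply: (calc_inj (GH_calculus D)).
by rewrite jHL !jH_retractE gr_lin.
Qed.
Lemma jHK h : jH_retract (jH h) = h.
Proof.
apply: (calc_inj (GH_calculus D)).
by rewrite jH_retractE (ah0_deg (jH_hom0 D)).
Qed.
Lemma jH_retract_pos n x : homog n.+1 x -> jH_retract x = 0.
Proof.
move=> hx; apply: (calc_inj (GH_calculus D)).
by rewrite jH_retractE (homogE 0 hx) (lin0 jHL).
Qed.

Definition hret (i : I) (x : GBH i) : tensor (GB i) H := tmap id jH_retract x.
Lemma hret_lin i : linear (@hret i).
Proof. exact: tmap_lin (@lin_id _ _) jH_retract_lin. Qed.
Lemma hincK i : cancel (@hinc i) (@hret i).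
Proof.
apply: tensor_lin_eq => [||g h].
- exact: lin_comp (@hret_lin i) (@hinc_lin i).
- exact: lin_id.
rewrite /hret /hinc (tmap_tens _ _ (@lin_id _ _) jHL).
by rewrite (tmap_tens _ _ (@lin_id _ _) jH_retract_lin) jHK.
Qed.

Lemma gr_hinc n i (u : tensor (GB i) H) : gr n (hinc u) = hinc (tmap (gr n) id u).
Proof.
have iL := @hinc_lin i; have tL := tmap_lin (@gr_lin _ (GB i) n) idL.
move: u; apply: tensor_lin_eq => [||g h].
- exact: lin_comp (gr_lin n) iL.
- exact: lin_comp iL tL.
rewrite (tmap_tens _ _ (@gr_lin _ (GB i) n) idL).
rewrite /hinc !(tmap_tens _ _ (@lin_id _ _) jHL).
move: g; apply: homog_ind => [|g g' hg hg'|m g hg].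
- by rewrite (lin0 (gr_lin n)) !tens0l (lin0 (gr_lin n)).
- by rewrite (linD (gr_lin n)) !tensDl (linD (gr_lin n)) hg hg'.
rewrite (gtensor_grE n hg (ah0_deg (jH_hom0 D) h)) addn0 (homogE n hg).
by case: ifP; rewrite ?tens0l.
Qed.

(** The map [id ⊗ eps] on horizontal forms, extended by zero to positive degree in [Gamma(H)]. *)
Definition hcounit (i : I) (x : GBH i) : GB i := slice (@counit k H) (hret x).
Lemma hcounit_hinc i (u : tensor (GB i) H) : hcounit (hinc u) = slice (@counit k H) u.
Proof. by rewrite /hcounit hincK. Qed.
Lemma hcounit_lin i : linear (@hcounit i).
Proof. exact: lin_comp (slice_lin (@counit_linear k H)) (@hret_lin i). Qed.
Lemma hcounit_gr n i (x : GBH i) : hcounit (gr n x) = gr n (hcounit x).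
Proof.
have cL := @hcounit_lin i; have gL := @gr_lin _ (GBH i) n; have gL' := @gr_lin _ (GB i) n.
have cE (g : GB i) w : hcounit (g ⊗ w : GBH i) = counit (jH_retract w) *: g.
  rewrite /hcounit /hret (tmap_tens _ _ (@lin_id _ _) jH_retract_lin).
  by rewrite slice_tens //; apply: counit_linear.
have c0 : counit (0 : H) = 0 := lin0 (@counit_linear k H).
move: x; apply: tensor_lin_eq => [||g w].
- exact: lin_comp cL gL.
- exact: lin_comp gL' cL.
move: g w; apply: homog_ind => [w|g g' hg hg' w|m g hg].
- by rewrite tens0l (lin0 gL) (lin0 cL) (lin0 gL').
- by rewrite tensDl (linD gL) !(linD cL) (linD gL') hg hg'.
apply: homog_ind => [|w w' hw hw'|p w hw].
- by rewrite tens0r (lin0 gL) (lin0 cL) (lin0 gL').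
- by rewrite tensDr (linD gL) !(linD cL) (linD gL') hw hw'.
rewrite (gtensor_grE n hg hw) cE (linZ gL') (homogE n hg).
case: p hw => [|p] hw; first by rewrite addn0; case: ifP; rewrite ?cE ?(lin0 cL) ?scaler0.
rewrite (jH_retract_pos hw) c0 scale0r.
by case: ifP; rewrite ?(lin0 cL) // cE (jH_retract_pos hw) c0 scale0r.
Qed.

Lemma coactBH_hinc i (g : GB i) h :
  coactBH (hinc (g ⊗ h)) = tmap (fun h => hinc (g ⊗ h)) id (comul h).
Proof.
have iL : linear (fun h : H => hinc (g ⊗ h)).
  exact: lin_comp (@hinc_lin i) ((tens_bilin _ _).2 g).
rewrite hinc_tens lform_hpart.
rewrite coactBH_tens coactH_alg (tmap_comp _ ((tens_bilin (GB i) GH).2 g) jHL idL idL).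
by congr tmap; apply: funext => x; rewrite /hinc (tmap_tens _ _ (@lin_id _ _) jHL).
Qed.

Variables (T : transitions Q) (E : transition_ext D T).
Local Notation hor := (hor E).
Local Notation qij i j := (@qij _ _ _ _ _ _ D i j).
Local Notation phiG i j := (@phiG _ _ _ _ _ _ D T E i j).

Lemma hchi_lin i : linear (@hchi _ _ _ _ _ _ _ _ E i).
Proof. by []. Qed.
Lemma hchi_inj (x y : hor) : (forall i, hchi i x = hchi i y) -> x = y.
Proof. by move=> h; apply: subm_eq; apply: functional_extensionality_dep. Qed.
Lemma hchi_horizontal i (x : hor) : exists u, hchi i x = hinc u.
Proof. exact: (svalP x).2 i. Qed.
Lemma hchi_glue i j (x : hor) : qij i j (hchi i x) = phiG i j (qij j i (hchi j x)).
Proof. exact: (svalP x).1 i j. Qed.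

Lemma chi0_hor p : exists x : hor, forall i, hchi i x = chi0 D i p.
Proof.
have inh : hor_subspace E (fun i => chi0 D i p).
  split=> [i j|i]; first exact: phiG_q.
  have jBL := ah_lin (jB_hom0 D i).
  exists (tmap (@jB _ _ _ _ _ _ D i) id (chi Q i p)).
  by rewrite (tmap_comp _ (@lin_id _ _) jBL jHL idL).
by exists (exist _ _ inh).
Qed.

(** [chi i] is onto, and elements of [P] are global horizontal forms of degree zero. *)
Lemma hpart_lift i h : exists x : hor, homog_hor 0 x /\ hchi i x = hpart i h.
Proof.
have [p hp] := @chi_surj _ _ _ _ _ Q i ((1 : Bi Q i) ⊗ h); have [x hx] := chi0_hor p.
exists x; split=> [l|]; first by rewrite hx; apply: ah0_deg (chi0_hom0 D l) p.
have jBH := jB_hom0 D i.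
by rewrite hx /chi0 hp (tmap_tens _ _ (ah_lin jBH) jHL) (ah_one jBH).
Qed.

Lemma hinc_lift i u : exists x : hor, hchi i x = hinc u.
Proof.
have iL := @hinc_lin i.
move: u; apply: tensor_ind => [|u v [x hx] [y hy]|g h].
- by exists 0; rewrite (lin0 iL) (lin0 (@hchi_lin i)).
- by exists (x + y); rewrite (linD iL) (linD (@hchi_lin i)) hx hy.
move: g; apply: homog_ind => [|g g' [x hx] [y hy]|n g hg].
- by exists 0; rewrite tens0l (lin0 iL) (lin0 (@hchi_lin i)).
- by exists (x + y); rewrite tensDl (linD iL) (linD (@hchi_lin i)) hx hy.
have [c _ ci] := GcB_surj hg; have [x [_ hx]] := hpart_lift i h.
exists (hor_mull c x); rewrite hinc_tens -ci -hx.
by [].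
Qed.

Lemma horizontal_slice i (f : H -> k^o) u : linear f ->
  horizontal (slice f (coactBH (hinc u)) : GBH i).
Proof.
move=> fL; have sL := slice_lin (U := GBH i) fL.
have cL := lin_comp (ah_lin (coactBH_hom D i)) (@hinc_lin i).
move: u; apply: tensor_ind => [|u v hu hv|g h].
- by rewrite (lin0 cL) (lin0 sL); apply: horizontal0.
- rewrite (linD cL) (linD sL) -[X in X + _]scale1r; exact: horizontalZD.
have iL : linear (fun h : H => hinc (g ⊗ h)).
  exact: lin_comp (@hinc_lin i) ((tens_bilin _ _).2 g).
by rewrite coactBH_hinc (slice_tmap _ iL fL); exists (g ⊗ slice f (comul h)).
Qed.

(** [phiG] is colinear, so slices of the local coactions still agree on the overlaps. *)
Lemma slice_hor (f : H -> k^o) (x : hor) : linear f ->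
  hor_subspace E (fun i => slice f (coactBH (hchi i x))).
Proof.
move=> fL; split=> [i j|i]; last first.
  by have [u ->] := hchi_horizontal i x; apply: horizontal_slice.
have qL i0 j0 : linear (qij i0 j0) by exact: ah_lin (dproj_hom (Nij D i0 j0)).
have fiL := ah_lin (phiG_hom E i j).
rewrite -(slice_tmap _ (qL i j) fL) -[tmap _ _ _]coactG_q hchi_glue coactG_phi.
by rewrite (slice_tmap _ fiL fL) coactG_q (slice_tmap _ (qL j i) fL).
Qed.

(** As [hor_coact] is chosen by [xget], a tensor with the required components must be exhibited. In
    a resolution common to all charts the slices glue to elements of [hor], which serve as first
    legs. *)
Lemma hor_coactE (x : hor) i : tmap (hchi i) id (hor_coact x) = coactBH (hchi i x).
Proof.
suff h : exists t : tensor hor H, forall i,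
    tassoc (tmap (hchi i) id t) = tmap id (@coactH _ _ _ _ _ _ D) (hchi i x).
  have := @xgetPex _ 0 (fun t : tensor hor H => forall i,
    tassoc (tmap (hchi i) id t) = tmap id (@coactH _ _ _ _ _ _ D) (hchi i x)) h i.
  by rewrite -/(hor_coact x) => e; rewrite /coactBH /gcoact -e tassocK.
have [r tE] := tensor_resolution (fun i => coactBH (hchi i x)).
pose y (p : H * {f : H -> k^o | linear f}) : hor := exist _ _ (slice_hor x (svalP p.2)).
exists (\sum_(p <- r) y p ⊗ p.1) => l.
rewrite (lin_sum (tmap_lin (@hchi_lin l) idL)).
under eq_bigr => p _ do rewrite (tmap_tens _ _ (@hchi_lin l) idL).
by rewrite -[X in tassoc X](tE l) tassocVK.
Qed.

(** Every slice of [s - t] has zero components, hence is zero. Covariance can therefore be tested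
    chart by chart. *)
Lemma hor_tensor_eq (s t : tensor hor H) :
  (forall i, tmap (hchi i) id s = tmap (hchi i) id t) -> s = t.
Proof.
move=> h; apply/eqP; rewrite -subr_eq0; apply/eqP.
have [r /(_ tt) e] := @tensor_resolution _ unit (fun _ => hor) H (fun _ => s - t).
rewrite {}e big1 // => p _.
have fL := svalP p.2.
rewrite (_ : slice _ _ = 0) ?tens0l //; apply: hchi_inj => i.
rewrite -(slice_tmap _ (@hchi_lin i) fL) (linB (tmap_lin (@hchi_lin i) idL)) h subrr.
by rewrite (lin0 (slice_lin fL)).
Qed.
End Horizontal.

(** * Local form of a covariant derivative *)

Section LocalFormula.
Variables (k : fieldType) (H : hopf k) (P B : ualgType k) (I : finType).
Variables (Q : qpfb H P B I) (D : diff_structure Q).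
Local Notation GB := (GB D).
Local Notation jH := (jH D).
Local Notation GBH := (GBH D).
Local Notation lform := (@lform _ _ _ _ _ _ D _).
Local Notation hpart := (@hpart _ _ _ _ _ _ D).
Local Notation hinc := (@hinc _ _ _ _ _ _ D _).
Local Notation hcounit := (@hcounit _ _ _ _ _ _ D _).
Let idL := @lin_id k H.
Let lfH i := lform_hom D i.
Let lfL i := ah_lin (lfH i).

Variables (b : bool) (i : I) (A : H -> GB i).
Hypothesis AL : linear A.

Definition lforms (h : H) : GBH i := lform (A h).
Definition omega : H -> GBH i := conv lforms (hpart i).
Lemma lforms_lin : linear lforms.
Proof. exact: lin_comp (@lfL i) AL. Qed.
Lemma omegaE h : omega h = hinc (tmap A id (comul h)).
Proof.
rewrite /omega /conv /tmap (tsum_linear _ _ (@hinc_lin _ _ _ _ _ _ D i)).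
by apply: eq_tsum => u v; rewrite hinc_tens.
Qed.
Lemma omega_tsum h : omega h = tsum (fun h1 h2 => A h1 ⊗ jH h2) (comul h).
Proof. by apply: eq_tsum => u v; rewrite lform_hpart. Qed.
Lemma hcounit_omega h : hcounit (omega h) = A h.
Proof.
rewrite omegaE hcounit_hinc (slice_tmap _ AL (@counit_linear k H)).
by congr A; apply: comul_counitr.
Qed.

(* [g (x) h |-> dg (x) h - (-1)^n sum g A(h_1) (x) h_2] in the left case and
   [g (x) h |-> dg (x) h - sum A(h_1) g (x) h_2] in the right case. *)
Definition dloc (u : tensor (GB i) H) : GBH i :=
  tsum (fun g h => local_term (hpart i) b lforms (lform g) h) u.

Let term_bilin : bilin (fun g h => local_term (hpart i) b lforms (lform g) h).
Proof.
exact (bilin_comp (local_term_bilin (hpart_hom D i) b lforms_lin) (@lfL i) idL).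
Qed.
Lemma dloc_lin : linear dloc.
Proof. exact: tsum_lin term_bilin. Qed.
Lemma dloc_tens g h : dloc (g ⊗ h) = local_term (hpart i) b lforms (lform g) h.
Proof. exact: tsum_tens term_bilin. Qed.
Lemma dloc_termE g h :
  dloc (g ⊗ h) = lform (dif g) * hpart i h - sided b (lform g) (omega h).
Proof. by rewrite dloc_tens /local_term -(dh_dif (@lfH i)). Qed.
Lemma dloc1 h : dloc ((1 : GB i) ⊗ h) = - omega h.
Proof.
rewrite dloc_termE dif_one (lin0 (@lfL i)) mul0r add0r (ah_one (@lfH i)) /sided.
by case: b; rewrite ?mulr1 // (sgn_homog (gr_one (GBH i))) expr0 scale1r mul1r.
Qed.

Lemma sided_lform_hinc g (u : tensor (GB i) H) :
  exists v, sided b (lform g) (hinc u) = hinc v.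
Proof.
have mulE g' : exists v, lform g' * hinc u = hinc v.
  by apply: horizontalMl; exists u.
have mulE' g' : exists v, hinc u * lform g' = hinc v.
  by apply: horizontalMr; exists u.
by rewrite /sided; case: b => //; rewrite -(dga_hom_sgn _ (@lfH i)).
Qed.
Lemma dloc_horizontal u : horizontal (dloc u).
Proof.
move: u; apply: tensor_ind => [|u v hu hv|g h].
- by rewrite (lin0 dloc_lin); apply: horizontal0.
- by rewrite (linD dloc_lin) -[X in X + _]scale1r; exact: horizontalZD.
rewrite dloc_termE -hinc_tens omegaE; have [v ->] := sided_lform_hinc g (tmap A id (comul h)).
exists (dif g ⊗ h - v); exact: (esym (linB (@hinc_lin _ _ _ _ _ _ D i) _ _)).
Qed.

Lemma coactBH_dloc g h :
  coactBH (dloc (g ⊗ h)) = tmap (fun h => dloc (g ⊗ h)) id (comul h).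
Proof.
rewrite dloc_tens.
rewrite (rho_local_term (coactBH_hom D i) (hpart_hom D i) (@coactBH_hpart _ _ _ _ _ _ D i)
  b lforms_lin).
- by congr tmap; apply: funext => u; rewrite dloc_tens.
- by move=> u; apply: coactBH_lform.
- exact: coactBH_lform.
- by rewrite -(dga_hom_sgn _ (@lfH i)); apply: coactBH_lform.
- by rewrite -(dh_dif (@lfH i)); apply: coactBH_lform.
Qed.

Hypothesis A1 : forall h, homog 1 (A h).

Lemma hpart_homog h : homog 0 (hpart i h).
Proof. by rewrite /homog -hinc1 gr_hinc tmap_tens ?(gr_one (GB i)) //; apply: gr_lin. Qed.
Lemma lform_homog n (g : GB i) : homog n g -> homog n (lform g).
Proof. by move=> hg; rewrite /homog -(dh_gr (@lfH i)) hg. Qed.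
Lemma omega_homog h : homog 1 (omega h).
Proof.
rewrite /homog omegaE gr_hinc (tmap_comp _ (gr_lin 1) AL idL idL); congr (hinc (tsum _ _)).
by apply: funext => u; apply: funext => v; rewrite A1.
Qed.
Lemma dloc_homog n g h : homog n g -> homog n.+1 (dloc (g ⊗ h)).
Proof.
move=> hg; rewrite dloc_termE /homog (linB (gr_lin _)); congr (_ - _).
  rewrite -[n.+1]addn0; apply: gr_mul; last exact: hpart_homog.
  by apply: lform_homog; apply: dif_homog.
have lg := lform_homog hg.
rewrite /sided; case: b; last by rewrite -add1n; apply: gr_mul => //; apply: omega_homog.
rewrite (sgn_homog lg) -uscalerAl (linZ (gr_lin _)) -addn1 gr_mul //.
exact: omega_homog.
Qed.
Lemma gr_dloc n u : gr n.+1 (dloc u) = dloc (tmap (gr n) id u).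
Proof.
have tL := tmap_lin (@gr_lin _ (GB i) n) idL.
move: u; apply: tensor_lin_eq => [||g h].
- exact: lin_comp (gr_lin _) dloc_lin.
- exact: lin_comp dloc_lin tL.
rewrite (tmap_tens _ _ (@gr_lin _ (GB i) n) idL).
move: g; apply: homog_ind => [|g g' hg hg'|m g hg].
- by rewrite (lin0 (gr_lin _)) tens0l (lin0 dloc_lin) (lin0 (gr_lin _)).
- by rewrite (linD (gr_lin n)) !tensDl !(linD dloc_lin) (linD (gr_lin _)) hg hg'.
rewrite (homogE n hg) (homogE _ (dloc_homog h hg)) eqSS.
by case: ifP; rewrite ?tens0l ?(lin0 dloc_lin).
Qed.

Lemma dloc_mull n (g : GB i) (u : tensor (GB i) H) : b -> homog n g ->
  dloc (tmap (fun w : GB i => g * w) id u) =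
  dif (lform g) * hinc u + (-1) ^+ n *: (lform g * dloc u).
Proof.
move=> bT hg; have gL := (umul_bilin (GB i)).2 g.
have mL x := (umul_bilin (GBH i)).2 x; have hL := @hinc_lin _ _ _ _ _ _ D i.
move: u; apply: tensor_lin_eq => [||w h].
- exact: lin_comp dloc_lin (tmap_lin gL idL).
- move=> c x y; rewrite hL dloc_lin !mL !scalerDr addrACA; congr (_ + _ + _).
  by rewrite !scalerA mulrC.
rewrite (tmap_tens _ _ gL idL) !dloc_termE hinc_tens -(dh_dif (@lfH i)).
rewrite (dif_mul _ hg) (linD (@lfL i)) (linZ (@lfL i)) !(ah_mul (@lfH i)).
rewrite /sided bT sgn_mul (sgn_homog (lform_homog hg)) mulrDl mulrBr scalerBr addrA.
by rewrite -!uscalerAl -!mulrA.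
Qed.

(** Here the sign depends on the degree of [u]; writing it with [sgn] keeps both sides linear in
    [u], so generators suffice. *)
Lemma dloc_mulr (g : GB i) (u : tensor (GB i) H) : ~~ b ->
  dloc (tmap (fun w : GB i => w * g) id u) =
  dloc u * lform g + sgn (hinc u) * dif (lform g).
Proof.
move=> /negbTE bF; have gL := (umul_bilin (GB i)).1 g.
have hL := @hinc_lin _ _ _ _ _ _ D i.
have sL := @sgn_lin _ (GBH i).
move: u; apply: tensor_lin_eq => [||w h].
- exact: lin_comp dloc_lin (tmap_lin gL idL).
- by move=> c x y; rewrite hL dloc_lin sL !mulrDl -!uscalerAl scalerDr addrACA.
rewrite (tmap_tens _ _ gL idL) !dloc_termE hinc_tens -(dh_dif (@lfH i)).
rewrite dif_mulE (linD (@lfL i)) !(ah_mul (@lfH i)) (dga_hom_sgn _ (@lfH i)).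
rewrite /sided bF sgn_mul (sgn_homog (hpart_homog h)) expr0 scale1r.
rewrite mulrDl mulrBl -!mulrA !(lform_hpartC _ h) !mulrA addrAC.
by rewrite ?mulrA.
Qed.
End LocalFormula.

Lemma sval_inj (T : Type) (P : T -> Prop) (x y : {z | P z}) : sval x = sval y -> x = y.
Proof. by case: x y => x hx [y hy] /= e; apply: eq_exist. Qed.

(** * The correspondence *)

Section Correspondence.
Variables (k : fieldType) (H : hopf k) (P B : ualgType k) (I : finType).
Variables (Q : qpfb H P B I) (D : diff_structure Q).
Variables (T : transitions Q) (E : transition_ext D T).
Local Notation GB := (GB D).
Local Notation GBH := (GBH D).
Local Notation lform := (@lform _ _ _ _ _ _ D _).
Local Notation hpart := (@hpart _ _ _ _ _ _ D).
Local Notation hinc := (@hinc _ _ _ _ _ _ D _).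
Local Notation hret := (@hret _ _ _ _ _ _ D _).
Local Notation hcounit := (@hcounit _ _ _ _ _ _ D _).
Local Notation hor := (hor E).
Local Notation qij i j := (@qij _ _ _ _ _ _ D i j).
Local Notation phiG i j := (@phiG _ _ _ _ _ _ D T E i j).
Local Notation base i j := (@base _ _ _ _ _ _ D i j).
Local Notation eta i j := (@eta _ _ _ _ _ _ D i j).
Local Notation tau := (tau D T).
Let idL := @lin_id k H.
Let lfH i := lform_hom D i.
Let hincL i := @hinc_lin _ _ _ _ _ _ D i.
Let qH i j : dga_hom (qij i j). Proof. exact: dproj_hom. Qed.

Definition covariant_derivative (b : bool) (N : hor -> hor) : Prop :=
  if b then left_covariant_derivative N else right_covariant_derivative N.

(** * Comparison of two charts on their overlap *)

Section Overlap.
Variables (b : bool) (A : forall i, H -> GB i).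
Hypothesis AL : forall i, linear (A i).
Variables i j : I.

Let a h : Gij D i j := base i j (A i h).
Let aL : linear a. Proof. exact: lin_comp (ah_lin (base_hom D i j)) (AL i). Qed.
Let a' h : Gij D i j := phiG i j (base j i (A j h)).
Let aL' : linear a'.
Proof.
exact: lin_comp (ah_lin (phiG_hom E i j)) (lin_comp (ah_lin (base_hom D j i)) (AL j)).
Qed.

Lemma qij_sided X Y : qij i j (sided b X Y) = sided b (qij i j X) (qij i j Y).
Proof.
by rewrite /sided; case: b; rewrite (ah_mul (qH i j)) // (dga_hom_sgn _ (qH i j)).
Qed.
Lemma qij_omega h : qij i j (omega (A i) h) = conv a (eta i j) h.
Proof. exact: conv_hom (qH i j). Qed.

Definition overlap_derivative : Gij D i j -> Gij D i j :=
  local_derivative (@coactG _ _ _ _ _ _ D i j) (eta i j) b a.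

Let rhoH := coactG_hom D i j.
Let etaH := eta_hom D i j.
Let rho_eta := @coactG_eta _ _ _ _ _ _ D i j.

(** The right side depends only on the class of [hinc u]: this is the descent of the local formula
    to the overlap. *)
Lemma qij_dloc u : qij i j (dloc b (A i) u) = overlap_derivative (qij i j (hinc u)).
Proof.
have qL := ah_lin (qH i j).
have dL : linear overlap_derivative := local_derivative_lin rhoH etaH b aL.
move: u; apply: tensor_lin_eq => [||g h].
- exact: lin_comp qL (dloc_lin b (AL i)).
- exact: lin_comp dL (lin_comp qL (@hincL i)).
rewrite dloc_termE // hinc_tens (linB qL) qij_sided !(ah_mul (qH i j)) qij_omega.
rewrite /overlap_derivative (local_derivativeM rhoH etaH rho_eta b aL); last first.
  exact: coactG_base.
by rewrite /local_term -(dh_dif (base_hom D i j)).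
Qed.

Let t := tau i j.
Let tL := tau_lin D T i j.
Let rho_t h : coactG (t h) = t h ⊗ (1 : H).
Proof. by rewrite /t; have [g ->] := tau_base D T i j h; apply: coactG_base. Qed.
Let t_eta h g : t h * eta i j g = eta i j g * t h.
Proof. by rewrite /t; have [x ->] := tau_base D T i j h; apply: base_etaC. Qed.
Let t_a h g : t h * a g = a g * t h.
Proof. by rewrite [RHS](tau_baseC E). Qed.

(** The case [X = 1], free of any gluing hypothesis: comparing this value with the one from chart
    [j] yields the transformation law. *)
Lemma overlap_derivative1 h :
  overlap_derivative (conv t (eta i j) h) =
  conv (fun g => dif (t g)) (eta i j) h - conv t (conv a (eta i j)) h.
Proof.
have hX : coactG (1 : Gij D i j) = (1 : Gij D i j) ⊗ (1 : H) by rewrite (ah_one rhoH).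
rewrite -[conv t _ h]mul1r /overlap_derivative.
rewrite (local_derivative_twisted rhoH etaH rho_eta b aL (tau_homog D T i j)
  rho_t t_eta t_a) => [||g]; [|exact: hX|by rewrite mulr1 mul1r].
rewrite dif_one mul0r add0r (sgn_homog (gr_one (Gij D i j))) expr0 scale1r mul1r /sided.
by case: b; rewrite ?mulr1 // (sgn_homog (gr_one (Gij D i j))) expr0 scale1r mul1r.
Qed.

Hypothesis glue : forall h, conv t a h = dif (t h) + conv a' t h.

(** With a global lift [c] of [g], the class of [g ⊗ h] becomes the base form of [c] times
    [conv t eta] at [h]. This is the product treated by [local_derivative_glued], whose value is the
    image of the formula of chart [j]. *)
Lemma phiG_dloc u :
  overlap_derivative (phiG i j (qij j i (hinc u))) = phiG i j (qij j i (dloc b (A j) u)).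
Proof.
have fH := phiG_hom E i j; have fL := ah_lin fH; have qL := ah_lin (qH j i).
have dL : linear overlap_derivative := local_derivative_lin rhoH etaH b aL.
move: u; apply: tensor_lin_eq => [||g h].
- exact: lin_comp dL (lin_comp fL (lin_comp qL (@hincL j))).
- exact: lin_comp fL (lin_comp qL (dloc_lin b (AL j))).
move: g; apply: homog_ind => [|g g' hg hg'|n g hg].
- rewrite tens0l (lin0 (@hincL j)) (lin0 (dloc_lin b (AL j))) !(lin0 qL) !(lin0 fL).
  exact: lin0 dL.
- rewrite tensDl (linD (@hincL j)) (linD (dloc_lin b (AL j))) !(linD qL) !(linD fL).
  by rewrite (linD dL) hg hg'.
have [c _ cj] := GcB_surj hg; have cE := base_glue E i j c; rewrite cj in cE.
rewrite hinc_tens (ah_mul (qH j i)) (ah_mul fH) (phiG_eta E) -[qij j i (lform g)]/(base j i g).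
rewrite -cE /overlap_derivative.
rewrite (local_derivative_glued rhoH etaH rho_eta b aL tL (tau_homog D T i j)
  rho_t t_eta t_a aL' glue); first last.
- by move=> x; apply: (dtau_base E).
- by move=> x; apply: base_etaC.
- by move=> x; apply: (tau_baseC E).
- exact: coactG_base.
rewrite dloc_termE // (linB qL) (linB fL) (ah_mul (qH j i)) (ah_mul fH) (phiG_eta E).
congr (_ * _ - _); first by rewrite (dh_dif (@lfH j)) (dh_dif (qH j i)) (dh_dif fH) cE.
have -> : phiG i j (qij j i (sided b (lform g) (omega (A j) h))) =
    sided b (base i j (sval c i)) (phiG i j (qij j i (omega (A j) h))).
  rewrite cE /sided; case: b; rewrite (ah_mul (qH j i)) (ah_mul fH) //.
  by rewrite (dga_hom_sgn _ (qH j i)) (dga_hom_sgn _ fH).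
congr sided; rewrite (conv_hom _ _ _ (qH j i)) (conv_hom _ _ _ fH).
by apply: eq_tsum => u v; rewrite -(phiG_eta E).
Qed.
End Overlap.

Lemma covariant_derivative_covariant b (N : hor -> hor) :
  covariant_derivative b N -> covariant N.
Proof. by case: b => -[]. Qed.

Lemma local_formsE (N : hor -> hor) (A : forall i, H -> GB i) : local_forms N A <->
  forall i h (x : hor), hchi i x = hpart i h -> hchi i (N x) = - omega (A i) h.
Proof. by split=> h i g x /h ->; rewrite omega_tsum. Qed.

(** [cov_ker] applied to the difference. It allows any lift to be used when computing in one
    chart. *)
Lemma covariant_local (N : hor -> hor) i (x y : hor) : covariant N ->
  hchi i x = hchi i y -> hchi i (N x) = hchi i (N y).
Proof.
move=> Nc /eqP; rewrite -subr_eq0 -(linB (@hchi_lin _ _ _ _ _ _ _ _ E i)) => /eqP.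
move/(cov_ker Nc); rewrite (linB (cov_lin Nc)) (linB (@hchi_lin _ _ _ _ _ _ _ _ E i)).
by move/eqP; rewrite subr_eq0 => /eqP.
Qed.

(** By linearity and locality one lift for each [g ⊗ h] is enough: a global form times a lift of
    [1 ⊗ h], to which the Leibniz rule applies. *)
Lemma derivative_dloc b (N : hor -> hor) (A : forall i, H -> GB i) :
  (forall i, linear (A i)) -> covariant_derivative b N -> local_forms N A ->
  forall i u (x : hor), hchi i x = hinc u -> hchi i (N x) = dloc b (A i) u.
Proof.
move=> AL Nd /local_formsE NA i u x xu.
have Nc := covariant_derivative_covariant Nd; have NL := cov_lin Nc.
have chL := @hchi_lin _ _ _ _ _ _ _ _ E i; have dL := dloc_lin b (AL i).
suff [y [yu <-]] : exists y : hor, hchi i y = hinc u /\ hchi i (N y) = dloc b (A i) u.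
  by apply: covariant_local => //; rewrite yu.
move: u {xu}; apply: tensor_ind => [|u v [x1 [xu Nx]] [y [yv Ny]]|g h].
- by exists 0; rewrite (lin0 NL) (lin0 chL) (lin0 (@hincL i)) (lin0 dL).
- by exists (x1 + y); rewrite (linD NL) !(linD chL) (linD (@hincL i)) (linD dL) xu yv Nx Ny.
move: g; apply: homog_ind => [|g g' [x1 [xu Nx]] [y [yv Ny]]|n g hg].
- by exists 0; rewrite tens0l (lin0 NL) (lin0 chL) (lin0 (@hincL i)) (lin0 dL).
- exists (x1 + y); rewrite tensDl.
  by rewrite (linD NL) !(linD chL) (linD (@hincL i)) (linD dL) xu yv Nx Ny.
have [c hc cg] := GcB_surj hg; have [y [y0 yh]] := hpart_lift E i h.
have lg := lform_homog hg; have gE : iotaG c i = lform g by rewrite -cg.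
rewrite dloc_termE // (dh_dif (@lfH i)).
case: b Nd {dL} => Nd.
- exists (hor_mull c y); split; first by rewrite hinc_tens -gE -yh.
  rewrite (Nd.2 n c y hc i) gE yh (NA i h y yh) /sided (sgn_homog lg).
  by rewrite mulrN scalerN uscalerAl.
(* The lift [y] has degree zero, so the right Leibniz rule carries no sign. *)
- exists (hor_mulr y c); split; first by rewrite hinc_tens lform_hpartC -gE -yh.
  rewrite (Nd.2 0%N y c y0 i) gE yh (NA i h y yh) /sided expr0 scale1r mulNr addrC.
  by rewrite -(dh_dif (@lfH i)) lform_hpartC.
Qed.

(** Lifts of [1 ⊗ h] exist, so [local_forms] is not vacuous: it prescribes [omega], from which the
    counit recovers the forms. *)
Lemma local_forms_inj (N : hor -> hor) (A A' : forall i, H -> GB i) :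
  (forall i, linear (A i)) -> (forall i, linear (A' i)) ->
  local_forms N A -> local_forms N A' -> A = A'.
Proof.
move=> AL AL' /local_formsE NA /local_formsE NA'; apply: functional_extensionality_dep => i.
apply: funext => h; have [y [_ yh]] := hpart_lift E i h.
rewrite -(hcounit_omega (AL i)) -(hcounit_omega (AL' i)); congr hcounit.
by apply: oppr_inj; rewrite -(NA i h y yh) -(NA' i h y yh).
Qed.

Lemma derivative_inj b (N N' : hor -> hor) (A : forall i, H -> GB i) :
  (forall i, linear (A i)) -> covariant_derivative b N -> covariant_derivative b N' ->
  local_forms N A -> local_forms N' A -> N = N'.
Proof.
move=> AL Nd Nd' NA NA'; apply: funext => x; apply: hchi_inj => i.
have [u xu] := hchi_horizontal i x.
by rewrite (derivative_dloc AL Nd NA xu) (derivative_dloc AL Nd' NA' xu).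
Qed.

(** * From a derivative to its forms *)

Section FormsOfDerivative.
Variables (b : bool) (N : hor -> hor).
Hypothesis Nd : covariant_derivative b N.
Let Nc := covariant_derivative_covariant Nd.
Let NL := cov_lin Nc.
Let chL i := @hchi_lin _ _ _ _ _ _ _ _ E i.

Let lift i (u : tensor (GB i) H) : hor := projT1 (cid (hinc_lift E u)).
Let liftE i (u : tensor (GB i) H) : hchi i (lift u) = hinc u.
Proof. by rewrite /lift; case: cid. Qed.

Let F i (u : tensor (GB i) H) : GB i := hcounit (hchi i (N (lift u))).
Let FE i (x : hor) u : hchi i x = hinc u -> hcounit (hchi i (N x)) = F u.
Proof. by move=> xu; congr hcounit; apply: covariant_local; rewrite ?liftE. Qed.
Let FL i : linear (@F i).
Proof.
move=> a u v; rewrite -(@hcounit_lin _ _ _ _ _ _ D i) -chL -NL; symmetry; apply: FE.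
by rewrite chL !liftE (@hincL i).
Qed.

Definition derivative_forms i (h : H) : GB i := - F ((1 : GB i) ⊗ h).
Lemma derivative_forms_lin i : linear (@derivative_forms i).
Proof.
move=> a g h; rewrite /derivative_forms ((tens_bilin _ _).2 _) FL opprD.
by rewrite scalerN.
Qed.

Lemma derivative_formsP : local_forms N (@derivative_forms).
Proof.
apply/local_formsE => i h x xh.
have [s Xs] := hchi_horizontal i (N x).
have cL := @hcounit_lin _ _ _ _ _ _ D i.
have hpL := ah_lin (hpart_hom D i).
have FrL : linear (fun z : GBH i => F (hret z)).
  exact: lin_comp (@FL i) (@hret_lin _ _ _ _ _ _ D i).
(* The counit undoes the coaction: [g ⊗ h_1 ⊗ h_2] returns to [g ⊗ h]. *)
have e1 : tmap hcounit id (coactBH (hinc s)) = s.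
  have L1 := lin_comp (tmap_lin cL idL) (lin_comp (ah_lin (coactBH_hom D i)) (@hincL i)).
  move: (s); apply: tensor_lin_eq => [||g g']; [exact: L1|exact: lin_id|].
  have gL : linear (fun h : H => hinc (g ⊗ h)).
    exact: lin_comp (@hincL i) ((tens_bilin _ _).2 g).
  rewrite coactBH_hinc (tmap_comp _ cL gL idL idL) -{2}(comul_counitl g').
  rewrite (tsum_linear _ _ ((tens_bilin _ _).2 g)); apply: eq_tsum => u v.
  rewrite hcounit_hinc slice_tens ?tensZl ?tensZr //; exact: counit_linear.
(* Covariance moves the coaction inside [N], where only the elements [1 ⊗ h_1] remain; the counit of
   their images gives the forms. *)
have e2 : s = tmap (fun g => - derivative_forms i g) id (comul h).
  rewrite -e1 -Xs -hor_coactE -(cov_coact Nc) (tmap_comp _ (@chL i) NL idL idL).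
  rewrite (tmap_comp _ cL (lin_comp (@chL i) NL) idL idL).
  have -> : (fun y => hcounit (hchi i (N y))) = (fun y => F (hret (hchi i y))).
    apply: funext => y; have [u yu] := hchi_horizontal i y.
    by rewrite (FE yu) yu hincK.
  rewrite -(tmap_comp _ FrL (@chL i) idL idL) hor_coactE xh coactBH_hpart.
  rewrite (tmap_comp _ FrL hpL idL idL); congr tmap; apply: funext => g.
  by rewrite /derivative_forms opprK -hinc1 hincK.
rewrite Xs e2 omegaE -(linN (@hincL i)); congr hinc.
rewrite /tmap /tsum /psum -sumrN; apply: eq_bigr => p _.
by rewrite -(linN ((tens_bilin _ _).1 _)).
Qed.

Lemma derivative_forms_connection : connection_forms T (@derivative_forms).
Proof.
have AL := derivative_forms_lin; have NA := derivative_formsP.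
have /local_formsE NA' := NA.
split=> //.
- move=> i h; have [y [y0 yh]] := hpart_lift E i h.
  have yu : hchi i y = hinc ((1 : GB i) ⊗ h) by rewrite hinc1.
  rewrite /derivative_forms -(FE yu) /homog (linN (gr_lin 1)) -hcounit_gr.
  by rewrite (cov_deg Nc y0).
- move=> i; have yu : hchi i (hor_one E) = hinc ((1 : GB i) ⊗ (1 : H)).
    by rewrite hinc1 (ah_one (hpart_hom D i)).
  rewrite /derivative_forms -(FE yu) (cov_one Nc) (lin0 (@chL i)).
  by rewrite (lin0 (@hcounit_lin _ _ _ _ _ _ D i)) oppr0.
move=> i j; apply/(glue_conv E AL i j).
have tL := tau_lin D T i j; have etaL := ah_lin (eta_hom D i j).
pose a h := base i j (derivative_forms i h).
pose a' h := phiG i j (base j i (derivative_forms j h)).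
have aL : linear a := lin_comp (ah_lin (base_hom D i j)) (AL i).
have aL' : linear a'.
  exact: lin_comp (ah_lin (phiG_hom E i j)) (lin_comp (ah_lin (base_hom D j i)) (AL j)).
have dtL : linear (fun h => dif (tau i j h)) := lin_comp (@dif_lin _ _) tL.
have aL'' := conv_lin aL' tL.
suff e : conv (tau i j) a = fun h => dif (tau i j h) + conv a' (tau i j) h.
  by move=> h; rewrite -[LHS]/(conv (tau i j) a h) e.
apply: (@conv_eta_inj _ _ _ _ _ _ D i j); first exact: conv_lin.
  by move=> c x y; rewrite dtL aL'' scalerDr addrACA.
apply: funext => h; rewrite convDl -!convA //.
(* A single global [y] equal to [1 ⊗ h] in chart [j]; gluing of [N y] compares the two local
   formulas, the class of [y] seen from chart [i] being [conv tau eta] at [h]. *)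
have [y [_ yh]] := hpart_lift E j h; have [u yu] := hchi_horizontal i y.
have := hchi_glue i j (N y); rewrite (derivative_dloc AL Nd NA yu) (NA' j h y yh).
rewrite (qij_dloc b AL j) -yu hchi_glue yh [qij j i _]/(eta j i h) phiG_eta.
rewrite (overlap_derivative1 b AL) (linN (ah_lin (qH j i))) (linN (ah_lin (phiG_hom E i j))).
rewrite (qij_omega _ j) (conv_hom _ _ _ (phiG_hom E i j)).
have -> : (fun h => phiG i j (eta j i h)) = conv (tau i j) (eta i j).
  by apply: funext => g; rewrite phiG_eta.
by move/eqP; rewrite subr_eq => /eqP ->; rewrite addrAC addNr add0r.
Qed.
End FormsOfDerivative.

(** * From forms to a derivative *)

Section DerivativeOfForms.
Variables (b : bool) (A : forall i, H -> GB i).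
Hypothesis Ac : connection_forms T A.
Let AL := cf_lin Ac.
Let A1 := cf_deg Ac.
Let dL i : linear (dloc b (A i)) := dloc_lin b (AL i).
Let chL i := @hchi_lin _ _ _ _ _ _ _ _ E i.

Let hretE i (x : hor) : hinc (hret (hchi i x)) = hchi i x.
Proof. by have [u ->] := hchi_horizontal i x; rewrite hincK. Qed.

(** The transformation law enters here: [qij_dloc] in chart [i] and [phiG_dloc] from chart [j] give
    the same overlap derivative. *)
Lemma forms_derivative_hor (x : hor) :
  hor_subspace E (fun i => dloc b (A i) (hret (hchi i x))).
Proof.
split=> [i j|i]; last exact: dloc_horizontal.
have glue := proj1 (glue_conv E AL i j) (cf_glue Ac i j).
rewrite (qij_dloc b AL j) hretE hchi_glue -{1}(hretE j x).
exact: phiG_dloc.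
Qed.
Definition forms_derivative (x : hor) : hor := exist _ _ (forms_derivative_hor x).

Lemma hchi_derivative i x : hchi i (forms_derivative x) = dloc b (A i) (hret (hchi i x)).
Proof. by []. Qed.
Lemma hchi_derivative_hinc i x u :
  hchi i x = hinc u -> hchi i (forms_derivative x) = dloc b (A i) u.
Proof. by rewrite hchi_derivative => ->; rewrite hincK. Qed.

Lemma forms_derivative_lin : linear forms_derivative.
Proof.
move=> a x y; apply: hchi_inj => i.
by rewrite chL !hchi_derivative chL (@hret_lin _ _ _ _ _ _ D i) dL.
Qed.

Lemma forms_derivative_local : local_forms forms_derivative A.
Proof.
apply/local_formsE => i h x xh.
by rewrite (@hchi_derivative_hinc _ _ ((1 : GB i) ⊗ h)) ?hinc1 // dloc1.
Qed.

Lemma forms_derivative_covariant : covariant forms_derivative.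
Proof.
split.
- exact: forms_derivative_lin.
- move=> n x hx i; have [u xu] := hchi_horizontal i x.
  have := hx i; rewrite xu /homog gr_hinc => /(congr1 hret); rewrite !hincK => ue.
  by rewrite (hchi_derivative_hinc xu) gr_dloc // ue.
- apply: hchi_inj => i.
  have x1 : hchi i (hor_one E) = hpart i 1 by rewrite (ah_one (hpart_hom D i)).
  have /local_formsE/(_ _ _ _ x1) -> := forms_derivative_local.
  rewrite omegaE // (ah_one (comul_hom H)) -tens_one (tmap_tens _ _ (AL i) idL).
  by rewrite (cf_one Ac) tens0l (lin0 (@hincL i)) oppr0.
- move=> x; apply: hor_tensor_eq => i.
  have rL := @hret_lin _ _ _ _ _ _ D i.
  have [u xu] := hchi_horizontal i x.
  rewrite (tmap_comp _ (@chL i) forms_derivative_lin idL idL).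
  rewrite -[LHS](tmap_comp _ (@dL i) (lin_comp rL (@chL i)) idL idL).
  rewrite -(tmap_comp _ rL (@chL i) idL idL) !hor_coactE (hchi_derivative_hinc xu) xu.
  have cL := ah_lin (coactBH_hom D i).
  have L1 := lin_comp (tmap_lin (@dL i) idL)
    (lin_comp (tmap_lin rL idL) (lin_comp cL (@hincL i))).
  move: (u); apply: tensor_lin_eq => [||g h]; [exact: L1|exact: lin_comp cL (@dL i)|].
  have gL : linear (fun h : H => hinc (g ⊗ h)).
    exact: lin_comp (@hincL i) ((tens_bilin _ _).2 g).
  rewrite coactBH_hinc coactBH_dloc // (tmap_comp _ rL gL idL idL).
  rewrite (tmap_comp _ (@dL i) (lin_comp rL gL) idL idL).
  by congr tmap; apply: funext => g'; rewrite hincK.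
- move=> i x x0; rewrite hchi_derivative x0 (lin0 (@hret_lin _ _ _ _ _ _ D i)).
  exact: lin0 (@dL i).
Qed.

Lemma forms_derivativeP : covariant_derivative b forms_derivative.
Proof.
rewrite /covariant_derivative; case bE: b; split; try exact: forms_derivative_covariant.
- move=> n g x hg i; have [u xu] := hchi_horizontal i x.
  have gL := (umul_bilin (GB i)).2 (sval g i).
  have e : hchi i (hor_mull g x) = hinc (tmap (fun w : GB i => sval g i * w) id u).
    rewrite -[LHS]/(lform (sval g i) * hchi i x) xu.
    have L1 := lin_comp ((umul_bilin (GBH i)).2 (lform (sval g i))) (@hincL i).
    have L2 := lin_comp (@hincL i) (tmap_lin gL idL).
    move: (u); apply: tensor_lin_eq => [||w h]; [exact: L1|exact: L2|].
    by rewrite (tmap_tens _ _ gL idL) !hinc_tens (ah_mul (@lfH i)) mulrA.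
  rewrite (hchi_derivative_hinc e) (hchi_derivative_hinc xu) xu.
  exact: dloc_mull.
- move=> n x g hx i; have [u xu] := hchi_horizontal i x.
  have gL := (umul_bilin (GB i)).1 (sval g i).
  have e : hchi i (hor_mulr x g) = hinc (tmap (fun w : GB i => w * sval g i) id u).
    rewrite -[LHS]/(hchi i x * lform (sval g i)) xu.
    have L1 := lin_comp ((umul_bilin (GBH i)).1 (lform (sval g i))) (@hincL i).
    have L2 := lin_comp (@hincL i) (tmap_lin gL idL).
    move: (u); apply: tensor_lin_eq => [||w h]; [exact: L1|exact: L2|].
    rewrite (tmap_tens _ _ gL idL) !hinc_tens (ah_mul (@lfH i)).
    by rewrite -!mulrA lform_hpartC.
  rewrite (hchi_derivative_hinc e) (hchi_derivative_hinc xu) dloc_mulr ?bE // -xu.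
  by rewrite (sgn_homog (hx i)) uscalerAl.
Qed.
End DerivativeOfForms.

(** The relation [local_forms] determines [N] from [A] and [A] from [N]; as [F] and [K] both respect
    it, they are mutually inverse without further computation. *)
Lemma correspondence b :
  exists F : {N : hor -> hor | covariant_derivative b N} ->
             {A : forall i, H -> GB i | connection_forms T A},
    bijective F /\ forall N, local_forms (sval N) (sval (F N)).
Proof.
pose F (N : {N : hor -> hor | covariant_derivative b N}) :
    {A : forall i, H -> GB i | connection_forms T A} :=
  exist _ _ (derivative_forms_connection (svalP N)).
have FP N : local_forms (sval N) (sval (F N)) := derivative_formsP (svalP N).
pose K (A : {A : forall i, H -> GB i | connection_forms T A}) :
    {N : hor -> hor | covariant_derivative b N} :=
  exist _ _ (forms_derivativeP b (svalP A)).
have KP A : local_forms (sval (K A)) (sval A) := forms_derivative_local b (svalP A).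
have AL (A : {A : forall i, H -> GB i | connection_forms T A}) := cf_lin (svalP A).
exists F; split=> //; exists K => [N|A]; apply: sval_inj.
- exact: derivative_inj (AL (F N)) (svalP (K (F N))) (svalP N) (KP (F N)) (FP N).
- exact: local_forms_inj (AL (F (K A))) (AL A) (FP (K A)) (KP A).
Qed.
End Correspondence.

Theorem proposition10 (R : realType) (H : hopf R[i]) (P B : ualgType R[i])
    (I : finType) (Q : qpfb H P B I) (T : transitions Q) (D : diff_structure Q)
    (E : transition_ext D T) :
  (exists F : {N : hor E -> hor E | left_covariant_derivative N} ->
              {A : forall i, H -> GB D i | connection_forms T A},
     bijective F /\ forall N, local_forms (sval N) (sval (F N)))
  /\
  (exists F : {N : hor E -> hor E | right_covariant_derivative N} ->
              {A : forall i, H -> GB D i | connection_forms T A},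
     bijective F /\ forall N, local_forms (sval N) (sval (F N))).
Proof. by split; [exact: (correspondence E true)|exact: (correspondence E false)]. Qed.
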